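(* Let $n,m\ge1$ be integers. For any anti-blocking bodies $A,B_1,\ldots,B_m\subset\mathbb{R}^n_+$ and every choice of signs, $$|A|^{m-1}\,|A\pm B_1\pm\cdots\pm B_m|\le \zeta_{n,m}\prod_{i=1}^m|A-B_i|,$$ where $$\zeta_{n,m}:=\max d_{n,m}(\alpha_1,\ldots,\alpha_m),\qquad d_{n,m}(\alpha_1,\ldots,\alpha_m):=\frac{\prod_{i=1}^m\binom{\alpha_i}{N}}{\binom{n}{N}^{m-1}},\qquad N=\sum_{i=1}^m\alpha_i-n(m-1),$$ the maximum being over all integers $0\le\alpha_1,\dots,\alpha_m\le n$ with $N\ge0$. Moreover, $\zeta_{n,m}$ is the best possible (smallest) constant for which this inequality holds for all such bodies and signs.
   Context: $\mathbb{R}^n_+=[0,\infty)^n$. A convex body is a nonempty compact convex set. A coordinate subspace is one spanned by a subset of the standard basis $e_1,\dots,e_n$. A convex body $K\subset\mathbb{R}^n_+$ is anti-blocking if $P_EK=K\cap E$ for every coordinate subspace $E$, where $P_E$ is the orthogonal projection onto $E$. Sums are Minkowski sums: $K+L=\{x+y:x\in K,y\in L\}$, and $K-L=K+(-L)$. $|\cdot|$ is $n$-dimensional Lebesgue measure. *)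

(* Defs.v *)
(* R^n is 'rV[R]_n for an arbitrary R : realType. *)
From HB Require Import structures.
From mathcomp Require Import all_boot all_order all_algebra.
From mathcomp Require Import all_classical all_reals all_analysis.

Set Implicit Arguments.
Unset Strict Implicit.
Unset Printing Implicit Defensive.

Import Order.TTheory GRing.Theory Num.Theory.
Import numFieldNormedType.Exports.

Local Open Scope classical_set_scope.
Local Open Scope ring_scope.

Definition rV_display : measure_display.
Proof. exact: default_measure_display. Qed.

Section measurable_rV.
Context {R : realType} (n : nat).

Definition rV_coord (i : 'I_n) (v : 'rV[R]_n) : measurableTypeR R := v 0 i.

Let rV_set0 : g_sigma_preimage rV_coord set0.
Proof. exact: sigma_algebra0. Qed.

Let rV_setC A : g_sigma_preimage rV_coord A -> g_sigma_preimage rV_coord (~` A).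
Proof. exact: sigma_algebraC. Qed.

Let rV_bigcup (F : (set 'rV[R]_n)^nat) :
  (forall i, g_sigma_preimage rV_coord (F i)) ->
  g_sigma_preimage rV_coord (\bigcup_i (F i)).
Proof. exact: sigma_algebra_bigcup. Qed.

(* The product sigma-algebra, i.e. the Borel sigma-algebra of R^n. *)
HB.instance Definition _ := @isMeasurable.Build rV_display 'rV[R]_n
  (g_sigma_preimage rV_coord) rV_set0 rV_setC rV_bigcup.

End measurable_rV.

Section measurable_rV_theory.
Context {R : realType}.

Lemma measurable_rV_coord n (i : 'I_n) :
  measurable_fun [set: 'rV[R]_n] (rV_coord i).
Proof.
move=> _ Y mY; rewrite setTI; apply: sub_sigma_algebra => /=.
rewrite -bigcup_seq/=; exists i => /=; first by rewrite mem_index_enum.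
by exists Y => //; rewrite setTI.
Qed.

Lemma measurable_fun_rVP d (T : measurableType d) n (f : T -> 'rV[R]_n) :
  (forall i, measurable_fun [set: T] (rV_coord i \o f)) ->
  measurable_fun [set: T] f.
Proof.
move=> mf; apply: (@measurability _ _ _ _ _ f
  (\big[setU/set0]_(i < n) preimage_set_system setT (@rV_coord R n i) measurable)).
  by [].
move=> _ [B +] <-; rewrite -bigcup_seq /= => -[i _ [C mC <-]].
by have := mf i measurableT C mC; rewrite !setTI.
Qed.

Definition rV_cons n (p : measurableTypeR R * 'rV[R]_n) : 'rV[R]_n.+1 :=
  row_mx (const_mx p.1 : 'rV[R]_1) p.2.

Definition rV_uncons n (v : 'rV[R]_n.+1) : measurableTypeR R * 'rV[R]_n :=
  (v 0 0, rsubmx (v : 'rV[R]_(1 + n))).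

Lemma rV_cons0 n (p : measurableTypeR R * 'rV[R]_n) : rV_cons p 0 0 = p.1.
Proof.
rewrite (_ : 0 = lshift n (0 : 'I_1)); last exact: val_inj.
by apply: etrans (row_mxEl _ _ _ _) _; rewrite mxE.
Qed.

Lemma rV_consS n (p : measurableTypeR R * 'rV[R]_n) (i : 'I_n) :
  rV_cons p 0 (lift ord0 i) = p.2 0 i.
Proof.
rewrite (_ : lift ord0 i = rshift 1 i); last exact: val_inj.
exact: row_mxEr.
Qed.

Lemma rV_consK n : cancel (@rV_cons n) (@rV_uncons n).
Proof.
by move=> [x v]; rewrite /rV_uncons [X in (X, _)]rV_cons0 /rV_cons row_mxKr.
Qed.

Lemma measurable_rV_cons n : measurable_fun setT (@rV_cons n).
Proof.
apply: measurable_fun_rVP => i.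
have [j ->|->] := unliftP ord0 i.
  rewrite [X in measurable_fun _ X](_ : _ = rV_coord j \o snd).
    by apply: measurableT_comp => //; exact: measurable_rV_coord.
  by apply/funext => p; exact: rV_consS.
rewrite [X in measurable_fun _ X](_ : _ = fst)//.
by apply/funext => p; exact: rV_cons0.
Qed.

Lemma measurable_rV_uncons n : measurable_fun setT (@rV_uncons n).
Proof.
apply: measurable_fun_pair; first exact: measurable_rV_coord.
apply: measurable_fun_rVP => i.
rewrite [X in measurable_fun _ X](_ : _ = rV_coord (rshift 1 i)).
  exact: measurable_rV_coord.
by apply/funext => v; rewrite /= /rV_coord mxE.
Qed.

End measurable_rV_theory.

Section rV_product_measure.
Context {R : realType} (n : nat).
Variable mu : {sigma_finite_measure set 'rV[R]_n -> \bar R}.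

Definition rV_product : set 'rV[R]_n.+1 -> \bar R :=
  pushforward (lebesgue_measure \x mu)%E (@rV_cons R n).

Let measurable_preimage A : measurable A -> measurable (@rV_cons R n @^-1` A).
Proof. by move=> mA; rewrite -[X in measurable X]setTI; exact: measurable_rV_cons. Qed.

Let rV_product0 : rV_product set0 = 0%E.
Proof. by rewrite /rV_product /pushforward preimage_set0 measure0. Qed.

Let rV_product_ge0 A : (0 <= rV_product A)%E.
Proof. by rewrite /rV_product /pushforward measure_ge0. Qed.

Let rV_product_sigma_additive : semi_sigma_additive rV_product.
Proof.
move=> F mF tF mUF; rewrite /rV_product /pushforward preimage_bigcup.
apply: measure_semi_sigma_additive.
- by move=> k; exact: measurable_preimage.
- apply/trivIsetP => /= i j _ _ ij; rewrite -preimage_setI.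
  by move/trivIsetP : tF => /(_ _ _ _ _ ij) ->//; rewrite preimage_set0.
- by rewrite -preimage_bigcup; exact: measurable_preimage.
Qed.

HB.instance Definition _ := isMeasure.Build _ _ _ rV_product
  rV_product0 rV_product_ge0 rV_product_sigma_additive.

Let rV_product_sigma_finite : sigma_finite setT rV_product.
Proof.
have /sigma_finiteP[F [TF ndF Foo]] := sigma_finiteT (@lebesgue_measure R).
have /sigma_finiteP[G [TG ndG Goo]] := sigma_finiteT mu.
exists (fun k => @rV_uncons R n @^-1` (F k `*` G k)).
  rewrite -preimage_bigcup (_ : \bigcup_k (F k `*` G k) = setT) ?preimage_setT//.
  apply/seteqP; split => // -[x v] _.
  have [k _ Fkx] : (\bigcup_k F k) x by rewrite -TF.
  have [l _ Glv] : (\bigcup_k G k) v by rewrite -TG.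
  exists (maxn k l) => //; split => /=.
    by move: x Fkx; exact/subsetPset/ndF/leq_maxl.
  by move: v Glv; exact/subsetPset/ndG/leq_maxr.
move=> k; have [mF Fk] := Foo k; have [mG Gk] := Goo k; split.
  rewrite -[X in measurable X]setTI; apply: measurable_rV_uncons => //.
  exact: measurableX.
rewrite /rV_product /pushforward -comp_preimage.
rewrite (_ : _ \o _ = id) ?preimage_id; last first.
  by apply/funext => p; rewrite /= rV_consK.
by rewrite product_measure1E// lte_mul_pinfty// ge0_fin_numE.
Qed.

HB.instance Definition _ := Measure_isSigmaFinite.Build _ _ _ rV_product
  rV_product_sigma_finite.

End rV_product_measure.

(* n-dimensional Lebesgue measure, as the n-fold product measure transported
   along R * R^n = R^(n+1). *)
Fixpoint lebesgue_rV {R : realType} (n : nat) :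
    {sigma_finite_measure set 'rV[R]_n -> \bar R} :=
  if n is n'.+1 return {sigma_finite_measure set 'rV[R]_n -> \bar R}
  then rV_product (lebesgue_rV n')
  else \d_ (0 : 'rV[R]_0).

Lemma lebesgue_rV_box (R : realType) n (A : 'I_n -> set R) :
  (forall i, measurable (A i : set (measurableTypeR R))) ->
  lebesgue_rV n [set v | forall i, A i (v 0 i)] =
    (\prod_(i < n) lebesgue_measure (A i))%E.
Proof.
elim: n A => [|n IHn] A mA.
  by rewrite big_ord0 /= diracE mem_set// => -[].
pose S : set 'rV[R]_n := [set v | forall i, A (lift ord0 i) (v 0 i)].
have mS : measurable S.
  rewrite (_ : S = \bigcap_(i in [set: 'I_n]) rV_coord i @^-1` A (lift ord0 i)).
    apply: fin_bigcap_measurable => // i _.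
    by rewrite -[X in measurable X]setTI; exact: measurable_rV_coord.
  by apply/seteqP; split => v Sv i; [move=> _|]; exact: Sv.
rewrite big_ord_recl /= -(IHn (fun i => A (lift ord0 i)))//.
rewrite /rV_product /pushforward -product_measure1E//.
congr (product_measure1 _ _ _); apply/seteqP; split => -[x v] /= => [Av|[Ax Av] i].
  split => [|i]; first by have := Av ord0; rewrite rV_cons0.
  by have := Av (lift ord0 i); rewrite rV_consS.
by have [j ->|->] := unliftP ord0 i; rewrite ?rV_consS ?rV_cons0//; exact: Av.
Qed.

Section anti_blocking.
Context {R : realType} (n : nat).
Implicit Types A B K : set 'rV[R]_n.

Definition minkowski_sum A B : set 'rV[R]_n := [set a + b | a in A & b in B].

Definition opp_set A : set 'rV[R]_n := [set - a | a in A].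

Definition nonneg_orthant : set 'rV[R]_n := [set x | forall i, 0 <= x 0 i].

Definition convex_body K := [/\ K !=set0, compact K & convex_set K].

Definition coord_subspace (I : {set 'I_n}) : {vspace 'rV[R]_n} :=
  <<[seq (delta_mx 0 i : 'rV[R]_n)%R | i in I]>>%VS.

Definition is_orth_proj (E : {vspace 'rV[R]_n}) (x y : 'rV[R]_n) :=
  y \in E /\ forall z, z \in E -> (x - y) *m z^T = 0.

Definition orth_proj_image (E : {vspace 'rV[R]_n}) K : set 'rV[R]_n :=
  [set y | exists2 x, K x & is_orth_proj E x y].

Definition anti_blocking K :=
  [/\ K `<=` nonneg_orthant, convex_body K &
      forall I : {set 'I_n}, orth_proj_image (coord_subspace I) K =
        K `&` [set` coord_subspace I]].

End anti_blocking.

Section zeta.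
Context {R : realType} (n m : nat).
Implicit Types alpha : {ffun 'I_m -> 'I_n.+1}.

(* N >= 0 *)
Definition zeta_admissible alpha : bool :=
  (n * (m - 1) <= \sum_(i < m) alpha i)%N.

(* The truncated subtraction is exact on admissible alpha. *)
Definition zeta_N alpha : nat := (\sum_(i < m) alpha i - n * (m - 1))%N.

Definition zeta_d alpha : R :=
  (\prod_(i < m) 'C(alpha i, zeta_N alpha))%:R /
  ('C(n, zeta_N alpha) ^ (m - 1))%:R.

(* The default value 0 does not affect the maximum: zeta_d is nonnegative, and
   the constant family alpha = n is admissible. *)
Definition zeta : R :=
  \big[Num.max/0]_(alpha | zeta_admissible alpha) zeta_d alpha.

End zeta.

(* A +- B_1 +- ... +- B_m, where s i = false means the sign of B_i is minus. *)
Definition signed_sum (R : realType) (n m : nat) (A : set 'rV[R]_n)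
    (B : 'I_m -> set 'rV[R]_n) (s : 'I_m -> bool) : set 'rV[R]_n :=
  minkowski_sum A
    (\big[@minkowski_sum R n/[set 0]]_(i < m)
       if s i then B i else opp_set (B i)).

Definition sumset_bound (R : realType) (n m : nat) (C : R) :=
  forall (A : set 'rV[R]_n) (B : 'I_m -> set 'rV[R]_n) (s : 'I_m -> bool),
    anti_blocking A -> (forall i, anti_blocking (B i)) ->
    (lebesgue_rV n A ^+ (m - 1) * lebesgue_rV n (signed_sum A B s) <=
     C%:E * \prod_(i < m) lebesgue_rV n (minkowski_sum A (opp_set (B i))))%E.

(* Main.v *)
(* Splitting coordinate by coordinate bounds the volume of A +- B_1 +- ... +- B_m (with B_0 = A)
   by the sum, over all colorings c of the coordinates by 0, ..., m, of the products over i of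
   the volumes of the projections of B_i on the coordinates of color i, and bounds |A - B_i|
   from below by the sum, over all subsets J of the coordinates, of the products of the volumes
   of the projections of A and B_i on the complement of J and on J. Expanding the product of
   these lower bounds, the upper inequality follows from a reverse Bezout inequality for A
   alone: if the coordinates are partitioned into I_0, ..., I_m, |I_0| = N, and E_i is the
   complement of I_i, of size alpha_i, then
     (C(n,N) |A|)^(m-1) |P_{I_0} A| <= \prod_i C(alpha_i,N) |P_{E_i} A|.
   For this, let G(y) be the volume of the fibre of A over y, in the coordinates I_0, and let
   V_p(u) be the volume of the section of {G >= u G(0)} by p of the other coordinates. By
   Brunn-Minkowski V_p(u) / (1 - u^(1/N))^p is nondecreasing; the Loomis-Whitney-Finner
   inequality bounds V_q(u)^(m-1) by the product of the V_{p_i}(u), and a Berwald-type argument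
   (each V_{p_i} crosses a multiple of (1 - u^(1/N))^{p_i} at most once, then AM-GM) compares
   the integrals over u with those for the body
     A* = {x >= 0 : sum_{I_0} x + x_j <= 1 for all j outside I_0},
   where there is equality. Sharpness: take A = A* and for B_i the cube of side t in the
   coordinates I_i, and let t tend to infinity. *)
Require Import Defs.
From mathcomp Require Import all_boot all_order all_algebra.
From mathcomp Require Import all_classical all_reals all_analysis.
From mathcomp Require Import measurable_realfun.
From mathcomp Require Import ring lra zify.

Set Implicit Arguments.
Unset Strict Implicit.
Unset Printing Implicit Defensive.

Import Order.TTheory GRing.Theory Num.Theory.
Import numFieldNormedType.Exports.

Local Open Scope classical_set_scope.
Local Open Scope ring_scope.

(** Hölder's inequality in the level u is not enough for the reverse Bezout inequality: the m
    profiles V_{p_i} enter the bound of V_q with exponents 1/(m-1), which sum to more than 1.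
    Instead each profile is scaled to X_i, with integral at most that of tau^(p_i), where tau(u) = 1
    - u^(1/N). AM-GM then bounds the rescaled V_q - tau^q pointwise by a combination of the X_i -
    tau^(p_i) whose coefficients depend on u. The binomials enter because the integral of tau^j over
    ]0, 1[ is 1 / C(j + N, N). Projections of an anti-blocking body on coordinate subspaces are
    sections, so every volume becomes an iterated one-dimensional integral of an indicator, and the
    geometric inequalities become inductions over a list of coordinates. For a downward closed set
    each one-variable function met there is nonincreasing on the half-line, so its superlevel sets
    are initial intervals, determined by their right ends. *)

(** * Bounded nonnegative measurable functions *)

Section bounded_measurable.
Context d (T : measurableType d) (R : realType).
Implicit Types f g : T -> R.

(** Nonnegativity makes Tonelli's theorem available, and boundedness makes integrals over a bounded
    window finite. The class is stable under sums, products, sections and partial integration. *)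
Definition bm f := measurable_fun setT f /\ exists C, forall x, 0 <= f x <= C.

Lemma bm_ge0 f x : bm f -> 0 <= f x.
Proof. by move=> [_ [C /(_ x) /andP[]]]. Qed.

Lemma bm_bound f : bm f -> exists2 C, 0 < C & forall x, f x <= C.
Proof.
move=> [_ [C fC]]; exists (`|C| + 1); first by rewrite ltr_wpDl.
by move=> x; have /andP[_] := fC x; have := ler_norm C; lra.
Qed.

Lemma bmD f g : bm f -> bm g -> bm (fun x => f x + g x).
Proof.
move=> [mf [C fC]] [mg [D gD]]; split; first exact: measurable_funD.
by exists (C + D) => x; have := fC x; have := gD x; lra.
Qed.

Lemma bmM f g : bm f -> bm g -> bm (fun x => f x * g x).
Proof.
move=> [mf [C fC]] [mg [D gD]]; split; first exact: measurable_funM.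
exists (C * D) => x; have /andP[f0 fx] := fC x; have /andP[g0 gx] := gD x.
by rewrite mulr_ge0//= ler_pM.
Qed.

Lemma bm_cst (c : R) : 0 <= c -> bm (fun=> c).
Proof. by move=> c0; split; [exact: measurable_cst|exists c => x; rewrite c0 lexx]. Qed.

Lemma bm_indic (A : set T) : measurable A -> bm (\1_A : T -> R).
Proof.
move=> mA; split; first exact: measurable_indic.
by exists 1 => x; rewrite indicE; case: (_ \in _) => /=; rewrite ?ler01 ?lexx.
Qed.

Lemma bm_sum (I : Type) (s : seq I) (P : pred I) (F : I -> T -> R) :
  (forall i, P i -> bm (F i)) -> bm (fun x => \sum_(i <- s | P i) F i x).
Proof.
move=> bF; elim: s => [|i s IHs].
  rewrite [X in bm X](_ : _ = (fun=> 0) :> (T -> R)); first exact: bm_cst.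
  by apply/funext => x; rewrite big_nil.
rewrite [X in bm X](_ : _ = fun x => (if P i then F i x else 0) +
  \sum_(j <- s | P j) F j x).
  by apply: bmD => //; case: (P i) (bF i) => [bFi|_]; [exact: bFi|exact: bm_cst].
by apply/funext => x; rewrite big_cons; case: ifP => //; rewrite add0r.
Qed.

End bounded_measurable.

Lemma bm_comp d d' (T : measurableType d) (T' : measurableType d') (R : realType)
    (h : T' -> T) (f : T -> R) :
  measurable_fun setT h -> bm f -> bm (f \o h).
Proof.
move=> mh [mf [C fC]]; split; last by exists C => x; exact: fC.
exact: measurableT_comp.
Qed.

Lemma bm_section1 d d' (T : measurableType d) (T' : measurableType d') (R : realType)
    (f : T * T' -> R) x : bm f -> bm (fun y => f (x, y)).
Proof.
have m : measurable_fun setT (fun y : T' => (x, y)) by exact: measurable_fun_pair.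
by move=> bf; exact: (bm_comp m bf).
Qed.

Lemma bm_section2 d d' (T : measurableType d) (T' : measurableType d') (R : realType)
    (f : T * T' -> R) y : bm f -> bm (fun x => f (x, y)).
Proof.
have m : measurable_fun setT (fun x : T => (x, y)) by exact: measurable_fun_pair.
by move=> bf; exact: (bm_comp m bf).
Qed.

(** * Truncated integrals on the line, Fubini and lengths of intervals *)

Section integral_over_interval.
Context (R : realType) (M : R).
Hypothesis M_ge1 : 1 <= M.
Local Notation mu := (@lebesgue_measure R).
Implicit Types f g h : R -> R.

(* Integrals are truncated to [-M, M], so that they are finite for bounded functions; M is
   chosen large enough for all the bodies involved. *)
Definition cutoff (s : R) : R := \1_(`[- M, M]%classic) s.

Definition Int f : R := fine (\int[mu]_s (f s * cutoff s)%:E)%E.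

Lemma bm_cutoff : bm cutoff.
Proof. by apply: bm_indic. Qed.

Lemma cutoff_ge0 s : 0 <= cutoff s.
Proof. exact: (bm_ge0 _ bm_cutoff). Qed.

Lemma cutoff1 s : -M <= s <= M -> cutoff s = 1.
Proof. by move=> sM; rewrite /cutoff indicE mem_set//= in_itv. Qed.

Lemma cutoff0 s : ~~ (-M <= s <= M) -> cutoff s = 0.
Proof. by move=> sM; rewrite /cutoff indicE memNset//= in_itv/=; exact/negP. Qed.

Lemma integral_cutoff : (\int[mu]_s (cutoff s)%:E = (M + M)%:E)%E.
Proof.
rewrite integral_indic//= setIT lebesgue_measure_itv/= lte_fin ifT.
  by rewrite -EFinB opprK.
by have := M_ge1; lra.
Qed.

Let mfc f : bm f -> measurable_fun setT (fun s => (f s * cutoff s)%:E).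
Proof. by move=> bf; apply/measurable_EFinP; have [] := bmM bf bm_cutoff. Qed.

Let fc0 f : bm f -> forall s, (0 <= (f s * cutoff s)%:E)%E.
Proof. by move=> bf s; rewrite lee_fin (bm_ge0 _ (bmM bf bm_cutoff)). Qed.

Lemma IntE f : bm f -> (\int[mu]_s (f s * cutoff s)%:E = (Int f)%:E)%E.
Proof.
move=> bf; have [C C0 fC] := bm_bound bf.
rewrite /Int fineK// ge0_fin_numE; last by apply: integral_ge0 => s _; exact: fc0.
apply: (@le_lt_trans _ _ (\int[mu]_s (C%:E * (cutoff s)%:E))%E).
  apply: ge0_le_integral => //=.
  - by move=> s _; exact: fc0.
  - exact: mfc.
  - by apply/measurable_EFinP/measurable_funM => //; have [] := bm_cutoff.
  - by move=> s _; rewrite -EFinM lee_fin ler_wpM2r// cutoff_ge0.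
rewrite ge0_integralZl//=.
- by rewrite integral_cutoff -EFinM ltry.
- by apply/measurable_EFinP; have [] := bm_cutoff.
- by move=> s _; rewrite lee_fin cutoff_ge0.
- by rewrite lee_fin ltW.
Qed.

Lemma Int_ge0 f : bm f -> 0 <= Int f.
Proof.
by move=> bf; rewrite -lee_fin -IntE//; apply: integral_ge0 => s _; exact: fc0.
Qed.

Lemma Int_le f g : bm f -> bm g -> (forall s, -M <= s <= M -> f s <= g s) ->
  Int f <= Int g.
Proof.
move=> bf bg fg; rewrite -lee_fin -!IntE//; apply: ge0_le_integral => //=.
- by move=> s _; exact: fc0.
- exact: mfc.
- exact: mfc.
- move=> s _; rewrite lee_fin; case: (boolP (-M <= s <= M)) => sM.
    by rewrite ler_wpM2r ?cutoff_ge0 ?fg.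
  by rewrite cutoff0// !mulr0.
Qed.

Lemma eq_Int f g : (forall s, -M <= s <= M -> f s = g s) -> Int f = Int g.
Proof.
move=> fg; rewrite /Int; congr (fine (integral _ _ _)); apply/funext => s.
case: (boolP (-M <= s <= M)) => sM; first by rewrite fg.
by rewrite cutoff0// !mulr0.
Qed.

Lemma IntD f g : bm f -> bm g -> Int (fun s => f s + g s) = Int f + Int g.
Proof.
move=> bf bg; apply: EFin_inj; rewrite EFinD -!IntE//; last exact: bmD.
rewrite -ge0_integralD//=.
- by apply: eq_integral => s _; rewrite mulrDl EFinD.
- by move=> s _; exact: fc0.
- exact: mfc.
- by move=> s _; exact: fc0.
- exact: mfc.
Qed.

Lemma IntZ c f : 0 <= c -> bm f -> Int (fun s => c * f s) = c * Int f.
Proof.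
move=> c0 bf; apply: EFin_inj; rewrite EFinM -!IntE//; last first.
  by apply: bmM => //; exact: bm_cst.
rewrite -ge0_integralZl//=.
- by apply: eq_integral => s _; rewrite -EFinM mulrA.
- exact: mfc.
- by move=> s _; exact: fc0.
Qed.

Lemma Int0 : Int (fun=> 0) = 0.
Proof.
by rewrite /Int; under eq_integral do rewrite mul0r; rewrite integral0.
Qed.

Lemma Int_sum (I : Type) (s : seq I) (P : pred I) (F : I -> R -> R) :
  (forall i, P i -> bm (F i)) ->
  Int (fun x => \sum_(i <- s | P i) F i x) = \sum_(i <- s | P i) Int (F i).
Proof.
move=> bF; elim: s => [|i s IHs].
  by rewrite big_nil -[RHS]Int0; apply: eq_Int => s _; rewrite big_nil.
rewrite big_cons; case: ifPn => Pi.
  rewrite -IHs -IntD//; last 2 first.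
  - exact: bF.
  - exact: bm_sum.
  by apply: eq_Int => x _; rewrite big_cons Pi.
by rewrite -IHs; apply: eq_Int => x _; rewrite big_cons (negPf Pi).
Qed.

Lemma IntN f : bm f -> Int (fun s => f (- s)) = Int f.
Proof.
move=> bf; rewrite /Int; congr fine.
transitivity (\int[pushforward mu (-%R : R -> measurableTypeR R)]_s
    (f s * cutoff s)%:E)%E.
  rewrite ge0_integral_pushforward//=.
  - rewrite preimage_setT; apply: eq_integral => s _ /=; congr (f _ * _)%:E.
    rewrite /cutoff !indicE; congr ((nat_of_bool _)%:R).
    by apply/idP/idP; rewrite !inE/= !in_itv/=; lra.
  - exact: mfc.
  - by move=> s _; exact: fc0.
by apply: eq_measure_integral => //= A mA AS; exact: lebesgue_measureN.
Qed.

Lemma Int_indic_itv (b0 b1 : bool) (a b : R) : -M <= a -> a <= b -> b <= M ->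
  Int \1_[set` Interval (BSide b0 a) (BSide b1 b)] = b - a.
Proof.
move=> Ma ab bM; set D := [set` _]; rewrite /Int.
have DM : D `&` `[- M, M]%classic = D.
  apply/setIidl => s; rewrite /D /= !in_itv/= => /andP[sa sb].
  have {}sa : a <= s by case: (b0) sa; rewrite ?bnd_simp// => /ltW.
  have {}sb : s <= b by case: (b1) sb; rewrite ?bnd_simp// => /ltW.
  by rewrite (le_trans Ma)//= (le_trans sb).
rewrite (_ : (fun _ => _) = fun s => (\1_(D `&` `[- M, M]%classic) s)%:E); last first.
  by apply/funext => s; rewrite /cutoff indicI.
rewrite integral_indic//=; last first.
  by rewrite DM; exact: measurable_itv.
rewrite setIT DM lebesgue_measure_itv/= lte_fin.
by case: ltgtP ab => // -> _; rewrite subrr.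
Qed.

End integral_over_interval.

Section integral_fubini.
Context (R : realType) (M : R).
Hypothesis M_ge1 : 1 <= M.
Local Notation mu := (@lebesgue_measure R).

Lemma bm_Int d (T : measurableType d) (f : T * R -> R) :
  bm f -> bm (fun x => Int M (fun s => f (x, s))).
Proof.
move=> bf; have [C C0 fC] := bm_bound bf.
have bfx x : bm (fun s => f (x, s)).
  exact: bm_section1.
split; last first.
  exists (C * Int M (fun=> 1)) => x; rewrite Int_ge0//=.
  rewrite -IntZ//; [|exact: ltW|exact: bm_cst].
  by apply: Int_le => //; [apply: bm_cst; rewrite mulr1 ltW|move=> s _; rewrite mulr1].
apply/measurable_EFinP.
rewrite (_ : _ \o _ =
    fubini_F mu (fun z : T * R => (f z * cutoff M z.2)%:E)); last first.
  by apply/funext => x /=; rewrite -IntE.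
have bfc : bm (fun z : T * R => f z * cutoff M z.2).
  by apply: bmM => //; apply: (bm_comp measurable_snd (bm_cutoff M)).
apply: measurable_fun_fubini_tonelli_F.
  by apply/measurable_EFinP; case: bfc.
by move=> z; rewrite lee_fin (bm_ge0 _ bfc).
Qed.

Lemma Int_swap (f : R * R -> R) : bm f ->
  Int M (fun s => Int M (fun t => f (s, t))) =
  Int M (fun t => Int M (fun s => f (s, t))).
Proof.
move=> bf.
have bf1 s : bm (fun t => f (s, t)) by exact: bm_section1.
have bf2 t : bm (fun s => f (s, t)) by exact: bm_section2.
have bF := bm_Int bf.
have bG : bm (fun t => Int M (fun s => f (s, t))).
  apply: (bm_Int (f := fun z => f (z.2, z.1))).
  have m : measurable_fun setT (fun z : R * R => (z.2, z.1)) by exact: measurable_fun_pair.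
  exact: (bm_comp m bf).
have bc := bm_cutoff M.
pose g z := (f z * cutoff M z.1 * cutoff M z.2)%:E.
have bg : bm (fun z => f z * cutoff M z.1 * cutoff M z.2).
  by do 2?apply: bmM => //; [apply: (bm_comp measurable_fst)|apply: (bm_comp measurable_snd)].
have mg : measurable_fun setT g by apply/measurable_EFinP; case: bg.
have g0 z : (0 <= g z)%E by rewrite lee_fin (bm_ge0 _ bg).
have := @fubini_tonelli1 _ _ _ _ _ mu mu g mg g0.
rewrite (@fubini_tonelli2 _ _ _ _ _ mu mu g mg g0) => E.
apply: EFin_inj; rewrite -(IntE M_ge1 bF) -(IntE M_ge1 bG).
transitivity (\int[mu]_x fubini_F mu g x)%E; last rewrite -E.
  apply: eq_integral => s _; rewrite /fubini_F /g mulrC.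
  rewrite -(IntZ M_ge1 (cutoff_ge0 M s) (bf1 s)).
  rewrite -(IntE M_ge1 (bmM (bm_cst _ (cutoff_ge0 M s)) (bf1 s))).
  by apply: eq_integral => t _; rewrite (mulrC (cutoff M s)).
apply: eq_integral => t _; rewrite /fubini_G /g mulrC.
rewrite -(IntZ M_ge1 (cutoff_ge0 M t) (bf2 t)).
rewrite -(IntE M_ge1 (bmM (bm_cst _ (cutoff_ge0 M t)) (bf2 t))).
by apply: eq_integral => s _; rewrite -[in RHS]mulrA [in RHS]mulrC.
Qed.

End integral_fubini.

Section interval_lengths.
Context (R : realType) (M : R).
Hypothesis M_ge1 : 1 <= M.
Local Notation mu := (@lebesgue_measure R).
Local Notation Int := (Int M).

Lemma Int_indic_le (D : set R) (a b : R) : measurable D -> a <= b ->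
  (forall s, -M <= s <= M -> D s -> a <= s <= b) -> Int \1_D <= b - a.
Proof.
move=> mD ab Dab.
have [[s0 [sM Ds0]]|h] := pselect (exists s, -M <= s <= M /\ D s); last first.
  rewrite (@eq_Int _ _ _ (fun=> 0)) ?Int0 ?subr_ge0// => s sM.
  by rewrite indicE memNset// => Ds; apply: h; exists s.
have h0 := Dab _ sM Ds0.
(* The interval is cut by the window [-M, M]; the point [s0] lies in both, so the cut endpoints are
   still in order. *)
have := Int_indic_itv (M := M) true false (a := Num.max (-M) a) (b := Num.min M b).
have H1 : - M <= Num.max (- M) a by rewrite le_max lexx.
have H2 : Num.max (- M) a <= Num.min M b.
  rewrite ge_max !le_min ab; lra.
have H3 : Num.min M b <= M by rewrite ge_min lexx.
move=> /(_ H1 H2 H3) E.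
have : Int \1_D <= Num.min M b - Num.max (- M) a.
  rewrite -E; apply: Int_le => //.
  - exact: bm_indic.
  - by apply: bm_indic; exact: measurable_itv.
  - move=> s sM'; rewrite !indicE; case: (boolP (s \in D)) => [/set_mem Ds|_].
      rewrite mem_set//= in_itv/= ge_max le_min.
      by have := Dab _ sM' Ds; lra.
    by rewrite ler0n.
have : Num.min M b <= b by rewrite ge_min lexx orbT.
have : a <= Num.max (-M) a by rewrite le_max lexx orbT.
lra.
Qed.

Lemma Int_indic_ge (D : set R) (a b : R) : measurable D ->
  -M <= a -> a <= b -> b <= M ->
  (forall s, a <= s <= b -> D s) -> b - a <= Int \1_D.
Proof.
move=> mD Ma ab bM Dab; rewrite -(Int_indic_itv true false Ma ab bM).
apply: Int_le => //.
- by apply: bm_indic; exact: measurable_itv.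
- exact: bm_indic.
- move=> s _; rewrite !indicE; case: (boolP (s \in D)) => Ds; first by rewrite lern1 leq_b1.
  by rewrite memNset//= in_itv/= => /Dab/mem_set; apply/negP.
Qed.

Lemma Int_unit_le (y : R) : 0 <= y <= 1 ->
  Int \1_[set u | 0 < u < 1 /\ u <= y] = y.
Proof.
move=> /andP[y0]; rewrite le_eqVlt => /orP[/eqP ->|y1].
  rewrite (_ : [set _ | _] = `]0, 1[%classic).
    by rewrite Int_indic_itv ?subr0//; have := M_ge1; lra.
  by apply/seteqP; split => u /=; rewrite in_itv/=; lra.
rewrite (_ : [set _ | _] = `]0, y]%classic).
  by rewrite Int_indic_itv ?subr0//; have := M_ge1; lra.
by apply/seteqP; split => u /=; rewrite in_itv/=; lra.
Qed.

End interval_lengths.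

(** * The layer-cake formula *)

Section layer_cake.
Context (R : realType) (M : R).
Hypothesis M_ge1 : 1 <= M.
Local Notation Int := (Int M).

(** The region below the graph of f / c, kept as a subset of the product so that the layer-cake
    formula is Fubini for its indicator. Heights are strictly positive, so points where f vanishes
    do not count. *)
Definition level d (T : measurableType d) (c : R) (f : T -> R) : set (R * T) :=
  [set z | 0 < z.1 < 1 /\ c * z.1 <= f z.2].

Lemma measurable_level d (T : measurableType d) (c : R) (f : T -> R) :
  measurable_fun setT f -> measurable (level c f).
Proof.
move=> mf; pose b (z : R * T) := (0 < z.1) && (z.1 < 1) && (c * z.1 <= f z.2).
rewrite (_ : level c f = setT `&` b @^-1` [set true]).
  have mb : measurable_fun setT b; last exact: mb.
  apply: measurable_and; first apply: measurable_and.
  - exact: measurable_fun_ltr.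
  - exact: measurable_fun_ltr.
  - apply: measurable_fun_ler; first by apply: measurable_funM.
    exact: measurableT_comp.
rewrite setTI; apply/seteqP; split => z; rewrite /level /b /=.
  by move=> [-> ->].
by move=> /andP[-> ->].
Qed.

Lemma bm_level d (T : measurableType d) (c : R) (f : T -> R) :
  bm f -> bm (\1_(level c f) : _ -> R).
Proof. by move=> [mf _]; apply: bm_indic; exact: measurable_level. Qed.

Lemma Int_level_point (c y : R) : 0 < c -> 0 <= y ->
  Int (fun u => \1_[set z : R | 0 < z < 1 /\ c * z <= y] u) = Num.min 1 (y / c).
Proof.
move=> c0 y0; rewrite -(@Int_unit_le _ M M_ge1 (Num.min 1 (y / c))); last first.
  by rewrite le_min ler01 divr_ge0 ?(ltW c0)//= ge_min lexx.
apply: eq_Int => u _; congr (\1_ _ u); apply/seteqP; split => z /= [z01 h]; split => //.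
  rewrite le_min ler_pdivlMr// mulrC h; lra.
by move: h; rewrite le_min ler_pdivlMr// mulrC => /andP[].
Qed.

Lemma layer_cake (c : R) (f : R -> R) : 0 < c -> bm f ->
  Int (fun u => Int (fun s => \1_(level c f) (u, s))) =
  Int (fun s => Num.min 1 (f s / c)).
Proof.
move=> c0 bf; rewrite Int_swap//; last exact: bm_level.
by apply: eq_Int => s _; rewrite -Int_level_point//; exact: bm_ge0.
Qed.

Lemma bm_min1 (c : R) (f : R -> R) : 0 < c -> bm f -> bm (fun s => Num.min 1 (f s / c)).
Proof.
move=> c0 bf; split; last first.
  exists 1 => s; rewrite ge_min lexx/= le_min ler01 divr_ge0//; last exact: ltW.
  by rewrite (bm_ge0 _ bf).
apply: measurable_minr => //.
by apply: measurable_funM; [case: bf|exact: measurable_cst].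
Qed.

Lemma bm_level_Int (c : R) (f : R -> R) : bm f ->
  bm (fun u => Int (fun s => \1_(level c f) (u, s))).
Proof. by move=> bf; apply: bm_Int => //; exact: bm_level. Qed.

Lemma layer_cake_eq (c : R) (f : R -> R) : 0 < c -> bm f ->
  (forall s, f s <= c) ->
  Int f = c * Int (fun u => Int (fun s => \1_(level c f) (u, s))).
Proof.
move=> c0 bf fc; rewrite layer_cake// -IntZ//; [|exact: ltW|exact: bm_min1].
apply: eq_Int => s _; rewrite (min_idPr _) ?ler_pdivrMr ?mul1r//.
by rewrite mulrC divfK// gt_eqF.
Qed.

(** Levels in ]0, 1[ only see the truncation of [f] at [c]. This version serves a function whose
    maximum may exceed the chosen scale, as happens for the mixed function in the Brunn-Minkowski
    step. *)
Lemma layer_cake_ge (c : R) (f : R -> R) : 0 < c -> bm f ->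
  c * Int (fun u => Int (fun s => \1_(level c f) (u, s))) <= Int f.
Proof.
move=> c0 bf; rewrite layer_cake// -IntZ//; [|exact: ltW|exact: bm_min1].
apply: Int_le => //.
  by apply: bmM; [apply: bm_cst; exact: ltW|exact: bm_min1].
by move=> s _; rewrite mulrC -ler_pdivlMr// ge_min lexx orbT.
Qed.

End layer_cake.

(** * Functions supported on the half-line and nonincreasing there *)

Section monotone_profiles.
Context (R : realType) (M : R).
Hypothesis M_ge1 : 1 <= M.
Local Notation Int := (Int M).

(** The behaviour of section volumes of a downward closed set along one coordinate. Superlevel sets
    are intervals starting at 0, so adding or scaling them amounts to adding or scaling their right
    ends. *)
Definition profile (f : R -> R) := [/\ bm f, (forall s, s < 0 -> f s = 0) &
  forall s t, 0 <= s -> s <= t -> f t <= f s].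

Lemma profile_max f s : profile f -> f s <= f 0.
Proof.
move=> [bf f0 fd]; case: (ltP s 0) => [/f0 ->|s0]; last exact: fd.
exact: bm_ge0.
Qed.

(** A superlevel set contains [0, s] with each of its points s, so its length dominates each of its
    points. Together with the next lemma this identifies the length with a supremum of points. *)
Lemma profile_level_ge f c u s : profile f -> 0 < c -> 0 < u < 1 ->
  0 <= s <= M -> c * u <= f s -> s <= Int (fun s => \1_(level c f) (u, s)).
Proof.
move=> [bf f0 fd] c0 u01 sM cu.
have -> : (fun s => \1_(level c f) (u, s)) = \1_[set s | level c f (u, s)] :> (R -> R).
  by apply/funext => t; rewrite !indicE; congr ((nat_of_bool _)%:R); apply/idP/idP; rewrite !inE.
rewrite -[leLHS]subr0; apply: Int_indic_ge => //; [|have := M_ge1; lra|lra|lra|].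
  have m : measurable_fun setT (fun s : R => (u, s)) by exact: measurable_fun_pair.
  rewrite -[X in measurable X]setTI; apply: m => //.
  by apply: measurable_level; case: bf.
move=> t ts; split => //=; apply: (le_trans cu); apply: fd; lra.
Qed.

Lemma profile_level_le f c u B : profile f -> 0 < c -> 0 < u < 1 -> 0 <= B ->
  (forall s, 0 <= s <= M -> c * u <= f s -> s <= B) ->
  Int (fun s => \1_(level c f) (u, s)) <= B.
Proof.
move=> [bf f0 fd] c0 u01 B0 h.
have -> : (fun s => \1_(level c f) (u, s)) = \1_[set s | level c f (u, s)] :> (R -> R).
  by apply/funext => t; rewrite !indicE; congr ((nat_of_bool _)%:R); apply/idP/idP; rewrite !inE.
rewrite -[leRHS]subr0; apply: Int_indic_le => //.
  have m : measurable_fun setT (fun s : R => (u, s)) by exact: measurable_fun_pair.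
  rewrite -[X in measurable X]setTI; apply: m => //.
  by apply: measurable_level; case: bf.
move=> s sM [/= _ cu].
have s0 : 0 <= s.
  rewrite leNgt; apply/negP => /f0 fs; move: cu; rewrite fs leNgt mulr_gt0//; lra.
by rewrite s0 h//; lra.
Qed.

Lemma level_out (f : R -> R) (c u : R) : ~~ (0 < u < 1) -> Int (fun s => \1_(level c f) (u, s)) = 0.
Proof.
move=> u01; rewrite -[RHS](Int0 M); apply: eq_Int => s _.
by rewrite indicE memNset// => -[/= h _]; rewrite h in u01.
Qed.

(** Argued level by level: m times the superlevel interval of [f] lies in that of [h], so no
    substitution in an integral is needed. The bound m <= 1 keeps m * s inside the window. *)
Lemma profile_scale f h (m : R) : profile f -> profile h -> 0 < m <= 1 ->
  (forall s, 0 <= s <= M -> f s <= h (m * s)) -> m * Int f <= Int h.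
Proof.
move=> pf ph m01 fh; have [bf _ _] := pf; have [bh _ _] := ph.
have m0 : 0 < m by lra.
have [C C0 fC] := bm_bound bf.
rewrite (layer_cake_eq M_ge1 C0 bf fC) mulrCA.
apply: le_trans (layer_cake_ge M_ge1 C0 bh).
rewrite ler_pM2l// -IntZ//; [|exact: ltW|exact: bm_level_Int].
apply: Int_le => //; [|exact: bm_level_Int|].
  by apply: bmM; [apply: bm_cst; exact: ltW|exact: bm_level_Int].
move=> u _; case: (boolP (0 < u < 1)) => u01; last by rewrite !level_out// mulr0.
rewrite mulrC -ler_pdivlMr//; apply: profile_level_le => //.
  rewrite divr_ge0//; [|exact: ltW].
  by apply: Int_ge0 => //; apply: bm_section1 (bm_level _ bh).
move=> s sM cu; rewrite ler_pdivlMr// mulrC; apply: profile_level_ge => //.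
  rewrite mulr_ge0/=; [|lra|lra].
  by apply: (@le_trans _ _ (1 * s)); [apply: ler_wpM2r; lra|lra].
by apply: (le_trans cu); exact: fh.
Qed.

End monotone_profiles.

(** * Convexity and AM-GM inequalities for powers *)

Section elementary_inequalities.
Context (R : realType).
Implicit Types a b c x y z t : R.

Lemma exists_root k x : (0 < k)%N -> 0 <= x -> exists2 a, 0 <= a & a ^+ k = x.
Proof.
move=> k0 x0; exists (x `^ k%:R^-1); first exact: powR_ge0.
rewrite -powR_mulrn ?powR_ge0// -powRrM mulVf ?powRr1//.
by rewrite pnatr_eq0 -lt0n.
Qed.

Lemma exists_root_gt0 k x : (0 < k)%N -> 0 < x -> exists2 a, 0 < a & a ^+ k = x.
Proof.
move=> k0 x0; have [a a0 ax] := exists_root k0 (ltW x0); exists a => //.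
rewrite lt_neqAle a0 andbT eq_sym; apply/eqP => a00.
by move: x0; rewrite -ax a00 expr0n eqn0Ngt k0 ltxx.
Qed.

Lemma exprS_tangent k x z : 0 <= x -> 0 <= z ->
  z ^+ k.+1 + k.+1%:R * z ^+ k * (x - z) <= x ^+ k.+1.
Proof.
move=> x0 z0; elim: k => [|k IHk]; first by rewrite !expr1 expr0; lra.
rewrite [leRHS]exprS; apply: le_trans (ler_wpM2l x0 IHk).
(* This square term is exactly x times the tangent at exponent k + 1 minus the tangent at exponent k
   + 2. *)
have : 0 <= k.+1%:R * (z ^+ k * (x - z) ^+ 2).
  by apply: mulr_ge0 => //; apply: mulr_ge0; [exact: exprn_ge0|exact: sqr_ge0].
rewrite -subr_ge0 => h; rewrite -subr_ge0; apply: le_trans h _.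
rewrite subr0 le_eqVlt; apply/orP; left; apply/eqP.
by rewrite [k.+2%:R]mulrS !exprS; ring.
Qed.

(** Joint convexity of x^(k+1) / a^k, the perspective of the power function. Both ratios x / a and y
    / b are compared with the tangent at the ratio [z] of the two mixtures; with the weights (1 - l)
    a and l b the first-order terms cancel. *)
Lemma perspective_convex k l a b x y : 0 < l < 1 -> 0 < a -> 0 < b -> 0 <= x -> 0 <= y ->
  ((1 - l) * x + l * y) ^+ k.+1 <=
  ((1 - l) * a + l * b) ^+ k *
    ((1 - l) * (x ^+ k.+1 / a ^+ k) + l * (y ^+ k.+1 / b ^+ k)).
Proof.
move=> l01 a0 b0 x0 y0; set c := (1 - l) * a + l * b.
have c0 : 0 < c by rewrite addr_gt0// mulr_gt0//; lra.
set z := ((1 - l) * x + l * y) / c.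
have z0 : 0 <= z.
  by rewrite divr_ge0 ?(ltW c0)// addr_ge0// mulr_ge0//; lra.
have E (w u : R) : 0 < u -> w ^+ k.+1 / u ^+ k = u * (w / u) ^+ k.+1.
  move=> u0; rewrite expr_div_n [u ^+ k.+1]exprS; field.
  by rewrite !gt_eqF ?exprn_gt0.
have Ec : (1 - l) * x + l * y = c * z by rewrite /z [RHS]mulrC divfK// gt_eqF.
rewrite Ec exprMn exprSr -mulrA ler_pM2l ?exprn_gt0// !E//.
have tx := exprS_tangent k (divr_ge0 x0 (ltW a0)) z0.
have ty := exprS_tangent k (divr_ge0 y0 (ltW b0)) z0.
have wa : 0 <= (1 - l) * a by rewrite mulr_ge0//; [lra|exact: ltW].
have wb : 0 <= l * b by rewrite mulr_ge0//; [lra|exact: ltW].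
rewrite !mulrA; apply: le_trans (lerD (ler_wpM2l wa tx) (ler_wpM2l wb ty)).
rewrite le_eqVlt; apply/orP; left; apply/eqP.
set K := _%:R * z ^+ k.
have Z : (1 - l) * a * (x / a - z) + l * b * (y / b - z) = 0.
  have -> : (1 - l) * a * (x / a - z) = (1 - l) * x - (1 - l) * a * z.
    by field; rewrite gt_eqF.
  have -> : l * b * (y / b - z) = l * y - l * b * z.
    by field; rewrite gt_eqF.
  transitivity (((1 - l) * x + l * y) - c * z); first by rewrite /c; ring.
  by rewrite Ec subrr.
transitivity (c * z ^+ k.+1 + K * ((1 - l) * a * (x / a - z) + l * b * (y / b - z))).
  by rewrite Z mulr0 addr0.
by rewrite /c; ring.
Qed.

(** The unweighted inequality over the sigma type in which [x i] is repeated [p i] times. *)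
Lemma weighted_AGM (I : finType) (p : I -> nat) (x : I -> R) :
  (forall i, 0 <= x i) ->
  \prod_i x i ^+ p i <= ((\sum_i (p i)%:R * x i) / (\sum_i p i)%N%:R) ^+ (\sum_i p i)%N.
Proof.
move=> x0.
have C : #|{: {i : I & 'I_(p i)}}| = (\sum_i p i)%N.
  rewrite card_tagged sumnE big_map big_enum/=.
  by apply: eq_bigr => i _; rewrite card_ord.
have S : \sum_(u : {i : I & 'I_(p i)}) x (tag u) = \sum_i (p i)%:R * x i.
  rewrite -(@sig_big_dep _ _ _ _ (fun i => 'I_(p i)) xpredT (fun _ => xpredT) (fun i _ => x i)).
  by apply: eq_bigr => i _; rewrite sumr_const card_ord mulr_natl.
have P : \prod_(u : {i : I & 'I_(p i)}) x (tag u) = \prod_i x i ^+ p i.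
  rewrite -(@sig_big_dep _ _ _ _ (fun i => 'I_(p i)) xpredT (fun _ => xpredT) (fun i _ => x i)).
  by apply: eq_bigr => i _; rewrite prodr_const card_ord.
have := @leif_AGM R {i : I & 'I_(p i)} {: {i : I & 'I_(p i)}}
  (fun u => x (tag u)) (fun u _ => x0 (tag u)).
by rewrite C S P => -[].
Qed.

Lemma AGM2 (p k : nat) x t : (0 < p + k)%N -> 0 <= x -> 0 <= t ->
  (p + k)%:R * (x ^+ k * t ^+ p) <= k%:R * x ^+ (p + k) + p%:R * t ^+ (p + k).
Proof.
move=> q0 x0 t0; set q := (p + k)%N.
have := @weighted_AGM bool (fun b : bool => if b then p else k)
  (fun b : bool => if b then t ^+ q else x ^+ q).
have H : forall b : bool, 0 <= (if b then t ^+ q else x ^+ q) by case; rewrite exprn_ge0.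
move=> /(_ H); rewrite !big_bool/= -/q -!exprM mulnC [(q * k)%N]mulnC !exprM -exprMn.
have L0 : x ^+ k * t ^+ p \is Num.nneg by rewrite nnegrE mulr_ge0// exprn_ge0.
have R0 : (p%:R * t ^+ q + k%:R * x ^+ q) / q%:R \is Num.nneg.
  by rewrite nnegrE divr_ge0// addr_ge0// mulr_ge0// exprn_ge0.
rewrite [t ^+ p * _]mulrC ler_pXn2r//.
by rewrite ler_pdivlMr ?ltr0n// => h; lra.
Qed.

(** Allows division by the factors of a product that may vanish: it suffices to treat strictly
    positive majorants. If some factor is 0, its majorant is made small while the others stay
    fixed. *)
Lemma le_prod_inf (I : finType) (P : pred I) (A C : R) (x : I -> R) :
  0 <= C -> (forall i, 0 <= x i) ->
  (forall e : I -> R, (forall i, 0 < e i) -> (forall i, x i <= e i) ->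
     A <= C * \prod_(i | P i) e i) ->
  A <= C * \prod_(i | P i) x i.
Proof.
move=> C0 x0 h.
have [/forallP xp|] := boolP [forall i, P i ==> (0 < x i)].
  have E : \prod_(i | P i) (if P i then x i else x i + 1) = \prod_(i | P i) x i.
    by apply: eq_bigr => i ->.
  rewrite -E; apply: h => i; have := xp i; have := x0 i; case: (P i) => /=; lra.
rewrite negb_forall => /existsP[j]; rewrite negb_imply -leNgt => /andP[Pj xj].
have {}xj : x j = 0 by apply/le_anti; rewrite xj x0.
rewrite (bigD1 j)//= xj mul0r mulr0 leNgt; apply/negP => A0.
pose Q := C * \prod_(i | P i && (i != j)) (x i + 1).
have Q0 : 0 <= Q.
  by rewrite mulr_ge0// prodr_ge0// => i _; rewrite addr_ge0.
(* Small enough that e * Q <= A / 2, against A <= e * Q. *)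
pose e := A / (2 * (Q + 1)).
have e0 : 0 < e by rewrite divr_gt0// mulr_gt0//; lra.
have := h (fun i => if i == j then e else x i + 1).
have H1 i : 0 < (if i == j then e else x i + 1).
  by case: ifP => // _; have := x0 i; lra.
have H2 i : x i <= (if i == j then e else x i + 1).
  by case: eqP => [->|_]; [rewrite xj ltW|lra].
move=> /(_ H1 H2); rewrite (bigD1 j)//= eqxx.
rewrite (eq_bigr (fun i => x i + 1)); last by move=> i /andP[_ /negPf ->].
rewrite mulrCA -/Q => AeQ.
have : e * Q <= A / 2.
  by rewrite /e mulrAC ler_pdivrMr; [lra|rewrite mulr_gt0//; lra].
lra.
Qed.

(** The minimum of 1 and the values of f. The cap 1 covers the empty list, and later it is the bound
    on the coordinate sum in the body [extremal]. *)
Lemma min_seq (T : eqType) (ys : seq T) (f : T -> R) : exists2 w : R,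
  forall i, i \in ys -> w <= f i &
  w <= 1 /\ forall t, t <= 1 -> (forall i, i \in ys -> t <= f i) -> t <= w.
Proof.
elim: ys => [|j ys [w wf [w1 wmax]]]; first by exists 1.
exists (Num.min (f j) w).
  move=> i; rewrite inE => /orP[/eqP ->|/wf]; first by rewrite ge_min lexx.
  by move=> h; rewrite ge_min h orbT.
split; first by rewrite ge_min w1 orbT.
move=> t t1 tf; rewrite le_min tf ?mem_head//= wmax// => i iys.
by apply: tf; rewrite inE iys orbT.
Qed.

(** Write X_i = s_i^(p_i). AM-GM bounds Y by the average of the s_i^q with weights p_i / (r q), and
    [AGM2] gives p_i (s_i^q - t^q) <= q s_i^(k_i) (X_i - t^(p_i)). By the two crossing hypotheses
    z_i >= s_i where the last bracket is positive and z_i <= s_i where it is negative, so s_i may be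
    replaced by z_i in the coefficient. The result is linear in the X_i with coefficients
    independent of t, hence ready to be integrated. *)
Lemma crossing_pointwise (m q r : nat) (p k : 'I_m -> nat) (X z : 'I_m -> R) t Y :
  (0 < r)%N -> (0 < q)%N -> (forall i, p i + k i = q)%N ->
  (\sum_i p i = r * q)%N ->
  0 < t -> 0 <= Y -> (forall i, 0 <= X i) -> (forall i, 0 <= z i) ->
  (forall i, p i = 0%N -> X i <= 1 /\ z i = 0) ->
  (forall i, (0 < p i)%N -> t ^+ p i < X i -> X i <= z i ^+ p i) ->
  (forall i, (0 < p i)%N -> X i < t ^+ p i -> z i ^+ p i <= X i) ->
  Y ^+ r <= \prod_i X i ->
  Y + r%:R^-1 * (\sum_i z i ^+ k i * t ^+ p i) <=
  t ^+ q + r%:R^-1 * (\sum_i z i ^+ k i * X i).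
Proof.
move=> r0 q0 pk sp t0 Y0 X0 z0 hp0 hgt hlt YX.
have /choice[s Hs] : forall i, exists s, 0 <= s /\ X i <= s ^+ p i /\
    (p i)%:R * (s ^+ q - t ^+ q) <= q%:R * (z i ^+ k i * (X i - t ^+ p i)).
  move=> i; have [pi0|pi0] := posnP (p i).
    (* With p_i = 0 any s_i has s_i^0 = 1 >= X_i. Both sides then vanish: k_i = q > 0 and z_i =
       0. *)
    have [X1 zi0] := hp0 _ pi0; exists 1; split=> //; split; first by rewrite pi0 expr0.
    rewrite pi0 mul0r zi0; have -> : k i = q by have := pk i; rewrite pi0.
    by rewrite expr0n eqn0Ngt q0/= mul0r mulr0.
  have [s s0 sX] := exists_root pi0 (X0 i); exists s; split => //; split; first by rewrite sX.
  have A := @AGM2 (p i) (k i) s t; rewrite pk in A; have {}A := A q0 s0 (ltW t0).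
  have K : s ^+ k i * (X i - t ^+ p i) <= z i ^+ k i * (X i - t ^+ p i).
    case: (ltgtP (X i) (t ^+ p i)) => Xt.
    - have zs : z i <= s.
        rewrite -(ler_pXn2r pi0) ?nnegrE// sX; exact: hlt.
      rewrite -subr_ge0 -mulrBl mulr_le0//; last by lra.
      by rewrite subr_le0 lerXn2r ?nnegrE.
    - have sz : s <= z i.
        rewrite -(ler_pXn2r pi0) ?nnegrE// sX; exact: hgt.
      by rewrite ler_wpM2r; [|lra|rewrite lerXn2r ?nnegrE].
    - by rewrite Xt subrr !mulr0.
  apply: le_trans (ler_wpM2l (ler0n _ q) K).
  rewrite -sX [s ^+ k i * _]mulrBr -exprD addnC pk.
  have Eq : q%:R = (p i)%:R + (k i)%:R :> R by rewrite -natrD pk.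
  rewrite Eq in A *; lra.
have s0 i : 0 <= s i by have [] := Hs i.
have sX i : X i <= s i ^+ p i by have [_ []] := Hs i.
have sb i : (p i)%:R * (s i ^+ q - t ^+ q) <= q%:R * (z i ^+ k i * (X i - t ^+ p i)).
  by have [_ []] := Hs i.
have rq0 : (0 < r * q)%N by rewrite muln_gt0 r0.
have YS : Y <= (\sum_i (p i)%:R * s i ^+ q) / (r * q)%:R.
  rewrite -(ler_pXn2r rq0) ?nnegrE//; last first.
    by rewrite divr_ge0// sumr_ge0// => i _; rewrite mulr_ge0// exprn_ge0.
  have := @weighted_AGM _ p (fun i => s i ^+ q) (fun i => exprn_ge0 _ (s0 i)).
  rewrite sp; apply: le_trans; rewrite exprM.
  apply: (@le_trans _ _ ((\prod_i X i) ^+ q)).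
    by rewrite lerXn2r ?nnegrE ?exprn_ge0// prodr_ge0.
  rewrite -prodrXl; apply: ler_prod => i _; rewrite exprn_ge0//=.
  by rewrite -exprM mulnC exprM lerXn2r ?nnegrE ?exprn_ge0.
have rq0R : 0 < (r * q)%:R :> R by rewrite ltr0n.
have S : \sum_i (p i)%:R * s i ^+ q <= (r * q)%:R * t ^+ q +
    q%:R * (\sum_i z i ^+ k i * X i - \sum_i z i ^+ k i * t ^+ p i).
  rewrite -sumrB mulr_sumr -sp natr_sum mulr_suml -big_split/=; apply: ler_sum => i _.
  have := sb i; rewrite !mulrBr; lra.
move: YS; rewrite ler_pdivlMr// => YS; have {}YS := le_trans YS S.
rewrite -(ler_pM2r rq0R); rewrite natrM in YS *.
have r0R : r%:R != 0 :> R by rewrite pnatr_eq0 -lt0n.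
have E (y w : R) : (y + r%:R^-1 * w) * (r%:R * q%:R) = y * (r%:R * q%:R) + q%:R * w.
  by field.
by rewrite !E; lra.
Qed.

End elementary_inequalities.

(** * One-dimensional steps: Brunn-Minkowski, Hölder, Berwald *)

Section one_dimensional_inequalities.
Context (R : realType) (M : R).
Hypothesis M_ge1 : 1 <= M.
Local Notation Int := (Int M).

(* The induction step of Brunn-Minkowski. Dividing f and g by their maxima makes all their
   superlevel sets nonempty at the same levels, so that one-dimensional Brunn-Minkowski
   applies at each level; [perspective_convex] recombines the maxima. *)
Lemma profile_Brunn_Minkowski (k : nat) (f g h : R -> R) (l : R) :
  profile f -> profile g -> profile h -> 0 < l < 1 ->
  (k = 0%N -> forall s, (f s = 0 \/ f s = 1) /\ (g s = 0 \/ g s = 1)) ->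
  (forall a b s t, 0 < a -> 0 < b -> 0 <= s <= M -> 0 <= t <= M ->
     a ^+ k <= f s -> b ^+ k <= g t ->
     ((1 - l) * a + l * b) ^+ k <= h ((1 - l) * s + l * t)) ->
  forall a b, 0 < a -> 0 < b -> a ^+ k.+1 <= Int f -> b ^+ k.+1 <= Int g ->
    ((1 - l) * a + l * b) ^+ k.+1 <= Int h.
Proof.
move=> pf pg ph l01 hk0 fgh a b a0 b0 af bg.
have l0 : 0 < l by case/andP: l01.
have l1 : 0 < 1 - l by rewrite subr_gt0; case/andP: l01.
have [bf _ _] := pf; have [bg' _ _] := pg; have [bh _ _] := ph.
have max_pos (f' : R -> R) (c : R) : profile f' -> 0 < c -> c ^+ k.+1 <= Int f' -> 0 < f' 0.
  move=> pf' c0 cf; have [bf' _ _] := pf'; rewrite ltNge; apply/negP => f0.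
  have : Int f' <= 0.
    rewrite -(Int0 M); apply: Int_le => //; first exact: bm_cst.
    by move=> s _; apply: le_trans f0; exact: profile_max.
  by move/(le_trans cf); rewrite leNgt exprn_gt0.
have f0 := max_pos _ _ pf a0 af; have g0 := max_pos _ _ pg b0 bg.
(* For k = 0 every power is 1, so the positive maximum has to be 1; this uses that the functions
   then take only the values 0 and 1. *)
have root_max (f' : R -> R) : 0 < f' 0 -> (k = 0%N -> forall s, f' s = 0 \/ f' s = 1) ->
    exists2 c, 0 < c & c ^+ k = f' 0.
  case: k {hk0 fgh af bg max_pos} => [|k] f'0 hf'.
    by exists 1 => //; rewrite expr0; case: (hf' erefl 0) => E //; rewrite E ltxx in f'0.
  exact: exists_root_gt0.
have [A A0 fA] := root_max f f0 (fun E s => (hk0 E s).1).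
have [B B0 gB] := root_max g g0 (fun E s => (hk0 E s).2).
pose c := (1 - l) * A + l * B.
have c0 : 0 < c by rewrite addr_gt0// mulr_gt0.
have Ak0 : 0 < A ^+ k by rewrite exprn_gt0.
have Bk0 : 0 < B ^+ k by rewrite exprn_gt0.
have ck0 : 0 < c ^+ k by rewrite exprn_gt0.
pose F u := Int (fun s => \1_(level (A ^+ k) f) (u, s)).
pose G u := Int (fun s => \1_(level (B ^+ k) g) (u, s)).
pose H u := Int (fun s => \1_(level (c ^+ k) h) (u, s)).
have bF : bm F by exact: bm_level_Int.
have bG : bm G by exact: bm_level_Int.
have bH : bm H by exact: bm_level_Int.
have FGH u : (1 - l) * F u + l * G u <= H u.
  have [u01|u01] := boolP (0 < u < 1); last first.
    by rewrite /F /G /H !level_out// !mulr0 addr0.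
  have rel s t : 0 <= s <= M -> 0 <= t <= M -> A ^+ k * u <= f s -> B ^+ k * u <= g t ->
      c ^+ k * u <= h ((1 - l) * s + l * t).
    move=> sM tM; have [k0|k0] := posnP k.
      have := fgh 1 1 s t; rewrite k0 !expr0 !mul1r => hh uf ug.
      have f1 : f s = 1 by have [[E|//] _] := hk0 k0 s; rewrite E in uf; lra.
      have g1 : g t = 1 by have [_ [E|//]] := hk0 k0 t; rewrite E in ug; lra.
      by apply: le_trans (hh _ _ sM tM _ _); rewrite ?f1 ?g1//; lra.
    have u0 : 0 < u by case/andP: u01.
    have [v v0 <-] := exists_root_gt0 k0 u0; rewrite -!exprMn => uf ug.
    have := fgh _ _ s t (mulr_gt0 A0 v0) (mulr_gt0 B0 v0) sM tM uf ug.
    by rewrite (_ : c * v = (1 - l) * (A * v) + l * (B * v)) // /c; ring.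
  have mixM s t : 0 <= s <= M -> 0 <= t <= M -> 0 <= (1 - l) * s + l * t <= M.
    move=> /andP[s0 sM] /andP[t0 tM]; rewrite addr_ge0/= ?mulr_ge0 ?(ltW l0) ?(ltW l1)//.
    apply: (@le_trans _ _ ((1 - l) * M + l * M)); last by rewrite -mulrDl subrK mul1r.
    by apply: lerD; rewrite ler_pM2l.
  have st s t : 0 <= s <= M -> 0 <= t <= M -> A ^+ k * u <= f s -> B ^+ k * u <= g t ->
      (1 - l) * s + l * t <= H u.
    move=> sM tM uf ug; apply: profile_level_ge => //; first exact: mixM.
    exact: rel.
  have zM : 0 <= (0 : R) <= M by have := M_ge1; lra.
  have fz : A ^+ k * u <= f 0 by rewrite -fA ger_pMr//; lra.
  have gz : B ^+ k * u <= g 0 by rewrite -gB ger_pMr//; lra.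
  (* The estimate for points passes to lengths one variable at a time, first [t] and then [s]. The
     maxima are attained at 0, so neither superlevel set is empty. *)
  have sG s : 0 <= s <= M -> A ^+ k * u <= f s -> (1 - l) * s + l * G u <= H u.
    move=> sM uf; rewrite -lerBrDl mulrC -ler_pdivlMr//.
    apply: profile_level_le => //.
      by rewrite divr_ge0 ?(ltW l0)// subr_ge0; have := st _ _ sM zM uf gz; rewrite mulr0 addr0.
    by move=> t tM ug; rewrite ler_pdivlMr// mulrC lerBrDl; exact: st.
  rewrite -lerBrDr mulrC -ler_pdivlMr//.
  apply: profile_level_le => //.
    by rewrite divr_ge0 ?(ltW l1)// subr_ge0; have := sG _ zM fz; rewrite mulr0 add0r.
  by move=> s sM uf; rewrite ler_pdivlMr// mulrC lerBrDr; exact: sG.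
have IF : Int f = A ^+ k * Int F.
  by apply: layer_cake_eq => // s; rewrite fA; exact: profile_max.
have IG : Int g = B ^+ k * Int G.
  by apply: layer_cake_eq => // s; rewrite gB; exact: profile_max.
have IH : c ^+ k * Int H <= Int h by exact: layer_cake_ge.
have IFGH : (1 - l) * Int F + l * Int G <= Int H.
  have {}l0 := ltW l0; have {}l1 := ltW l1.
  rewrite -!IntZ// -IntD//; [|exact: bmM (bm_cst _ _) _..].
  apply: Int_le => //.
  by apply: bmD; apply: bmM => //; exact: bm_cst.
apply: le_trans IH; apply: le_trans (perspective_convex k l01 A0 B0 (ltW a0) (ltW b0)) _.
rewrite ler_pM2l//; apply: le_trans IFGH.
apply: lerD; rewrite ler_pM2l//.
  by rewrite ler_pdivrMr// mulrC -IF.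
by rewrite ler_pdivrMr// mulrC -IG.
Qed.

(** Pointwise AM-GM for the quotients g_i / e_i, with e_i a positive majorant of the integral of
    g_i, then integration. The passage from e_i to the integrals themselves is [le_prod_inf], so
    vanishing integrals need no separate discussion. *)
Lemma Int_Hoelder (I : finType) (P : pred I) (r : nat) (c : R) (F : R -> R) (g : I -> R -> R) :
  #|P| = r -> (0 < r)%N -> 0 <= c -> bm F -> (forall i, bm (g i)) ->
  (forall s, -M <= s <= M -> F s ^+ r <= c * \prod_(i | P i) g i s) ->
  Int F ^+ r <= c * \prod_(i | P i) Int (g i).
Proof.
move=> Pr r0 c0 bF bg Fg.
have F0 s := bm_ge0 s bF; have g0 i s := bm_ge0 s (bg i).
have IF0 : 0 <= Int F by exact: Int_ge0.
apply: le_prod_inf => // [i|e e0 ge]; first exact: Int_ge0.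
have [c0'|cN0] := eqVneq c 0.
  rewrite c0' mul0r (_ : Int F = 0) ?expr0n ?eqn0Ngt ?r0//.
  rewrite -(Int0 M); apply: eq_Int => s sM; have := Fg s sM.
  rewrite c0' mul0r => Fr; apply/eqP; rewrite eq_le F0 andbT.
  by rewrite -(ler_pXn2r r0) ?nnegrE// expr0n eqn0Ngt r0.
have {cN0}cp : 0 < c by rewrite lt_neqAle eq_sym cN0.
have pe0 : 0 < \prod_(i | P i) e i by apply: prodr_gt0 => i _; exact: e0.
have [K K0 Kr] := exists_root_gt0 r0 (mulr_gt0 cp pe0).
rewrite -Kr lerXn2r ?nnegrE//; first exact: ltW.
have r0R : 0 < r%:R :> R by rewrite ltr0n.
have W i : 0 <= K / (r%:R * e i).
  by rewrite divr_ge0 ?(ltW K0)// mulr_ge0// ltW.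
apply: (@le_trans _ _ (Int (fun s => \sum_(i | P i) (K / (r%:R * e i)) * g i s))).
  apply: Int_le => //; first by apply: bm_sum => i _; apply: bmM => //; exact: bm_cst.
  move=> s sM; have := @leif_AGM R I P (fun i => g i s / e i).
  have H : {in P, forall i, 0 <= g i s / e i}.
    by move=> i _; rewrite divr_ge0// ltW.
  move=> /(_ H) [+ _]; rewrite Pr => AG.
  have -> : \sum_(i | P i) K / (r%:R * e i) * g i s = K * ((\sum_(i in P) g i s / e i) / r%:R).
    rewrite mulr_suml mulr_sumr; apply: eq_bigr => i _; field.
    by rewrite !gt_eqF.
  rewrite -(ler_pXn2r r0) ?nnegrE//; last first.
    apply: mulr_ge0; [exact: ltW|apply: divr_ge0 => //].
    by apply: sumr_ge0 => i _; rewrite divr_ge0// ltW.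
  rewrite exprMn Kr; apply: le_trans (ler_wpM2l (ltW (mulr_gt0 cp pe0)) AG).
  rewrite prodf_div -mulrA (mulrC (\prod_(i | P i) e i)) divfK ?gt_eqF//.
  exact: Fg.
rewrite Int_sum//; last by move=> i _; apply: bmM => //; exact: bm_cst.
apply: (@le_trans _ _ (\sum_(i | P i) K / r%:R)).
  apply: ler_sum => i _; rewrite IntZ//.
  apply: le_trans (ler_wpM2l (W i) (ge i)) _.
  rewrite invfM -!mulrA (mulVf (lt0r_neq0 (e0 i))) mulr1//.
by rewrite (sumr_const P) Pr -[leLHS]mulr_natr divfK// gt_eqF.
Qed.

(* Since Vs i / tau ^ p i is nondecreasing while Vs i is nonincreasing, the normalized Vs i
   crosses tau ^ p i at most once, at a height z i ^ p i which separates its values above and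
   below the crossing: this is what [crossing_pointwise] needs. *)
Lemma crossing_integral (m q r : nat) (p k : 'I_m -> nat) (tau : R -> R)
    (W : nat -> R -> R) (V : R -> R) (Vs : 'I_m -> R -> R) :
  (0 < r)%N -> (0 < q)%N -> (forall i, p i + k i = q)%N ->
  (\sum_i p i = r * q)%N ->
  (forall u, 0 < u < 1 -> 0 < tau u) ->
  (forall j, bm (W j)) -> (forall j u, 0 < u < 1 -> W j u = tau u ^+ j) ->
  (forall j, (j <= q)%N -> 0 < Int (W j)) ->
  (forall j u, ~~ (0 < u < 1) -> W j u = 0) ->
  bm V -> (forall u, ~~ (0 < u < 1) -> V u = 0) ->
  (forall i, bm (Vs i)) -> (forall i u, ~~ (0 < u < 1) -> Vs i u = 0) ->
  (forall i, p i = 0%N -> Vs i = W 0%N) ->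
  (forall i u u', 0 < u -> u <= u' -> u' < 1 -> Vs i u' <= Vs i u) ->
  (forall i u u', 0 < u -> u <= u' -> u' < 1 ->
    Vs i u * tau u' ^+ p i <= Vs i u' * tau u ^+ p i) ->
  (forall u, 0 < u < 1 -> V u ^+ r <= \prod_i Vs i u) ->
  Int V ^+ r <= Int (W q) ^+ r * \prod_i (Int (Vs i) / Int (W (p i))).
Proof.
move=> r0 q0 pk sp t0 bW WE IW0 W0 bV V0 bVs Vs0 hp0 Vdec Vinc VVs.
have IWq := IW0 q (leqnn q).
have IWp i : 0 < Int (W (p i)) by apply: IW0; rewrite -(pk i) leq_addr.
have IV0 : 0 <= Int V by exact: Int_ge0.
have Wge0 j u := bm_ge0 u (bW j).
have Vge0 u := bm_ge0 u bV.
have Vsge0 i u := bm_ge0 u (bVs i).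
apply: le_prod_inf => [|i|D D0 VD].
- by rewrite exprn_ge0// ltW.
- by rewrite divr_ge0 ?(ltW (IWp _))//; exact: Int_ge0.
pose X i u := Vs i u / D i.
have X0 i u : 0 <= X i u by rewrite divr_ge0// ltW.
have /choice[z Hz] : forall i, exists z, 0 <= z /\ (p i = 0%N -> z = 0) /\
   ((0 < p i)%N -> forall u, 0 < u < 1 ->
     (tau u ^+ p i < X i u -> X i u <= z ^+ p i) /\
     (X i u < tau u ^+ p i -> z ^+ p i <= X i u)).
  move=> i; have [pi0|pi0] := posnP (p i).
    by exists 0; split => //; split => //; rewrite pi0.
  (* The height separating the two regimes is the supremum of the values taken where X_i is at least
     tau^(p_i); 0 is included so that the set is never empty. *)
  pose S := [set y | y = 0 \/ exists u, 0 < u < 1 /\ tau u ^+ p i <= X i u /\ y = X i u].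
  have [C C0 VC] := bm_bound (bVs i).
  have Sb : has_sup S.
    split; first by exists 0; left.
    exists (C / D i) => y [->|[u [_ [_ ->]]]]; first by rewrite divr_ge0 ?ltW.
    by rewrite /X ler_pM2r ?invr_gt0.
  have S0 : 0 <= sup S by apply: sup_upper_bound => //; left.
  have [z z0 zS] := exists_root pi0 S0; exists z; split => //; split.
    by move=> E; rewrite E in pi0.
  move=> _ u u01; rewrite zS; split => Xt.
    by apply: sup_upper_bound => //; right; exists u; split => //; split => //; exact: ltW.
  apply: sup_le_ub; first by case: Sb.
  move=> y [->//|[v [v01 [vt ->]]]].
  (* At [u] the profile is below the power of tau and at [v] it is not. Since the quotient is
     nondecreasing, [v] cannot precede [u]. *)
  suff uv : u <= v by rewrite /X ler_pM2r ?invr_gt0//; apply: Vdec => //; lra.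
  rewrite leNgt; apply/negP => vu.
  have := Vinc i v u _ (ltW vu) _; rewrite -(ler_pM2r (x := (D i)^-1)) ?invr_gt0//.
  rewrite -!mulrA ![_ / D i]mulrC !mulrA -/(X i v) -/(X i u) => hh.
  have {}hh : X i v * tau u ^+ p i <= X i u * tau v ^+ p i by apply: hh; lra.
  have tv : 0 < tau v ^+ p i by rewrite exprn_gt0// t0.
  have tu : 0 < tau u ^+ p i by rewrite exprn_gt0// t0.
  have h1 : X i u * tau v ^+ p i < tau u ^+ p i * tau v ^+ p i by rewrite ltr_pM2r.
  have h2 : tau v ^+ p i * tau u ^+ p i <= X i v * tau u ^+ p i by rewrite ler_pM2r.
  by have := le_lt_trans (le_trans h2 hh) h1; rewrite mulrC ltxx.
have z0 i : 0 <= z i by have [] := Hz i.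
have zp0 i : p i = 0%N -> z i = 0 by have [_ []] := Hz i.
have Hz' i : (0 < p i)%N -> forall u, 0 < u < 1 ->
     (tau u ^+ p i < X i u -> X i u <= z i ^+ p i) /\
     (X i u < tau u ^+ p i -> z i ^+ p i <= X i u) by have [_ []] := Hz i.
have DP : 0 < \prod_i D i by apply: prodr_gt0.
have [K K0 Kr] := exists_root_gt0 r0 DP.
rewrite -Kr -exprMn lerXn2r ?nnegrE// ?mulr_ge0 ?(ltW K0) ?(ltW IWq)//.
have ri : 0 <= r%:R^-1 :> R by rewrite invr_ge0.
(* L <= Q is [crossing_pointwise] for V / K and the X_i, where K^r is the product of the D_i. After
   integration the sum in Q is at most the sum in L, because D_i majorizes the quotient of
   integrals; what remains compares V / K with W_q. *)
pose L u := K^-1 * V u + \sum_i (r%:R^-1 * z i ^+ k i) * W (p i) u.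
pose Q u := W q u + \sum_i (r%:R^-1 * z i ^+ k i / D i) * Vs i u.
have w1 i : 0 <= r%:R^-1 * z i ^+ k i by rewrite mulr_ge0// exprn_ge0.
have w2 i : 0 <= r%:R^-1 * z i ^+ k i / D i by rewrite divr_ge0// ltW.
have Ki : 0 <= K^-1 by rewrite invr_ge0 ltW.
have b1 : bm (fun u => K^-1 * V u) by apply: bmM => //; exact: bm_cst.
have b2 : bm (fun u => \sum_i (r%:R^-1 * z i ^+ k i) * W (p i) u).
  by apply: bm_sum => i _; apply: bmM => //; exact: bm_cst.
have b3 : bm (fun u => \sum_i (r%:R^-1 * z i ^+ k i / D i) * Vs i u).
  by apply: bm_sum => i _; apply: bmM => //; exact: bm_cst.
have LQ u : L u <= Q u.
  have [u01|u01] := boolP (0 < u < 1); last first.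
    rewrite /L /Q V0// W0// mulr0 !big1// => i _; first by rewrite Vs0// mulr0.
    by rewrite W0// mulr0.
  have Hp i : p i = 0%N -> X i u <= 1 /\ z i = 0.
    move=> pi0; split; last exact: zp0.
    rewrite /X ler_pdivrMr// mul1r hp0// WE// expr0.
    by have := VD i; have := IWp i; rewrite hp0// pi0 => IW; rewrite divff// gt_eqF.
  have Hgt i : (0 < p i)%N -> tau u ^+ p i < X i u -> X i u <= z i ^+ p i.
    by move=> pi0; have [] := Hz' i pi0 u u01.
  have Hlt i : (0 < p i)%N -> X i u < tau u ^+ p i -> z i ^+ p i <= X i u.
    by move=> pi0; have [] := Hz' i pi0 u u01.
  have HY : (K^-1 * V u) ^+ r <= \prod_i X i u.
    rewrite /X prodf_div -Kr exprMn mulrC exprVn ler_pM2r ?invr_gt0 ?exprn_gt0//.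
    exact: VVs.
  have := crossing_pointwise r0 q0 pk sp (t0 u u01) (mulr_ge0 Ki (Vge0 u)) (X0 ^~ u) z0
    Hp Hgt Hlt HY.
  have E1 : \sum_i (r%:R^-1 * z i ^+ k i) * W (p i) u =
      r%:R^-1 * (\sum_i z i ^+ k i * tau u ^+ p i).
    by rewrite mulr_sumr; apply: eq_bigr => i _; rewrite WE// mulrA.
  have E2 : \sum_i (r%:R^-1 * z i ^+ k i / D i) * Vs i u =
      r%:R^-1 * (\sum_i z i ^+ k i * X i u).
    by rewrite mulr_sumr; apply: eq_bigr => i _; rewrite /X !mulrA mulrAC.
  by rewrite /L /Q WE// E1 E2.
have bL : bm L by exact: bmD.
have bQ : bm Q by exact: bmD.
have := Int_le M_ge1 bL bQ (fun u _ => LQ u).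
rewrite /L /Q !IntD// IntZ// !Int_sum//; last 2 first.
- by move=> i _; apply: bmM => //; exact: bm_cst.
- by move=> i _; apply: bmM => //; exact: bm_cst.
under [X in _ + X <= _]eq_bigr do rewrite IntZ//.
under [X in _ <= _ + X]eq_bigr do rewrite IntZ//.
move=> LQI.
have S : \sum_i (r%:R^-1 * z i ^+ k i / D i) * Int (Vs i) <=
    \sum_i (r%:R^-1 * z i ^+ k i) * Int (W (p i)).
  apply: ler_sum => i _; rewrite -!mulrA ler_wpM2l// ler_wpM2l ?exprn_ge0//.
  by rewrite mulrC ler_pdivrMr// mulrC -ler_pdivrMr.
have : K^-1 * Int V <= Int (W q) by lra.
by rewrite mulrC ler_pdivrMr.
Qed.

End one_dimensional_inequalities.

(** * Iterated integration over lists of coordinates *)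

Section partial_integration.
Context (R : realType) (n : nat).
Implicit Types (x : 'rV[R]_n) (i j : 'I_n) (s t : R).

Definition upd x j s : 'rV[R]_n := \row_i (if i == j then s else x 0 i).

Lemma updE x j s i : upd x j s 0 i = if i == j then s else x 0 i.
Proof. by rewrite mxE. Qed.

Lemma upd_same x j s : upd x j s 0 j = s.
Proof. by rewrite updE eqxx. Qed.

Lemma upd_upd x j s t : upd (upd x j s) j t = upd x j t.
Proof. by apply/rowP => i; rewrite !updE; case: eqP. Qed.

Lemma upd_comm x i j s t : i != j -> upd (upd x i s) j t = upd (upd x j t) i s.
Proof.
move=> ij; apply/rowP => k; rewrite !updE.
by case: (eqVneq k j) => [->|//]; rewrite eq_sym (negPf ij).
Qed.

Lemma upd_id x j : upd x j (x 0 j) = x.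
Proof. by apply/rowP => i; rewrite updE; case: eqP => // ->. Qed.

Lemma measurable_upd j : measurable_fun setT (fun z : 'rV[R]_n * R => upd z.1 j z.2).
Proof.
apply: measurable_fun_rVP => i.
have [->|ij] := eqVneq i j.
  rewrite [X in measurable_fun _ X](_ : _ = snd)//.
  by apply/funext => z; rewrite /= /rV_coord upd_same.
rewrite [X in measurable_fun _ X](_ : _ = rV_coord i \o fst).
  by apply: measurableT_comp => //; exact: measurable_rV_coord.
by apply/funext => z; rewrite /= /rV_coord updE (negPf ij).
Qed.

Lemma bm_upd (f : 'rV[R]_n -> R) j : bm f -> bm (fun z : 'rV[R]_n * R => f (upd z.1 j z.2)).
Proof. by move=> bf; exact: (bm_comp (measurable_upd j) bf). Qed.

Lemma bm_upd1 (f : 'rV[R]_n -> R) x j : bm f -> bm (fun s => f (upd x j s)).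
Proof. by move=> bf; exact: (bm_section1 x (bm_upd j bf)). Qed.

Lemma bm_upd2 (f : 'rV[R]_n -> R) x i j : i != j -> bm f ->
  bm (fun z : R * R => f (upd (upd x i z.1) j z.2)).
Proof.
move=> ij bf; have m : measurable_fun setT (fun z : R * R => upd (upd x i z.1) j z.2).
  apply: measurable_fun_rVP => k; rewrite [X in measurable_fun _ X](_ : _ =
      if k == j then snd else if k == i then fst else cst (x 0 k)).
    by case: eqP => // _; case: eqP => // _; exact: measurable_cst.
  by apply/funext => z; rewrite /= /rV_coord !updE; case: eqP => // _; case: eqP.
exact: (bm_comp m bf).
Qed.

Variable M : R.
Hypothesis M_ge1 : 1 <= M.

Definition pint j (f : 'rV[R]_n -> R) x : R := Int M (fun s => f (upd x j s)).

(* For an anti-blocking A, [pints js \1_A 0] is the volume of the section of A by the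
   coordinate subspace indexed by [js], hence of its projection on that subspace. *)
Definition pints (js : seq 'I_n) (f : 'rV[R]_n -> R) := foldr pint f js.

Implicit Types (f g : 'rV[R]_n -> R) (js : seq 'I_n).

Lemma bm_pint j f : bm f -> bm (pint j f).
Proof. by move=> bf; apply: (bm_Int M_ge1 (bm_upd j bf)). Qed.

Lemma bm_pints js f : bm f -> bm (pints js f).
Proof. by move=> bf; elim: js => //= j js; exact: bm_pint. Qed.

Lemma pints_ge0 js f x : bm f -> 0 <= pints js f x.
Proof. by move=> bf; exact: (bm_ge0 x (bm_pints js bf)). Qed.

Lemma pints_cat js1 js2 f : pints (js1 ++ js2) f = pints js1 (pints js2 f).
Proof. by rewrite /pints foldr_cat. Qed.

(** Compares integrals taken at two different base points: [rel] couples the arguments and survives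
    putting the same value into the same coordinate of both. *)
Lemma pints_rel (rel : 'rV[R]_n -> 'rV[R]_n -> Prop) js f g x x' :
  bm f -> bm g ->
  (forall j s y y', j \in js -> -M <= s <= M -> rel y y' -> rel (upd y j s) (upd y' j s)) ->
  (forall y y', rel y y' -> f y <= g y') ->
  rel x x' -> pints js f x <= pints js g x'.
Proof.
move=> bf bg hrel fg; elim: js x x' hrel => [|j js IHjs] x x' hrel xx' /=; first exact: fg.
apply: Int_le => //; [exact: bm_upd1 (bm_pints _ _)..|].
move=> s sM; apply: IHjs; last by apply: hrel; rewrite ?mem_head.
by move=> i t y y' ijs; apply: hrel; rewrite inE ijs orbT.
Qed.

Lemma pints_le_out js f g x : bm f -> bm g ->
  (forall y : 'rV[R]_n, (forall i, i \notin js -> y 0 i = x 0 i) -> f y <= g y) ->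
  pints js f x <= pints js g x.
Proof.
move=> bf bg fg; apply: (@pints_rel (fun y y' : 'rV[R]_n =>
  y = y' /\ forall i, i \notin js -> y 0 i = x 0 i)) => //.
  move=> j s y _ jjs _ [<- yx]; split=> // i ijs; rewrite updE.
  by case: eqVneq ijs => [->|_ /yx//]; rewrite jjs.
by move=> y _ [<-]; exact: fg.
Qed.

Lemma pints_le js f g x : bm f -> bm g -> (forall y, f y <= g y) ->
  pints js f x <= pints js g x.
Proof. by move=> bf bg fg; apply: pints_le_out. Qed.

Lemma eq_pints_out js f x x' : (forall i, i \notin js -> x 0 i = x' 0 i) ->
  pints js f x = pints js f x'.
Proof.
elim: js x x' => [|j js IHjs] x x' xx' /=.
  by congr f; apply/rowP => i; exact: xx'.
apply: eq_Int => s _; apply: IHjs => i ijs; rewrite !updE.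
by case: eqVneq => // ij; apply: xx'; rewrite inE negb_or ij.
Qed.

Lemma eq_pints js f g x :
  (forall y : 'rV[R]_n, (forall i, i \notin js -> y 0 i = x 0 i) ->
     (forall i, i \in js -> -M <= y 0 i <= M) -> f y = g y) ->
  pints js f x = pints js g x.
Proof.
elim: js x => [|j js IHjs] x fg /=; first by apply: fg => // i.
apply: eq_Int => s sM.
(* If [j] occurs again further in, the inner integration overwrites the value [s], and [x] itself
   can serve as base point. *)
have [jjs|jjs] := boolP (j \in js).
  rewrite (eq_pints_out _ (x' := x)); last first.
    by move=> i ijs; rewrite updE; case: eqVneq => // ij; rewrite -ij (negPf ijs) in jjs.
  rewrite [RHS](eq_pints_out _ (x' := x)); last first.
    by move=> i ijs; rewrite updE; case: eqVneq => // ij; rewrite -ij (negPf ijs) in jjs.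
  apply: IHjs => y h1 h2; apply: fg => i; rewrite inE ?negb_or.
    by move=> /andP[_]; exact: h1.
  by move=> /orP[/eqP ->|]; exact: h2.
apply: IHjs => y h1 h2; apply: fg => i; rewrite inE ?negb_or.
  by move=> /andP[ij ijs]; rewrite h1// updE (negPf ij).
move=> /orP[/eqP ->|]; last exact: h2.
by rewrite h1// upd_same.
Qed.

Lemma pint_swap i j f x : bm f -> pint i (pint j f) x = pint j (pint i f) x.
Proof.
move=> bf; have [->//|ij] := eqVneq i j.
rewrite /pint (Int_swap M_ge1 (bm_upd2 x ij bf)).
by apply: eq_Int => t _; apply: eq_Int => s _; rewrite /= upd_comm.
Qed.

Lemma perm_pints js1 js2 f : bm f -> perm_eq js1 js2 -> pints js1 f = pints js2 f.
Proof.
move=> bf.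
apply: (@catCA_perm_subst _ _ (fun js => pints js f)) => s1 s2 s3.
rewrite !pints_cat.
suff E g : bm g -> pints s1 (pints s2 g) = pints s2 (pints s1 g).
  by rewrite E//; apply: bm_pints.
move=> bg; elim: s1 => //= i s1 IHs1; rewrite IHs1.
elim: s2 {IHs1} => //= j s2 <-; apply/funext => x.
by rewrite pint_swap//; do 2?apply: bm_pints.
Qed.

Lemma pintsZ js c f x : 0 <= c -> bm f -> pints js (fun y => c * f y) x = c * pints js f x.
Proof.
move=> c0 bf; elim: js x => //= j js IHjs x; rewrite /pint -IntZ//; last first.
  exact: bm_upd1 (bm_pints _ _).
by apply: eq_Int => s _; exact: IHjs.
Qed.

Lemma pints_sum js (I : Type) (r : seq I) (P : pred I) (F : I -> 'rV[R]_n -> R) x :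
  (forall k, P k -> bm (F k)) ->
  pints js (fun y => \sum_(k <- r | P k) F k y) x = \sum_(k <- r | P k) pints js (F k) x.
Proof.
move=> bF; elim: js x => //= j js IHjs x; rewrite /pint -Int_sum//; last first.
  by move=> i Pi; apply: bm_upd1 (bm_pints _ (bF _ Pi)).
by apply: eq_Int => s _; exact: IHjs.
Qed.

(** Each coordinate moves only the factor of its own color, so all other factors leave that integral
    as constants. *)
Lemma pints_prod (I : finType) (c : 'I_n -> I) (F : I -> 'rV[R]_n -> R) js x :
  (forall k, bm (F k)) ->
  (forall k j y s, c j != k -> F k (upd y j s) = F k y) ->
  pints js (fun y => \prod_k F k y) x = \prod_k pints [seq j <- js | c j == k] (F k) x.
Proof.
move=> bF Fc; elim: js x => //= j js IHjs x.
have K k y s : c j != k ->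
    pints [seq i <- js | c i == k] (F k) (upd y j s) = pints [seq i <- js | c i == k] (F k) y.
  move=> cjk; elim: js y {IHjs} => [|i js IH] y /=; first exact: Fc.
  case: ifP => // cik /=; apply: eq_Int => t _.
  by rewrite upd_comm ?IH//; apply: contraNneq cjk => ->.
rewrite /pint (eq_Int (g := fun s => (\prod_(k | k != c j) pints [seq i <- js | c i == k] (F k) x)
    * pints [seq i <- js | c i == c j] (F (c j)) (upd x j s))); last first.
  move=> s _; rewrite IHjs (bigD1 (c j))//= mulrC; congr (_ * _).
  by apply: eq_bigr => k kj; rewrite K// eq_sym.
rewrite IntZ//; [|apply: prodr_ge0 => k _; exact: pints_ge0|exact: bm_upd1 (bm_pints _ _)].
rewrite [RHS](bigD1 (c j))//= eqxx/= mulrC; congr (_ * _).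
by apply: eq_bigr => k kj; rewrite eq_sym (negPf kj).
Qed.

End partial_integration.

(** * Lebesgue measure as an iterated integral *)

Section volume_as_iterated_integral.
Context (R : realType) (M : R).
Hypothesis M_ge1 : 1 <= M.

Lemma upd_cons0 n (x : 'rV[R]_n.+1) s : upd x ord0 s = rV_cons (s, (rV_uncons x).2).
Proof.
apply/rowP => i; rewrite updE; have [j ->|->] := unliftP ord0 i; last by rewrite eqxx rV_cons0.
rewrite rV_consS /= mxE (_ : rshift 1 j = lift ord0 j)//.
exact: val_inj.
Qed.

Lemma upd_consS n (x : 'rV[R]_n) (s t : R) j :
  upd (rV_cons (s, x)) (lift ord0 j) t = rV_cons (s, upd x j t).
Proof.
apply/rowP => i; rewrite updE; have [k ->|->] := unliftP ord0 i.
  by rewrite (inj_eq lift_inj) !rV_consS updE.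
by rewrite !rV_cons0.
Qed.

Lemma pints_consS n (f : 'rV[R]_n.+1 -> R) (s : R) (x : 'rV[R]_n) js :
  pints M (map (lift ord0) js) f (rV_cons (s, x)) =
  pints M js (fun y => f (rV_cons (s, y))) x.
Proof.
elim: js x => //= j js IHjs x; apply: eq_Int => t _.
by rewrite upd_consS.
Qed.

(** Induction along the recursive definition of the measure, each factor being one integral over the
    head coordinate. The set must lie in the cube of half-side M, since the integrals see nothing
    outside it. *)
Lemma lebesgue_rV_pints n (S : set 'rV[R]_n) : measurable S ->
  (forall x, S x -> forall i, -M <= x 0 i <= M) ->
  lebesgue_rV n S = (pints M (enum 'I_n) (\1_S) 0)%:E.
Proof.
elim: n S => [|n IHn] S mS SM.
  by rewrite enum_ord0 /= diracE indicE.
rewrite enum_ordSl /=; rewrite /rV_product /pushforward /product_measure1.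
have mP : measurable (@rV_cons R n @^-1` S).
  by rewrite -[X in measurable X]setTI; exact: measurable_rV_cons.
have mx s : measurable (xsection (@rV_cons R n @^-1` S) s) by exact: measurable_xsection.
have bS : bm (\1_S : _ -> R) by exact: bm_indic.
rewrite /pint -IntE//; last exact: bm_upd1 (bm_pints _ _ _).
apply: eq_integral => s _ /=.
have -> : xsection (@rV_cons R n @^-1` S) s = [set v | S (rV_cons (s, v))].
  by apply/seteqP; split => v /=; rewrite /xsection /= inE.
rewrite upd_cons0.
have -> : (rV_uncons (0 : 'rV[R]_n.+1)).2 = 0.
  by apply/rowP => i; rewrite /= !mxE.
have mSs : measurable [set v | S (rV_cons (s, v))].
  rewrite (_ : [set v | _] = xsection (@rV_cons R n @^-1` S) s)//.
  by apply/seteqP; split => v /=; rewrite /xsection /= inE.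
have E : pints M [seq lift ord0 i | i <- enum 'I_n] \1_S (rV_cons (s, 0)) =
    pints M (enum 'I_n) \1_[set v | S (rV_cons (s, v))] 0.
  by rewrite pints_consS; congr pints; apply/funext => v; rewrite !indicE.
rewrite E IHn//; last first.
  by move=> v /SM h i; have := h (lift ord0 i); rewrite rV_consS.
have [sM|sM] := boolP (-M <= s <= M); first by rewrite cutoff1// mulr1.
rewrite cutoff0// mulr0 (_ : [set v | _] = set0).
  by rewrite -IHn// measure0.
by apply/seteqP; split => // v /= /SM /(_ ord0); rewrite rV_cons0 => h; rewrite h in sM.
Qed.

End volume_as_iterated_integral.

(** * Section volumes of downward closed sets *)

Section downward_closed_sets.
Context (R : realType) (n : nat) (M : R).
Hypothesis M_ge1 : 1 <= M.
Local Notation pints := (pints M).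
Implicit Types (A S : set 'rV[R]_n) (x y z : 'rV[R]_n) (i j : 'I_n) (js : seq 'I_n).

Definition down_in S j := forall x, S x -> 0 <= x 0 j /\
  forall s, 0 <= s <= x 0 j -> S (upd x j s).

Lemma pints0 js x : pints js (fun=> 0) x = 0.
Proof.
elim: js x => //= j js IHjs x; rewrite /pint -[RHS](Int0 M).
by apply: eq_Int => s _; exact: IHjs.
Qed.

Lemma indic_le S S' x x' : (S x -> S' x') -> \1_S x <= \1_S' x' :> R.
Proof.
move=> SS'; rewrite !indicE; case: (boolP (x \in S)) => [/set_mem/SS' Sx|_].
  by rewrite mem_set.
by rewrite ler0n.
Qed.

Lemma pints_profile S js j x : measurable S -> down_in S j -> j \notin js ->
  profile (fun s => pints js \1_S (upd x j s)).
Proof.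
move=> mS dS jjs; have bS : bm (\1_S : _ -> R) by exact: bm_indic.
split.
- exact: bm_upd1 (bm_pints _ _ bS).
- move=> s s0; rewrite -[RHS](pints0 js (upd x j s)); apply: eq_pints => y yx _.
  rewrite indicE memNset// => /dS[+ _]; rewrite yx// upd_same; lra.
- move=> s t s0 st; apply: (@pints_rel _ _ _ M_ge1
    (fun y y' : 'rV[R]_n => y' = upd y j s /\ y 0 j = t)) => //.
  + move=> i r y y' ijs _ [-> yj].
    have ij : i != j by apply: contraNneq jjs => <-.
    by rewrite upd_comm 1?eq_sym// updE eq_sym (negPf ij).
  + move=> y y' [-> yj]; apply: indic_le => /dS[_]; apply.
    by rewrite s0 yj.
  + by rewrite upd_upd upd_same.
Qed.

Definition downset A := forall j, down_in A j.

(** The coordinates are lowered one after the other. *)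
Lemma downset_le A x y : downset A -> A x -> (forall i, 0 <= y 0 i <= x 0 i) -> A y.
Proof.
move=> dA Ax yx.
suff H (js : seq 'I_n) : uniq js -> A (\row_i if i \in js then y 0 i else x 0 i).
  have := H (enum 'I_n) (enum_uniq _); congr A; apply/rowP => i.
  by rewrite mxE mem_enum.
elim: js => [_|j js IHjs /= /andP[jjs ujs]].
  by rewrite (_ : \row_i _ = x)//; apply/rowP => i; rewrite mxE.
have [_ /(_ (y 0 j))] := dA j _ (IHjs ujs).
rewrite mxE (negPf jjs) => /(_ (yx j)); congr A; apply/rowP => i.
by rewrite updE !mxE inE; case: eqVneq => // ->.
Qed.

(** Induction on the coordinates with [profile_Brunn_Minkowski] as step. The bounds a and b stand
    for the roots of the two volumes, so no root is taken; their positivity excludes empty sections,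
    for which the mixed section may be empty too. *)
Lemma pints_Brunn_Minkowski A js x y (l a b : R) : uniq js -> measurable A -> downset A ->
  (forall z z' t, 0 < t < 1 -> A z -> A z' -> A ((1 - t) *: z + t *: z')) ->
  0 < l < 1 -> 0 < a -> 0 < b ->
  a ^+ size js <= pints js \1_A x -> b ^+ size js <= pints js \1_A y ->
  ((1 - l) * a + l * b) ^+ size js <= pints js \1_A ((1 - l) *: x + l *: y).
Proof.
move=> + mA dA cA l01; elim: js x y a b => [|j js IHjs] x y a b /=.
  move=> _ a0 b0; rewrite !expr0 !indicE.
  have [/set_mem Ax|] := boolP (x \in A); last by rewrite ler10.
  have [/set_mem Ay|] := boolP (y \in A); last by rewrite ler10.
  by rewrite mem_set//; exact: cA.
move=> /andP[jjs ujs]; move: a b.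
apply: profile_Brunn_Minkowski => //; [exact: pints_profile..| |].
  move=> /size0nil -> s /=; rewrite !indicE.
  by case: (_ \in _); case: (_ \in _) => /=; split; by [left|right].
move=> a b s t a0 b0 _ _ af bg; have := IHjs _ _ _ _ ujs a0 b0 af bg.
congr (_ <= pints _ _ _); apply/rowP => i; rewrite !mxE.
by case: eqP.
Qed.

Lemma profileZ (c : R) f : 0 <= c -> profile f -> profile (fun s => c * f s).
Proof.
move=> c0 [bf f0 fd]; split.
- by apply: bmM => //; exact: bm_cst.
- by move=> s /f0 ->; rewrite mulr0.
- by move=> s t s0 st; rewrite ler_wpM2l// fd.
Qed.

(** Iterates [profile_scale], one factor m per coordinate. [rel] couples y with a point whose
    integrated coordinates are m times those of y, so that the dilated section at x lies in the
    section at x'. *)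
Lemma pints_scale (rel : 'rV[R]_n -> 'rV[R]_n -> Prop) S js x x' (m : R) :
  uniq js -> measurable S -> (forall j, j \in js -> down_in S j) -> 0 < m <= 1 ->
  (forall j s y y', j \in js -> rel y y' -> rel (upd y j s) (upd y' j (m * s))) ->
  (forall y y', rel y y' -> S y -> S y') -> rel x x' ->
  m ^+ size js * pints js \1_S x <= pints js \1_S x'.
Proof.
move=> + mS + m01 + relS; have bS : bm (\1_S : _ -> R) by exact: bm_indic.
have m0 : 0 <= m by lra.
elim: js x x' => [|j js IHjs] x x' /=.
  by move=> _ _ _ xx'; rewrite mul1r; apply: indic_le; exact: relS.
move=> /andP[jjs ujs] dS hrel xx'; rewrite exprS -mulrA /pint.
have dj : down_in S j by apply: dS; rewrite mem_head.
have mk0 : 0 <= m ^+ size js by exact: exprn_ge0.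
rewrite -IntZ//; last exact: bm_upd1 (bm_pints _ _ _).
apply: profile_scale => //; [|exact: pints_profile|].
  by apply: profileZ => //; exact: pints_profile.
move=> s _; apply: IHjs => //.
- by move=> i ijs; apply: dS; rewrite inE ijs orbT.
- by move=> i t y y' ijs; apply: hrel; rewrite inE ijs orbT.
- by apply: hrel => //; rewrite mem_head.
Qed.

(** A coordinate [j] is missing from exactly one of the r + 1 lists, that of its own color.
    Integration over [j] is therefore Hölder with r functions; the remaining factor is bounded,
    uniformly in the value of coordinate [j], by its value at 0, where a section volume is
    largest. *)
Lemma Finner (m r : nat) S (D : seq 'I_n) (col : 'I_n -> 'I_m) x :
  (0 < r)%N -> m = r.+1 -> uniq D -> measurable S ->
  (forall j, j \in D -> down_in S j) ->
  (forall j, j \in D -> x 0 j = 0) ->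
  pints D \1_S x ^+ r <= \prod_i pints [seq j <- D | col j != i] \1_S x.
Proof.
move=> r0 mr + mS; have bS : bm (\1_S : _ -> R) by exact: bm_indic.
elim: D x => [|j D IHD] x /=.
  move=> _ _ _; rewrite prodr_const card_ord.
  by rewrite indicE; case: (_ \in _); rewrite /= ?expr1n// expr0n eqn0Ngt r0/= exprn_ge0.
move=> /andP[jD uD] dS x0.
have dj : down_in S j by apply: dS; rewrite mem_head.
have xj : upd x j 0 = x by rewrite -[in RHS](upd_id x j) x0// mem_head.
have dD i : i \in D -> down_in S i by move=> iD; apply: dS; rewrite inE iD orbT.
pose P : pred 'I_m := fun k => k != col j.
pose g (i : 'I_m) s := pints [seq k <- D | col k != i] \1_S (upd x j s).
have cP : #|P| = r.
  rewrite -[RHS]/(r.+1.-1) -mr -[in RHS](card_ord m) -(cardC1 (col j)).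
  by apply: eq_card => k; rewrite !inE.
have bg (i : 'I_m) : bm (g i) by exact: bm_upd1 (bm_pints _ _ _).
have := @Int_Hoelder _ _ M_ge1 _ P r (pints [seq k <- D | col k != col j] \1_S x)
  (fun s => pints D \1_S (upd x j s)) g cP r0 (pints_ge0 _ _ _ bS)
  (bm_upd1 _ _ (bm_pints _ _ bS)) bg.
rewrite [X in _ -> X]/= => H.
rewrite (bigD1 (col j))//= eqxx /=.
rewrite [X in _ <= _ * X](eq_bigr (fun k => Int M (g k))); last first.
  by move=> k kj; rewrite eq_sym kj.
apply: H => // s _.
have upD i : i \in D -> upd x j s 0 i = 0.
  move=> iD; rewrite updE; case: eqVneq => [E|_]; first by rewrite -E iD in jD.
  by rewrite x0// inE iD orbT.
apply: le_trans (IHD _ uD dD upD) _; rewrite (bigD1 (col j))//=.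
apply: ler_wpM2r; first by apply: prodr_ge0 => i _; exact: pints_ge0.
have jD' : j \notin [seq k <- D | col k != col j] by rewrite mem_filter eqxx.
by have := profile_max s (pints_profile x mS dj jD'); rewrite xj.
Qed.

End downward_closed_sets.

(** * The integral of a truncated power *)

Section integral_power.
Context (R : realType) (M : R).
Hypothesis M_ge1 : 1 <= M.

Definition spike (k : nat) (r s : R) : R := \1_(`[0, r]%classic) s * (r - s) ^+ k.

Lemma bm_spike k r : bm (spike k r).
Proof.
split; last first.
  exists (`|r| ^+ k) => s; rewrite /spike indicE.
  have [/set_mem|_] := boolP (s \in _); last by rewrite mul0r lexx exprn_ge0.
  rewrite /= in_itv/= mul1r => /andP[s0 sr].
  rewrite exprn_ge0 ?subr_ge0//= lerXn2r ?nnegrE ?subr_ge0//.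
  by have := ler_norm r; lra.
apply: measurable_funM; first exact: measurable_indic.
by apply: measurable_funX; apply: measurable_funB.
Qed.

Let powF k r (x : R) := (r - x) ^+ k.+1 / - k.+1%:R.

Let cvg_pow k (r x : R) : (fun y => (r - y) ^+ k) @ x --> (r - x) ^+ k.
Proof.
apply: (@cvg_comp _ _ _ (fun y => r - y) (fun x => x ^+ k)).
  by apply: cvgB; [exact: cvg_cst|exact: cvg_id].
exact: exprn_continuous.
Qed.

Let derivable_pow k (r x : R) : derivable (fun y => (r - y) ^+ k) x 1.
Proof.
have := @derivableX _ _ (fun y : R => r - y) k x 1.
by rewrite fctE; apply; apply: derivableB.
Qed.

Let derive_pow k (r x : R) :
  (fun y => (r - y) ^+ k)^`()%classic x = - k%:R * (r - x) ^+ k.-1.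
Proof.
rewrite (@derive1_comp _ (fun y => r - y) (fun x => x ^+ k))//; last first.
  exact: exprn_derivable.
rewrite derive1E exp_derive// derive1E deriveB// -derive1E.
by rewrite derive1_cst derive_id sub0r mulrN1 [in RHS]mulNr scaler1.
Qed.

Lemma Int_spike k (r : R) : 0 <= r <= 1 -> Int M (spike k r) = r ^+ k.+1 / k.+1%:R.
Proof.
(* The degenerate interval r = 0 is treated apart: the fundamental theorem needs r > 0, and 0^0 = 1
   makes the integrand the indicator of a point when k = 0. *)
move=> /andP[]; rewrite le_eqVlt => /orP[/eqP <- _|r0 r1].
  rewrite expr0n/= mul0r; apply/eqP; rewrite eq_le Int_ge0 ?andbT//; last exact: bm_spike.
  have bz : bm (\1_(`[0, 0]%classic : set R) : R -> R) by apply: bm_indic; exact: measurable_itv.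
  apply: (@le_trans _ _ (Int M (\1_(`[0, 0]%classic : set R)))).
    apply: Int_le => //; first exact: bm_spike.
    move=> s _; rewrite /spike indicE; have [/set_mem|_] := boolP (s \in _); last by rewrite mul0r.
    rewrite /= in_itv/= => s0; have -> : s = 0 by lra.
    by rewrite subrr mul1r expr0n lern1 leq_b1.
  by rewrite Int_indic_itv//; have := M_ge1; lra.
apply: EFin_inj; rewrite -IntE//; last exact: bm_spike.
transitivity (\int[lebesgue_measure]_(x in `[0%R, r]) ((r - x) ^+ k)%:E)%E.
  rewrite [RHS]integral_mkcond; apply: eq_integral => s _; rewrite /spike patchE indicE.
  case: ifPn => [/set_mem|]; rewrite ?mul0r ?mul0r//= in_itv/= => sr.
  by rewrite cutoff1 ?mul1r ?mulr1//; have := M_ge1; lra.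
rewrite (@continuous_FTC2 _ (fun x : R => (r - x) ^+ k) (powF k r))//=.
- by rewrite /powF subrr expr0n/= mul0r subr0 -EFinB; congr EFin; rewrite sub0r invrN mulrN opprK.
- by apply: continuous_subspaceT => x; exact: cvg_pow.
- split.
  + by move=> y _; apply: derivableM => //=; exact: derivable_pow.
  + by apply: cvg_at_right_filter; apply: cvgM; [exact: cvg_pow|exact: cvg_cst].
  + by apply: cvg_at_left_filter; apply: cvgM; [exact: cvg_pow|exact: cvg_cst].
- move=> x _; rewrite (derive1Mr _ (@derivable_pow k.+1 r x)).
  by rewrite derive_pow mulrAC divff// ?mul1r// oppr_eq0 pnatr_eq0.
Qed.

End integral_power.

(** * Superlevel sets of the fibre volume, with the level as a coordinate *)

Section level_coordinate.
Context (R : realType) (n : nat) (M : R).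
Hypothesis M_ge1 : 1 <= M.
Local Notation pints := (pints M).
Implicit Types (x y z : 'rV[R]_n) (i j : 'I_n) (ys : seq 'I_n) (u s : R).
Variables (A : set 'rV[R]_n) (j0 : 'I_n) (js : seq 'I_n).
Hypotheses (j0js : j0 \in js) (mA : measurable A) (dA : downset A) (ujs : uniq js).
Let G x := pints js \1_A x.
Hypothesis G0 : 0 < G 0.

(* The set of pairs (u, y) with u G(0) <= G(y): since G does not depend on the coordinates in
   [js], one of them, [j0], is free to carry the level u. *)
Definition superlevel : set 'rV[R]_n :=
  [set x : 'rV[R]_n | 0 < x 0 j0 < 1 /\ pints js \1_A 0 * x 0 j0 <= pints js \1_A x].

Let bA : bm (\1_A : 'rV[R]_n -> R). Proof. exact: bm_indic. Qed.

Let bG : bm G. Proof. exact: bm_pints. Qed.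

Let G_upd x j s : j \in js -> G (upd x j s) = G x.
Proof.
move=> jjs; apply: eq_pints_out => i ijs; rewrite updE.
by case: eqVneq ijs => // ->; rewrite jjs.
Qed.

Lemma measurable_superlevel : measurable superlevel.
Proof.
have mj : measurable_fun setT (fun x : 'rV[R]_n => x 0 j0) by exact: measurable_rV_coord.
pose b (x : 'rV[R]_n) := (0 < x 0 j0) && (x 0 j0 < 1) && (G 0 * x 0 j0 <= G x).
rewrite (_ : superlevel = setT `&` b @^-1` [set true]).
  have mb : measurable_fun setT b; last exact: mb.
  apply: measurable_and; first apply: measurable_and.
  - exact: measurable_fun_ltr.
  - exact: measurable_fun_ltr.
  - by apply: measurable_fun_ler; [apply: measurable_funM|case: bG].
rewrite setTI; apply/seteqP; split => x; rewrite /superlevel /b /=.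
  by move=> [-> ->].
by move=> /andP[-> ->].
Qed.

Let prof x i : i \notin js -> profile (fun s => G (upd x i s)).
Proof. by move=> ijs; exact: (pints_profile M_ge1 x mA (dA i) ijs). Qed.

Lemma superlevel_down i : i \notin js -> down_in superlevel i.
Proof.
move=> ijs x [x01 Gx].
have xi0 : 0 <= x 0 i.
  rewrite leNgt; apply/negP => xi; have [_ /(_ _ xi) + _] := prof x ijs.
  rewrite upd_id => E; move: Gx; rewrite -/(G x) E leNgt mulr_gt0//.
  by case/andP: x01.
have ij0 : i != j0 by apply: contraNneq ijs => ->.
split=> // s /andP[s0 sx]; rewrite /superlevel /= updE eq_sym (negPf ij0); split=> //.
apply: (le_trans Gx); have [_ _ /(_ _ _ s0 sx)] := prof x ijs.
by rewrite upd_id.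
Qed.

Let G_le x : G x <= G 0.
Proof.
pose x0 : 'rV[R]_n := \row_i (if i \in js then 0 else x 0 i).
have -> : G x = G x0.
  by apply: eq_pints_out => i ijs; rewrite mxE (negPf ijs).
apply: (@pints_rel _ _ _ M_ge1 (fun y y' : 'rV[R]_n => forall i, y' 0 i =
    if i \in js then y 0 i else 0)) => //.
- move=> j s y y' jjs _ yy' i; rewrite !updE; case: eqVneq => [->|_]; first by rewrite jjs.
  exact: yy'.
- move=> y y' yy'; apply: indic_le => Ay; apply: (downset_le dA Ay) => i; rewrite yy'.
  have [yi _] := dA i Ay.
  by case: ifP => _; rewrite ?yi lexx.
- by move=> i; rewrite !mxE; case: (i \in js).
Qed.

(** For fixed other coordinates the admissible levels are those of ]0, 1[ up to G(x) / G(0), which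
    is at most 1 because G is largest at the origin. *)
Lemma pint_superlevel x : pint M j0 \1_superlevel x = pints js \1_A x / pints js \1_A 0.
Proof.
have h : G x / G 0 <= 1 by rewrite ler_pdivrMr// mul1r.
have := Int_level_point M_ge1 G0 (bm_ge0 x bG); rewrite (min_idPr h) => <-.
apply: eq_Int => s _; rewrite !indicE; congr ((nat_of_bool _)%:R).
have E : superlevel (upd x j0 s) <-> (0 < s < 1 /\ G 0 * s <= G x).
  by rewrite /superlevel /= upd_same -/(G 0) -/(G (upd x j0 s)) G_upd.
by apply/idP/idP; rewrite !inE => /E.
Qed.

(** The layer-cake formula for G over the coordinates [ys]: the integral over the level carried by
    [j0] is moved outside the integrals over [ys]. *)
Lemma pints_superlevel ys :
  pints (ys ++ js) \1_A 0 =
  pints js \1_A 0 * Int M (fun u => pints ys \1_superlevel (upd 0 j0 u)).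
Proof.
have bS : bm (\1_superlevel : 'rV[R]_n -> R).
  by apply: bm_indic; exact: measurable_superlevel.
rewrite pints_cat -/G.
transitivity (pints ys (fun x => G 0 * pint M j0 \1_superlevel x) 0).
  apply: eq_pints => x _ _; rewrite pint_superlevel mulrC divfK// gt_eqF//.
rewrite pintsZ//; [|exact: ltW|exact: bm_pint]; congr (_ * _).
rewrite -[RHS]/(pints (j0 :: ys) \1_superlevel 0) -[pint _ _ _]/(pints [:: j0] \1_superlevel).
by rewrite -pints_cat (perm_pints M_ge1 (js2 := j0 :: ys))// -cat1s perm_catC.
Qed.

Variable ys : seq 'I_n.
Hypotheses (uys : uniq ys) (ysjs : forall i, i \in ys -> i \notin js).

Let V u := pints ys \1_superlevel (upd 0 j0 u).

Let j0ys : j0 \notin ys.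
Proof. by apply/negP => /ysjs; rewrite j0js. Qed.

Lemma bm_profile_superlevel : bm V.
Proof.
by apply/bm_upd1/bm_pints => //; apply: bm_indic; exact: measurable_superlevel.
Qed.

Lemma superlevel_volume_out u : ~~ (0 < u < 1) -> V u = 0.
Proof.
move=> u01; rewrite -[RHS](pints0 M ys (upd 0 j0 u)); apply: eq_pints => y yu _.
by rewrite indicE memNset// => -[]; rewrite yu// upd_same (negPf u01).
Qed.

Lemma superlevel_volume_decr u u' : 0 < u -> u <= u' -> u' < 1 -> V u' <= V u.
Proof.
move=> u0 uu' u1.
have bS : bm (\1_superlevel : 'rV[R]_n -> R).
  by apply: bm_indic; exact: measurable_superlevel.
apply: (@pints_rel _ _ _ M_ge1 (fun y y' : 'rV[R]_n => y' = upd y j0 u /\ y 0 j0 = u')) => //.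
- move=> j s y y' jys _ [-> yj].
  have jj0 : j0 != j by apply: contraNneq j0ys => ->.
  by rewrite upd_comm// updE (negPf jj0).
- move=> y y' [-> yj]; apply: indic_le => -[y01 Gy]; rewrite /superlevel /= upd_same.
  split; first lra.
  rewrite -/(G (upd y j0 u)) G_upd//; apply: le_trans Gy; rewrite ler_pM2l// yj//.
- by rewrite upd_upd upd_same.
Qed.

Hypothesis cA : forall z z' (t : R), 0 < t < 1 -> A z -> A z' -> A ((1 - t) *: z + t *: z').

(** Let v and v' be the N-th roots of u and u'. By Brunn-Minkowski between the origin and y, G(y) >=
    v^N G(0) implies G(m y) >= (1 - m + m v)^N G(0), and m = (1 - v') / (1 - v) is the factor that
    makes the bracket v'. So m times the section at level u lies in the section at level u'. *)
Lemma superlevel_volume_scale u u' : 0 < u -> u <= u' -> u' < 1 ->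
  V u * (1 - u' `^ (size js)%:R^-1) ^+ size ys <=
  V u' * (1 - u `^ (size js)%:R^-1) ^+ size ys.
Proof.
move=> u0; rewrite le_eqVlt => /orP[/eqP -> //|uu'] u1.
have N0 : (0 < size js)%N by case: (js) j0js.
set v := u `^ _; set v' := u' `^ _.
have root_spec w : 0 < w -> (w `^ (size js)%:R^-1) ^+ size js = w.
  by move=> w0; rewrite -powR_mulrn ?powR_ge0// -powRrM mulVf ?powRr1 ?ltW// pnatr_eq0 -lt0n.
have vE : v ^+ size js = u by exact: root_spec.
have v'E : v' ^+ size js = u' by apply: root_spec; exact: lt_trans uu'.
have v0 : 0 < v by rewrite powR_gt0.
have v'0 : 0 <= v' by exact: powR_ge0.
have vv' : v < v'.
  by rewrite -(ltr_pXn2r N0) ?nnegrE ?(ltW v0)// vE v'E.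
have v'1 : v' < 1.
  by rewrite -(ltr_pXn2r N0) ?nnegrE// v'E expr1n.
pose m := (1 - v') / (1 - v).
have mv : m * (1 - v) = 1 - v' by rewrite /m divfK// gt_eqF//; lra.
have m01 : 0 < m < 1.
  by rewrite /m divr_gt0/= ?ltr_pdivrMr ?mul1r; lra.
have [g g0 gE] := exists_root_gt0 N0 G0.
suff H : m ^+ size ys * V u <= V u'.
  have := ler_wpM2r (exprn_ge0 (size ys) (ltW (_ : 0 < 1 - v))) H.
  rewrite subr_gt0 => /(_ (lt_trans vv' v'1)).
  by rewrite mulrAC -exprMn mv mulrC.
apply: (@pints_scale _ _ _ M_ge1 (fun z z' : 'rV[R]_n =>
   [/\ z 0 j0 = u, z' 0 j0 = u' & forall i, i != j0 -> z' 0 i = m * z 0 i])) => //.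
- exact: measurable_superlevel.
- by move=> j /ysjs; exact: superlevel_down.
- by case/andP: m01 => -> /ltW ->.
- move=> j s y y' jys [yj y'j yy'].
  have jj0 : j0 == j = false by apply/negbTE; apply: contraNneq j0ys => ->.
  split; rewrite ?updE ?jj0// => i ij0; rewrite !updE; case: eqP => // _; exact: yy'.
- move=> y y' [yj y'j yy'] [_ Gy]; split; first by rewrite y'j; lra.
  rewrite -/(G y') y'j -/(G 0).
  have -> : G y' = G ((1 - m) *: 0 + m *: y).
    apply: eq_pints_out => i ijs; rewrite !mxE mulr0 add0r yy'//.
    by apply: contraNneq ijs => ->.
  have a1 : g ^+ size js <= G 0 by rewrite gE.
  have a2 : (g * v) ^+ size js <= G y by rewrite exprMn gE vE -yj.
  have := pints_Brunn_Minkowski M_ge1 ujs mA dA cA m01 g0 (mulr_gt0 g0 v0) a1 a2.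
  apply: le_trans; rewrite (_ : (1 - m) * g + m * (g * v) = g * v'); last first.
    have {1}-> : v' = 1 - m * (1 - v) by rewrite mv; ring.
    by ring.
  by rewrite exprMn gE v'E.
- by split; rewrite ?upd_same// => i ij0; rewrite !updE (negPf ij0) mxE mulr0.
Qed.

End level_coordinate.

(** * Topology and measurability in the space of row vectors *)

Section row_vector_topology.
Context (R : realType) (n : nat).
Implicit Types (x y : 'rV[R]_n) (S K : set 'rV[R]_n) (i : 'I_n).

Lemma continuous_rV_coord i : continuous (fun x => x 0 i).
Proof. by move=> x; exact: coord_continuous. Qed.

(** The measurable sets are generated by the coordinates, so an open set is written as the countable
    union of the cubes with rational centre and side 2 / (k + 1) that it contains. *)
Lemma open_measurable_rV S : open S -> measurable S.
Proof.
move=> oS.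
pose cube (p : 'rV[rat]_n * nat) : set 'rV[R]_n :=
  [set x | forall i, `|x 0 i - ratr (p.1 0 i)| < p.2.+1%:R^-1].
pose F p : set 'rV[R]_n := [set x | cube p x /\ cube p `<=` S].
have mcube p : measurable (cube p).
  rewrite (_ : cube p = \bigcap_(i in [set: 'I_n])
      rV_coord i @^-1` [set s | `|s - ratr (p.1 0 i)| < p.2.+1%:R^-1]).
    apply: fin_bigcap_measurable => // i _.
    rewrite -[X in measurable X]setTI; apply: measurable_rV_coord => //.
    rewrite (_ : [set s | _] =
        `](ratr (p.1 0 i) - p.2.+1%:R^-1), (ratr (p.1 0 i) + p.2.+1%:R^-1)[%classic).
      exact: measurable_itv.
    by apply/seteqP; split => s /=; rewrite in_itv/= ltr_distl.
  by apply/seteqP; split => x Sx i; [move=> _|]; exact: Sx.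
rewrite (_ : S = \bigcup_p F p).
  apply: countable_bigcupT_measurable; first exact: countableP.
  move=> p; have [h|h] := pselect (cube p `<=` S).
    by rewrite (_ : F p = cube p)//; apply/seteqP; split => x //= [].
  by rewrite (_ : F p = set0) ?measurable0//; apply/seteqP; split => x //= [].
apply/seteqP; split => [x Sx|x [p _] [cx]]; last exact.
have /nbhs_ballP[e /= e0 eS] : nbhs x S by exact: open_nbhs_nbhs.
have [k ke] : exists k : nat, k.+1%:R^-1 < e / 2.
  have [k _ kP] := near_infty_natSinv_lt (PosNum (divr_gt0 e0 (ltr0Sn _ 1))).
  by exists k; exact: (kP k (leqnn k)).
have k0 : 0 < k.+1%:R^-1 :> R by rewrite invr_gt0.
have /choice[q Hq] : forall i, exists q : rat, `|x 0 i - ratr q| < k.+1%:R^-1 :> R.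
  move=> i; have [|q] := @rat_in_itvoo R (x 0 i - k.+1%:R^-1) (x 0 i + k.+1%:R^-1).
    by rewrite ltrBlDr -addrA ltrDl addr_gt0.
  by rewrite in_itv/= => qx; exists q; rewrite distrC ltr_distl.
exists (\row_i q i, k) => //; split => /= [i|y cy]; first by rewrite mxE.
apply: eS; split => // a i; rewrite /ball /= (ord1 a).
have := cy i; have := Hq i; rewrite /= mxE (distrC (y 0 i)) => h1 h2.
apply: (le_lt_trans (ler_distD (ratr (q i)) (x 0 i) (y 0 i))).
by rewrite [ltRHS]splitr; apply: ltrD; [exact: lt_trans h1 ke|exact: lt_trans h2 ke].
Qed.

Lemma closed_measurable_rV S : closed S -> measurable S.
Proof.
move=> cS; rewrite -(setCK S); apply: measurableC; apply: open_measurable_rV.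
exact: closed_openC.
Qed.

Lemma compact_measurable_rV S : compact S -> measurable S.
Proof.
by move=> cS; apply: closed_measurable_rV; exact: compact_closed.
Qed.

Lemma compact_coord_bounded S : compact S ->
  exists2 C : R, 0 <= C & forall x, S x -> forall i, `|x 0 i| <= C.
Proof.
move=> cS; have /choice[C HC] : forall i, exists C : R, 0 <= C /\ forall x, S x -> `|x 0 i| <= C.
  move=> i; have : compact ((fun x => x 0 i) @` S).
    by apply: continuous_compact => //; apply: continuous_subspaceT; exact: continuous_rV_coord.
  move=> /compact_bounded[B [_ HB]]; exists (`|B| + 1); split; first by rewrite addr_ge0.
  move=> x Sx; apply: (HB (`|B| + 1)); first by have := ler_norm B; lra.
  by exists x.
exists (\sum_i C i); first by apply: sumr_ge0 => i _; have [] := HC i.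
move=> x Sx i; rewrite (bigD1 i)//=; have [_ /(_ x Sx)] := HC i.
move=> h; apply: (le_trans h); rewrite lerDl; apply: sumr_ge0 => k _; by have [] := HC k.
Qed.

Lemma closed_coord_le i (c : R) : closed [set x : 'rV[R]_n | x 0 i <= c].
Proof.
rewrite (_ : [set _ | _] = (fun x => x 0 i) @^-1` [set s | s <= c]) //.
by apply: preimage_closed; [move=> x _; exact: continuous_rV_coord|exact: closed_le].
Qed.

Lemma continuous_sum_coord (js : seq 'I_n) : continuous (fun x => \sum_(j <- js) x 0 j).
Proof.
elim: js => [|j js IHjs].
  rewrite [X in continuous X](_ : _ = cst 0); first exact: cst_continuous.
  by apply/funext => x; rewrite big_nil.
rewrite [X in continuous X](_ : _ = (fun x => x 0 j) \+ (fun x => \sum_(k <- js) x 0 k)).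
  by move=> x; apply: continuousD; [exact: continuous_rV_coord|exact: IHjs].
by apply/funext => x; rewrite big_cons.
Qed.

Lemma minkowski_sum_compact S K : compact S -> compact K -> compact (minkowski_sum S K).
Proof.
move=> cS cK.
have -> : minkowski_sum S K = (fun z : 'rV[R]_n * 'rV[R]_n => z.1 + z.2) @` (S `*` K).
  apply/seteqP; split => x /=.
    by move=> [a Sa [b Kb <-]]; exists (a, b).
  by move=> [[a b] /= [Sa Kb] <-]; exists a => //; exists b.
apply: continuous_compact; last exact: compact_setX.
by apply: continuous_subspaceT => z; exact: add_continuous.
Qed.

End row_vector_topology.

(** * Section volumes of the extremal body *)

Section extremal_body.
Context (R : realType) (n : nat) (M : R).
Hypothesis M_ge1 : 1 <= M.
Local Notation pints := (pints M).
Implicit Types (x y z : 'rV[R]_n) (i j : 'I_n) (js ys : seq 'I_n) (u s r t : R).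

Definition csum js x : R := \sum_(j <- js) x 0 j.

Lemma csum_ge0 js x : (forall j, j \in js -> 0 <= x 0 j) -> 0 <= csum js x.
Proof. by move=> x0; rewrite /csum big_seq sumr_ge0. Qed.

Lemma eq_csum js x y : (forall j, j \in js -> x 0 j = y 0 j) -> csum js x = csum js y.
Proof. by move=> xy; rewrite /csum big_seq [RHS]big_seq; exact: eq_bigr. Qed.

Definition corner js r : set 'rV[R]_n :=
  [set x : 'rV[R]_n | (forall j, j \in js -> 0 <= x 0 j) /\ csum js x <= r].

(** A Dirichlet integral over a simplex. Fixing one coordinate s leaves the same integral over the
    simplex of size r - s, and then a single power of r - s remains. *)
Lemma pints_corner js p r x : uniq js -> 0 <= r <= 1 ->
  pints js (fun y => \1_(corner js r) y * (r - csum js y) ^+ p) x =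
  r ^+ (p + size js) * (p`!%:R / (p + size js)`!%:R).
Proof.
elim: js r x => [|j js IHjs] r x /=.
  move=> _ /andP[r0 _]; rewrite addn0 divff ?mulr1; last by rewrite pnatr_eq0 -lt0n fact_gt0.
  by rewrite indicE mem_set ?mul1r /csum ?big_nil ?subr0//; split => //; rewrite /csum big_nil.
move=> /andP[jjs ujs] r01.
set c := p`!%:R / (p + size js)`!%:R : R.
have c0 : 0 <= c by rewrite divr_ge0.
transitivity (Int M (fun s => c * spike (p + size js) r s)).
  apply: eq_Int => s _; rewrite /spike indicE.
  have [sr|sr] := boolP (0 <= s <= r); last first.
    rewrite memNset; last by rewrite /= in_itv/=; exact/negP.
    rewrite mul0r mulr0 -[RHS](pints0 M js (upd x j s)).
    apply: eq_pints => y yx _; rewrite indicE memNset ?mul0r// => -[y0 yr].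
    have yj : y 0 j = s by rewrite yx// upd_same.
    have s0 : 0 <= s by rewrite -yj; apply: y0; rewrite mem_head.
    have h : 0 <= csum js y by apply: csum_ge0 => i ijs; apply: y0; rewrite inE ijs orbT.
    move: sr yr; rewrite s0 /csum big_cons yj -/(csum js y) /= -ltNge; lra.
  rewrite mem_set/= ?in_itv//= mul1r mulrC -(IHjs (r - s) (upd x j s))//; last by lra.
  apply: eq_pints => y yx _.
  have yj : y 0 j = s by rewrite yx// upd_same.
  have E : csum (j :: js) y = s + csum js y by rewrite /csum big_cons yj.
  rewrite E opprD addrA; congr (_ * _); rewrite !indicE; congr ((nat_of_bool _)%:R).
  apply/idP/idP; rewrite !inE => -[y0 yr]; split.
  - by move=> i ijs; apply: y0; rewrite inE ijs orbT.
  - by rewrite lerBrDl -E.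
  - by move=> i; rewrite inE => /orP[/eqP ->|/y0//]; rewrite yj; lra.
  - by rewrite E -lerBrDl.
rewrite IntZ//; last exact: bm_spike.
rewrite Int_spike// addnS factS natrM /c; field.
by rewrite pnatr_eq0 -lt0n fact_gt0 -natrD -mulrS pnatr_eq0.
Qed.

Definition box ys (a b : R) : set 'rV[R]_n :=
  [set x : 'rV[R]_n | forall i, i \in ys -> a <= x 0 i <= b].

Lemma measurable_box ys (a b : R) : measurable (box ys a b).
Proof.
rewrite (_ : box ys a b = \bigcap_(i in [set i | i \in ys]) rV_coord i @^-1` `[a, b]%classic).
  apply: fin_bigcap_measurable => // i _.
  by rewrite -[X in measurable X]setTI; apply: measurable_rV_coord => //; exact: measurable_itv.
by apply/seteqP; split => x h i iys; have := h i iys; rewrite /rV_coord /= in_itv.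
Qed.

Lemma pints_box ys (a b : R) x : uniq ys -> -M <= a -> a <= b -> b <= M ->
  pints ys \1_(box ys a b) x = (b - a) ^+ size ys.
Proof.
move=> + Ma ab bM; elim: ys x => [|j ys IHys] x /=.
  by move=> _; rewrite expr0 indicE mem_set.
move=> /andP[jys uys].
transitivity (Int M (fun s => (b - a) ^+ size ys * \1_(`[a, b]%classic) s)).
  apply: eq_Int => s _; rewrite indicE.
  have [st|st] := boolP (a <= s <= b); last first.
    rewrite memNset; last by rewrite /= in_itv/=; exact/negP.
    rewrite mulr0 -[RHS](pints0 M ys (upd x j s)).
    apply: eq_pints => y yx _; rewrite indicE memNset// => /(_ j (mem_head _ _)).
    by rewrite yx// upd_same (negPf st).
  rewrite mem_set/= ?in_itv//= mulr1 -(IHys (upd x j s))//.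
  apply: eq_pints => y yx _; rewrite !indicE; congr ((nat_of_bool _)%:R).
  apply/idP/idP; rewrite !inE => yb i.
    by move=> iys; apply: yb; rewrite inE iys orbT.
  by rewrite inE => /orP[/eqP ->|/yb//]; rewrite yx// upd_same.
rewrite IntZ//; [|by rewrite exprn_ge0// subr_ge0|by apply: bm_indic; exact: measurable_itv].
by rewrite Int_indic_itv// exprSr.
Qed.

(* The equality case of [reverse_Bezout]. *)
Definition extremal js : set 'rV[R]_n :=
  [set x : 'rV[R]_n | [/\ forall i, 0 <= x 0 i, csum js x <= 1 &
    forall i, i \notin js -> x 0 i + csum js x <= 1]].

Lemma closed_extremal js : closed (extremal js).
Proof.
have -> : extremal js = (\bigcap_(i in setT) [set x : 'rV[R]_n | 0 <= x 0 i]) `&`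
    ([set x | csum js x <= 1] `&`
     \bigcap_(i in [set i | i \notin js]) [set x : 'rV[R]_n | x 0 i + csum js x <= 1]).
  apply/seteqP; split => x /=.
    by move=> [h1 h2 h3]; split=> // i _; exact: h1.
  by move=> [h1 [h2 h3]]; split=> // i; exact: h1.
have cc : continuous (csum js) by exact: continuous_sum_coord.
apply: closedI; [|apply: closedI].
- apply: closed_bigI => i _.
  rewrite (_ : [set x | _] = (fun x : 'rV[R]_n => x 0 i) @^-1` [set s | 0 <= s]) //.
  by apply: preimage_closed; [move=> x _; exact: continuous_rV_coord|exact: closed_ge].
- rewrite (_ : [set x | _] = csum js @^-1` [set s | s <= 1]) //.
  by apply: preimage_closed; [move=> x _; exact: cc|exact: closed_le].
- apply: closed_bigI => i _.
  rewrite (_ : [set x | _] = ((fun x : 'rV[R]_n => x 0 i) \+ csum js) @^-1` [set s | s <= 1]) //.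
  apply: preimage_closed; last exact: closed_le.
  by move=> x _; apply: continuousD; [exact: continuous_rV_coord|exact: cc].
Qed.

Lemma measurable_extremal js : measurable (extremal js).
Proof. by apply: closed_measurable_rV; exact: closed_extremal. Qed.

Lemma csum_le js x y : (forall i, x 0 i <= y 0 i) -> csum js x <= csum js y.
Proof. by move=> xy; apply: ler_sum. Qed.

Lemma extremal_le js x y : extremal js x -> (forall i, 0 <= y 0 i <= x 0 i) -> extremal js y.
Proof.
move=> [x0 x1 x2] yx.
have h : csum js y <= csum js x by apply: csum_le => i; have /andP[] := yx i.
split; [by move=> i; have /andP[] := yx i|exact: le_trans x1|].
by move=> i ijs; apply: le_trans (x2 i ijs); apply: lerD => //; have /andP[] := yx i.
Qed.

Lemma extremal_le1 js x j : extremal js x -> 0 <= x 0 j <= 1.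
Proof.
move=> [x0 x1 x2]; rewrite x0/=.
have c0 : 0 <= csum js x by apply: csum_ge0.
have [ijs|ijs] := boolP (j \in js); last by have := x2 j ijs; lra.
apply: le_trans x1; rewrite /csum (big_rem j)//= lerDl; apply: sumr_ge0 => k _.
exact: x0.
Qed.

Lemma extremal_down js : downset (extremal js).
Proof.
move=> j x Ex; have [x0 x1 x2] := Ex; split=> // s sx.
apply: (extremal_le Ex) => i; rewrite updE; case: eqP => [->//|_].
by rewrite x0 lexx.
Qed.

Variable js : seq 'I_n.
Hypothesis ujs : uniq js.

(** Over a point of the simplex in the coordinates [js] with coordinate sum c lies a cube of side 1
    - c in the coordinates [ys]; integrating its volume is the Dirichlet integral above. *)
Lemma pints_extremal ys : uniq ys -> (forall i, i \in ys -> i \notin js) ->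
  pints (ys ++ js) \1_(extremal js) 0 = (size ys)`!%:R / (size ys + size js)`!%:R.
Proof.
move=> uys ysjs.
have bE : bm (\1_(extremal js) : 'rV[R]_n -> R) by apply: bm_indic; exact: measurable_extremal.
have P : perm_eq (ys ++ js) (js ++ ys) by rewrite perm_catC.
rewrite (perm_pints M_ge1 bE P) pints_cat.
transitivity (pints js (fun y => \1_(corner js 1) y * (1 - csum js y) ^+ size ys) 0); last first.
  by rewrite pints_corner ?expr1n ?mul1r// ler01 lexx.
apply: eq_pints => y y0 _; rewrite indicE.
have [/set_mem[yp y1]|yN] := boolP (y \in _).
  have c0 := csum_ge0 yp.
  rewrite mul1r -[X in X ^+ _]subr0 -(@pints_box ys 0 (1 - csum js y) y)//; [|have := M_ge1; lra..].
  apply: eq_pints => z zy _; rewrite !indicE; congr ((nat_of_bool _)%:R).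
  have zE : csum js z = csum js y.
    by apply: eq_csum => j jjs; apply: zy; apply/negP => /ysjs; rewrite jjs.
  apply/idP/idP; rewrite !inE.
    by move=> [z0 z1 z2] i iys; rewrite z0/= lerBrDr -zE z2// ysjs.
  move=> zb; split.
  - move=> i; have [/zb/andP[]//|iys] := boolP (i \in ys).
    rewrite zy//; have [/yp//|ijs] := boolP (i \in js).
    by rewrite y0// mxE.
  - by rewrite zE.
  - move=> i ijs; rewrite zE; have [/zb/andP[_]|iys] := boolP (i \in ys); first by lra.
    by rewrite zy// y0// mxE add0r.
rewrite mul0r -[RHS](pints0 M ys y); apply: eq_pints => z zy _.
have zj j : j \in js -> z 0 j = y 0 j.
  by move=> jjs; apply: zy; apply/negP => /ysjs; rewrite jjs.
rewrite indicE memNset// => -[z0 z1 _]; move/negP: yN; apply; rewrite inE; split.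
  by move=> j jjs; rewrite -zj.
by rewrite -(eq_csum zj).
Qed.

Lemma pints_extremal0 : pints js \1_(extremal js) 0 = (size js)`!%:R^-1.
Proof. by have := @pints_extremal [::]; rewrite /= add0n fact0 div1r; apply. Qed.

Variable j0 : 'I_n.
Hypothesis j0js : j0 \in js.

(** The fibre over y is a simplex of size w, the minimum of 1 and the 1 - y_i, with volume w^N / N!.
    Hence G(y) >= u G(0) means that every y_i is at most 1 - u^(1/N): the superlevel section is a
    cube, with the reference profile as its volume. *)
Lemma extremal_superlevel ys u : uniq ys -> (forall i, i \in ys -> i \notin js) -> 0 < u < 1 ->
  pints ys \1_(superlevel M (extremal js) j0 js) (upd 0 j0 u) =
  (1 - u `^ (size js)%:R^-1) ^+ size ys.
Proof.
move=> uys ysjs u01; set v := u `^ _.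
have N0 : (0 < size js)%N by case: (js) j0js.
have v0 : 0 < v by rewrite powR_gt0//; lra.
have vE : v ^+ size js = u.
  rewrite -powR_mulrn ?powR_ge0// -powRrM mulVf ?powRr1//; first lra.
  by rewrite pnatr_eq0 -lt0n.
have v1 : v < 1 by rewrite -(ltr_pXn2r N0) ?nnegrE// ?vE ?expr1n ?ltW//; lra.
rewrite -[X in X ^+ _]subr0 -(@pints_box ys 0 (1 - v) (upd 0 j0 u))//; [|have := M_ge1; lra..].
apply: eq_pints => y yu _; rewrite !indicE; congr ((nat_of_bool _)%:R).
have j0ys : j0 \notin ys by apply/negP => /ysjs; rewrite j0js.
have yj : y 0 j0 = u by rewrite yu// upd_same.
have G0 : 0 < pints js \1_(extremal js) 0.
  by rewrite pints_extremal0 invr_gt0 ltr0n fact_gt0.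
have dE' i : i \in ys -> down_in (superlevel M (extremal js) j0 js) i.
  move=> /ysjs; apply: superlevel_down => //; first exact: measurable_extremal.
  exact: extremal_down.
have [w wys [w1 wmax]] := min_seq ys (fun i => 1 - y 0 i).
suff H : (forall i, i \in ys -> 0 <= y 0 i) ->
    pints js \1_(extremal js) y = if 0 <= w then w ^+ size js / (size js)`!%:R else 0.
  apply/idP/idP; rewrite !inE.
    move=> sy; have y0 i : i \in ys -> 0 <= y 0 i by move=> /dE' /(_ _ sy) [].
    move: sy => [_]; rewrite yj pints_extremal0 (H y0).
    case: ifP => w0; last by rewrite leNgt mulr_gt0 ?invr_gt0 ?ltr0n ?fact_gt0//; lra.
    rewrite mulrC ler_pM2r ?invr_gt0 ?ltr0n ?fact_gt0// -vE.
    rewrite ler_pXn2r ?nnegrE ?(ltW v0)// => vw i iys.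
    by rewrite y0//=; have := wys i iys; lra.
  move=> yb; have y0 i : i \in ys -> 0 <= y 0 i by move=> /yb /andP[].
  have vw : v <= w by apply: wmax; [exact: ltW|move=> i /yb; lra].
  split; first by rewrite yj.
  rewrite yj pints_extremal0 (H y0) ifT; last by lra.
  rewrite mulrC ler_pM2r ?invr_gt0 ?ltr0n ?fact_gt0// -vE.
  by rewrite ler_pXn2r ?nnegrE ?(ltW v0) ?(le_trans (ltW v0) vw).
move=> y0; case: ifP => w0.
  have := @pints_corner js 0 w y ujs; rewrite add0n fact0 div1r => <-; last by rewrite w0.
  apply: eq_pints => z zy _; rewrite expr0 mulr1 !indicE; congr ((nat_of_bool _)%:R).
  have zys i : i \in ys -> z 0 i = y 0 i by move=> /ysjs ijs; exact: zy.
  have z00 i : i \notin ys -> i \notin js -> z 0 i = 0.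
    move=> iys ijs; rewrite zy// yu// updE mxE; case: eqP => // E.
    by rewrite E j0js in ijs.
  apply/idP/idP; rewrite !inE.
    move=> [z0 z1 z2]; split=> [j _|]; first exact: z0.
    apply: wmax => // i iys; rewrite -(zys i iys); have := z2 i (ysjs i iys); lra.
  move=> [zj zw]; split.
  - move=> i; have [iys|iys] := boolP (i \in ys); first by rewrite zys// y0.
    have [/zj//|ijs] := boolP (i \in js).
    by rewrite z00.
  - by apply: le_trans w1.
  - move=> i ijs; have [iys|iys] := boolP (i \in ys).
      by rewrite zys//; have := wys i iys; lra.
    by rewrite z00// add0r; apply: le_trans w1.
rewrite -[RHS](pints0 M js y); apply: eq_pints => z zy _.
rewrite indicE memNset// => -[z0 z1 z2]; move/negbT: w0; rewrite -ltNge => w0.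
suff : 0 <= w by lra.
apply: wmax => // i iys; have := z2 i (ysjs i iys); rewrite (zy i (ysjs i iys)).
have : 0 <= csum js z by exact: csum_ge0.
lra.
Qed.

End extremal_body.

(** * Counting the coordinates of each color *)

Section color_classes.
Context (n r : nat) (c : 'I_n -> 'I_r.+2).

(** Renumbers the nonzero colors from 0. The default at color 0 is harmless, since the index is read
    only on coordinates of nonzero color. *)
Definition color_index (d : 'I_n -> 'I_r.+2) j : 'I_r.+1 := odflt ord0 (unlift ord0 (d j)).

Local Notation js := [seq j <- enum 'I_n | c j == ord0].
Local Notation us := [seq j <- enum 'I_n | c j != ord0].
Local Notation Es i := [seq j <- enum 'I_n | c j != lift ord0 i].
Local Notation col := (color_index c).
Local Notation ys i := [seq j <- us | col j != i].
Local Notation N := (size js).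
Local Notation q := (size us).

Lemma color_indexE j : c j != ord0 -> c j = lift ord0 (col j).
Proof.
rewrite /color_index => cj; have [i ->//|ci] := unliftP ord0 (c j).
by rewrite ci eqxx in cj.
Qed.

Lemma mem_filter_enum (P : pred 'I_n) j : (j \in [seq j <- enum 'I_n | P j]) = P j.
Proof. by rewrite mem_filter mem_enum andbT. Qed.

Lemma uniq_free_coords : uniq us. Proof. by rewrite filter_uniq// enum_uniq. Qed.
Lemma uniq_base_coords : uniq js. Proof. by rewrite filter_uniq// enum_uniq. Qed.

Lemma free_coords_base j : j \in us -> j \notin js.
Proof. by rewrite !mem_filter_enum => /negPf ->. Qed.

Lemma perm_free_base : perm_eq (us ++ js) (enum 'I_n).
Proof.
apply: uniq_perm; [|exact: enum_uniq|].
  rewrite cat_uniq uniq_free_coords uniq_base_coords andbT; apply/hasPn => j jjs.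
  by apply/negP => /free_coords_base; rewrite jjs.
by move=> j; rewrite mem_cat !mem_filter_enum mem_enum; case: (c j == ord0).
Qed.

Lemma uniq_class_coords i : uniq (ys i).
Proof. by rewrite filter_uniq// uniq_free_coords. Qed.

Lemma class_coords_base i j : j \in ys i -> j \notin js.
Proof. by rewrite mem_filter => /andP[_]; exact: free_coords_base. Qed.

Lemma perm_class_coords i : perm_eq (ys i ++ js) (Es i).
Proof.
apply: uniq_perm; [|by rewrite filter_uniq// enum_uniq|].
  rewrite cat_uniq uniq_class_coords uniq_base_coords andbT; apply/hasPn => j jjs.
  by apply/negP => /class_coords_base; rewrite jjs.
move=> j; rewrite mem_cat mem_filter !mem_filter_enum.
case: (eqVneq (c j) ord0) => [->|cj] /=; first by rewrite orbT.
by rewrite orbF andbT (color_indexE cj) (inj_eq lift_inj).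
Qed.

Lemma size_free_base : (q + N)%N = n.
Proof. by have := perm_size perm_free_base; rewrite size_cat size_enum_ord. Qed.

Lemma size_class_coords i : (size (ys i) + count (fun j => col j == i) us = q)%N.
Proof. by rewrite size_filter addnC count_predC. Qed.

Lemma sum_class_count : (\sum_i count (fun j => col j == i) us = q)%N.
Proof.
rewrite -[RHS]sum1_size.
under eq_bigr do rewrite -sum1_count.
rewrite (exchange_big_dep predT)//=; apply: eq_bigr => j _.
by rewrite (big_pred1 (col j))// => i; rewrite /= eq_sym.
Qed.

(** Each free coordinate is missing from exactly one of the r + 1 lists. This is the homogeneity
    condition of [crossing_pointwise]. *)
Lemma sum_size_class_coords : (\sum_i size (ys i) = r * q)%N.
Proof.
have : (\sum_i (size (ys i) + count (fun j => col j == i) us) = r.+1 * q)%N.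
  under eq_bigr do rewrite size_class_coords.
  by rewrite sum_nat_const card_ord.
by rewrite big_split/= sum_class_count mulSn addnC => /addnI.
Qed.

Lemma size_class_compl i : size (Es i) = (size (ys i) + N)%N.
Proof. by rewrite -(perm_size (perm_class_coords i)) size_cat. Qed.

(** Says that the sizes of the complements form an admissible family and that its N is the number of
    coordinates of color 0. *)
Lemma sum_size_classes : (\sum_i size (Es i) = N + n * r)%N.
Proof.
under eq_bigr do rewrite size_class_compl.
rewrite big_split/= sum_size_class_coords sum_nat_const card_ord.
by have := size_free_base; nia.
Qed.

End color_classes.

(** * The reverse Bezout inequality *)

Section reverse_Bezout.
Context (R : realType) (n : nat) (M : R).
Hypothesis M_ge1 : 1 <= M.
Local Notation pints := (pints M).
Variables (A : set 'rV[R]_n) (r : nat) (c : 'I_n -> 'I_r.+2).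
Hypotheses (mA : measurable A) (dA : downset A)
  (cA : forall z z' (t : R), 0 < t < 1 -> A z -> A z' -> A ((1 - t) *: z + t *: z')).

Local Notation js := [seq j <- enum 'I_n | c j == ord0].
Local Notation us := [seq j <- enum 'I_n | c j != ord0].
Local Notation Es i := [seq j <- enum 'I_n | c j != lift ord0 i].
Local Notation col := (color_index c).
Local Notation ys i := [seq j <- us | col j != i].
Local Notation N := (size js).
Local Notation q := (size us).

Let bA : bm (\1_A : 'rV[R]_n -> R). Proof. exact: bm_indic. Qed.

(** In the main case all volumes factor through G = |P_{I_0} A|, with power r + 1 on both sides.
    What is left is [crossing_integral], the binomials being the inverse integrals of the reference
    profiles. The degenerate cases r = 0, q = 0, N = 0 and G = 0 are settled beforehand. *)
Lemma reverse_Bezout :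
  ('C(n, N)%:R * pints (enum 'I_n) \1_A 0) ^+ r * pints js \1_A 0 <=
  \prod_i ('C(size (Es i), N)%:R * pints (Es i) \1_A 0).
Proof.
have uus := uniq_free_coords c; have ujs := uniq_base_coords c.
have uys i : uniq (ys i) by exact: uniq_class_coords.
have usjs j : j \in us -> j \notin js by exact: free_coords_base.
have ysjs i j : j \in ys i -> j \notin js by exact: class_coords_base.
have aE ls : 0 <= pints ls \1_A 0 by exact: pints_ge0.
have rhs0 : 0 <= \prod_i ('C(size (Es i), N)%:R * pints (Es i) \1_A 0).
  by apply: prodr_ge0 => i _; rewrite mulr_ge0.
have EsE i : pints (Es i) \1_A 0 = pints (ys i ++ js) \1_A 0.
  by rewrite (perm_pints M_ge1 bA (perm_class_coords c i)).
have allE : pints (enum 'I_n) \1_A 0 = pints (us ++ js) \1_A 0.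
  by rewrite (perm_pints M_ge1 bA (perm_free_base c)).
have [r0|r0] := posnP r.
  have er (x : R) : x ^+ r = 1 by rewrite r0.
  have E i : ys i = [::].
    apply: size0nil; have rq0 k : (r * k = 0)%N by rewrite r0.
    have := sum_size_class_coords c; rewrite rq0 => /eqP.
    by rewrite sum_nat_eq0 => /forallP/(_ i)/= /eqP.
  rewrite er mul1r (eq_bigr (fun _ => pints js \1_A 0)); last first.
    by move=> i _; rewrite EsE (size_class_compl c) E binn mul1r.
  by rewrite prodr_const card_ord exprS er mulr1.
have [q0|q0] := posnP q.
  have usE : us = [::] by exact: size0nil.
  have E i : ys i = [::] by rewrite usE.
  rewrite (eq_bigr (fun _ => pints js \1_A 0)); last first.
    by move=> i _; rewrite EsE (size_class_compl c) E binn mul1r.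
  have Cn : 'C(n, N) = 1%N by rewrite -[X in 'C(X, _)](size_free_base c) q0 binn.
  by rewrite Cn allE usE prodr_const card_ord mul1r exprSr.
(* With no coordinate of color 0 nothing can carry the level; all binomials are 1 and the claim is
   [Finner]. *)
have [N0|N0] := posnP N.
  have jsE : js = [::] by exact: size0nil.
  rewrite N0 bin0 mul1r jsE /= allE jsE cats0.
  apply: (@le_trans _ _ (pints us \1_A 0 ^+ r)).
    by rewrite ler_piMr ?exprn_ge0// indicE lern1 leq_b1.
  rewrite (eq_bigr (fun i => pints (ys i) \1_A 0)); last first.
    by move=> i _; rewrite EsE jsE cats0 bin0 mul1r.
  by apply: Finner => // j _; rewrite mxE.
have [G0|G0] := ltP 0 (pints js \1_A 0); last first.
  have -> : pints js \1_A 0 = 0 by apply/le_anti; rewrite G0 aE.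
  by rewrite mulr0.
have [j0 j0js] : exists j0, j0 \in js.
  by move: N0; case: (js) => // j l _; exists j; rewrite mem_head.
pose tau (u : R) : R := 1 - u `^ N%:R^-1.
have tau0 u : 0 < u < 1 -> 0 < tau u.
  move=> u01; rewrite subr_gt0 -(ltr_pXn2r N0) ?nnegrE ?powR_ge0// expr1n.
  rewrite -powR_mulrn ?powR_ge0// -powRrM mulVf ?powRr1//; first lra.
    by lra.
  by rewrite pnatr_eq0 -lt0n.
pose W (j : nat) (u : R) : R := \1_(`]0, 1[%classic) u * tau u ^+ j.
have W0 j u : ~~ (0 < u < 1) -> W j u = 0.
  by move=> u01; rewrite /W indicE memNset ?mul0r//= in_itv/=; exact/negP.
have W1 j u : 0 < u < 1 -> W j u = tau u ^+ j.
  by move=> u01; rewrite /W indicE mem_set ?mul1r//= in_itv.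
have bW j : bm (W j).
  split; last first.
    exists 1 => u; have [u01|u01] := boolP (0 < u < 1); last by rewrite W0// lexx ler01.
    have t0 := ltW (tau0 u u01).
    have t1 : tau u <= 1 by rewrite lerBlDr lerDl powR_ge0.
    by rewrite W1// exprn_ge0//= exprn_ile1.
  apply: measurable_funM; first exact: measurable_indic.
  apply: measurable_funX; apply: measurable_funB; first exact: measurable_cst.
  exact: measurable_powR.
(* A Beta integral, read off from the body [extremal]: by [extremal_superlevel] its profile over j
   free coordinates is W_j, and its volumes are known. *)
have IW j : (j <= q)%N -> Int M (W j) = 'C(j + N, N)%:R^-1.
  move=> jq; pose zs := take j us.
  have uzs : uniq zs by exact: take_uniq.
  have zsjs i : i \in zs -> i \notin js by move=> /mem_take; exact: usjs.
  have szs : size zs = j by rewrite size_take; case: ltngtP jq => // ->.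
  have := pints_superlevel M_ge1 j0js (measurable_extremal js) (@extremal_down _ _ js).
  rewrite (pints_extremal0 M_ge1 ujs) invr_gt0 ltr0n fact_gt0.
  move=> /(_ isT zs); rewrite (pints_extremal M_ge1 ujs uzs zsjs) szs.
  rewrite (eq_Int (g := W j)) => [E|u _].
    have : Int M (W j) = N`!%:R * (j`!%:R / (j + N)`!%:R).
      by rewrite E mulrA divff ?mul1r// pnatr_eq0 -lt0n fact_gt0.
    move=> ->; have := bin_fact (leq_addl j N); rewrite addnK => <-.
    rewrite !natrM; field.
    by rewrite !pnatr_eq0 -!lt0n !fact_gt0 bin_gt0 leq_addl.
  have [u01|u01] := boolP (0 < u < 1).
    by rewrite W1// extremal_superlevel// szs.
  rewrite W0//; apply: superlevel_volume_out => //.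
have IW0 j : (j <= q)%N -> 0 < Int M (W j).
  by move=> jq; rewrite IW// invr_gt0 ltr0n bin_gt0 leq_addl.
pose At := superlevel M A j0 js.
have mAt : measurable At by exact: measurable_superlevel.
have dAt j : j \in us -> down_in At j.
  by move=> jus; apply: superlevel_down => //; exact: usjs.
pose V u := pints us \1_At (upd 0 j0 u).
pose Vs i u := pints (ys i) \1_At (upd 0 j0 u).
have bV : bm V by exact: bm_profile_superlevel.
have V0 u : ~~ (0 < u < 1) -> V u = 0 by exact: superlevel_volume_out.
have bVs i : bm (Vs i) by exact: bm_profile_superlevel.
have Vs0 i u : ~~ (0 < u < 1) -> Vs i u = 0.
  by apply: superlevel_volume_out => // j; exact: ysjs.
have Vsp0 i : size (ys i) = 0%N -> Vs i = W 0%N.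
  move=> /size0nil E; apply/funext => u; have [u01|u01] := boolP (0 < u < 1); last first.
    by rewrite Vs0// W0.
  rewrite W1// expr0 /Vs E /= indicE mem_set//; split; first by rewrite upd_same.
  have -> : pints js \1_A (upd 0 j0 u) = pints js \1_A 0.
    apply: eq_pints_out => k kjs; rewrite updE; case: eqP => // kj.
    by rewrite kj j0js in kjs.
  by rewrite upd_same ger_pMr//; case/andP: u01 => _ /ltW.
have Vdec i u u' : 0 < u -> u <= u' -> u' < 1 -> Vs i u' <= Vs i u.
  by apply: superlevel_volume_decr => // j; exact: ysjs.
have Vinc i u u' : 0 < u -> u <= u' -> u' < 1 ->
    Vs i u * tau u' ^+ size (ys i) <= Vs i u' * tau u ^+ size (ys i).
  by apply: superlevel_volume_scale => // j; exact: ysjs.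
have VVs u : 0 < u < 1 -> V u ^+ r <= \prod_i Vs i u.
  move=> _; apply: Finner => // j jus; rewrite updE mxE; case: eqP => // E.
  by have := usjs _ jus; rewrite E j0js.
have := @crossing_integral _ _ M_ge1 r.+1 q r (fun i => size (ys i))
  (fun i => count (fun j => col j == i) us) tau W V Vs r0 q0
  (size_class_coords c) (sum_size_class_coords c) tau0 bW W1 IW0 W0 bV V0 bVs Vs0 Vsp0 Vdec Vinc VVs.
have aV : pints (us ++ js) \1_A 0 = pints js \1_A 0 * Int M V.
  exact: pints_superlevel.
have aVs i : pints (ys i ++ js) \1_A 0 = pints js \1_A 0 * Int M (Vs i).
  exact: pints_superlevel.
set G := pints js \1_A 0 in G0 aV aVs *.
rewrite allE aV IW// => H.
rewrite (eq_bigr (fun i => G * (Int M (Vs i) / Int M (W (size (ys i)))))); last first.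
  move=> i _; rewrite EsE (size_class_compl c) aVs IW.
    by rewrite invrK mulrCA (mulrC (Int _ _)).
  by rewrite -(size_class_coords c i) leq_addr.
rewrite big_split/= prodr_const card_ord exprSr.
rewrite (size_free_base c) in H; have C0 : 0 < 'C(n, N)%:R :> R.
  by rewrite ltr0n bin_gt0 -[X in (_ <= X)%N](size_free_base c) leq_addl.
rewrite mulrA exprMn mulrAC; apply: le_trans (ler_wpM2l _ H) _.
  by rewrite mulr_ge0 ?exprn_ge0 ?mulr_ge0 ?ltW.
rewrite exprMn exprVn le_eqVlt; apply/orP; left; apply/eqP; field.
by rewrite expf_neq0// gt_eqF.
Qed.

End reverse_Bezout.

(** * Upper bound for the volume of a signed sum *)

Section signed_sumsets.
Context (R : realType) (n : nat) (M : R).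
Hypothesis M_ge1 : 1 <= M.
Local Notation pints := (pints M).
Variables (I : finType) (K : I -> set 'rV[R]_n) (eps : I -> bool).
Hypotheses (cK : forall i, compact (K i)) (dK : forall i, downset (K i))
  (KM : forall i x, K i x -> forall j, x 0 j <= M).
Implicit Types (c : {ffun 'I_n -> I}) (D : seq 'I_n) (x : 'rV[R]_n) (j : 'I_n).

Let e i : R := if eps i then 1 else -1.

Lemma bigminkowskiP (T : I -> set 'rV[R]_n) x :
  (\big[@minkowski_sum R n/[set 0]]_i T i) x <->
  exists k : I -> 'rV[R]_n, (forall i, T i (k i)) /\ x = \sum_i k i.
Proof.
suff H (s : seq I) y : uniq s -> (\big[@minkowski_sum R n/[set 0]]_(i <- s) T i) y <->
    exists k : I -> 'rV[R]_n, (forall i, i \in s -> T i (k i)) /\ y = \sum_(i <- s) k i.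
  rewrite H ?index_enum_uniq//; split=> -[k [kT ->]]; exists k; split=> // i.
  by apply: kT; rewrite mem_index_enum.
elim: s y => [|i s IHs] y /=.
  move=> _; rewrite big_nil; split=> [->|[k [_ ->]]]; last by rewrite big_nil.
  by exists (fun=> 0); rewrite big_nil.
move=> /andP[iNs us]; rewrite big_cons; split.
  move=> [a Ta [b bT <-]]; have /(IHs _ us)[k [kT ->]] := bT.
  exists (fun i' => if i' == i then a else k i'); split.
    move=> i'; rewrite inE; case: eqVneq => [->//|_] /=; exact: kT.
  rewrite big_cons eqxx; congr (_ + _); rewrite big_seq [RHS]big_seq.
  by apply: eq_bigr => i' i's; case: eqVneq i's iNs => // -> ->.
move=> [k [kT ->]]; rewrite big_cons; exists (k i); first by apply: kT; rewrite mem_head.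
exists (\sum_(j <- s) k j) => //; apply/(IHs _ us); exists k; split=> // i' i's.
by apply: kT; rewrite inE i's orbT.
Qed.

Lemma bigminkowski_compact (T : I -> set 'rV[R]_n) : (forall i, compact (T i)) ->
  compact (\big[@minkowski_sum R n/[set 0]]_i T i).
Proof.
move=> cT; elim/big_ind : _ => //; first exact: compact_set1.
by move=> A B; exact: minkowski_sum_compact.
Qed.

(* In the coordinates of [D], only the summand of index [c j] may be nonzero. *)
Definition split_sum D c : set 'rV[R]_n := [set x | exists k : I -> 'rV[R]_n,
  [/\ forall i, K i (k i), forall i j, j \in D -> c j != i -> k i 0 j = 0 &
      x = \sum_i e i *: k i]].

Lemma compact_split_sum D c : compact (split_sum D c).
Proof.
pose T i := (fun x => e i *: x) @` (K i `&`
  \bigcap_(j in [set j | j \in D /\ c j != i]) [set x : 'rV[R]_n | x 0 j = 0]).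
rewrite (_ : split_sum D c = \big[@minkowski_sum R n/[set 0]]_i T i).
  apply: bigminkowski_compact => i; apply: continuous_compact.
    by apply: continuous_subspaceT => x; exact: scaler_continuous.
  apply: compact_closedI => //; apply: closed_bigI => j _.
  rewrite (_ : [set x | _] = (fun x : 'rV[R]_n => x 0 j) @^-1` [set s | s = 0]) //.
  by apply: preimage_closed; [move=> x _; exact: continuous_rV_coord|exact: closed_eq].
apply/seteqP; split => x.
  move=> [k [kK kz ->]]; apply/bigminkowskiP; exists (fun i => e i *: k i); split=> // i.
  by exists (k i) => //; split=> // j [jD cj]; exact: kz.
move=> /bigminkowskiP[k [kT ->]].
have /choice[h hP] : forall i, exists y, (K i y /\ (forall j, j \in D -> c j != i -> y 0 j = 0))
    /\ e i *: y = k i.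
  move=> i; have [y [Ky yz] yk] := kT i; exists y; split=> //; split=> // j jD cj.
  exact: yz.
exists h; split=> [i|i j|].
- by have [[]] := hP i.
- by have [[_ /(_ j)]] := hP i.
- by apply: eq_bigr => i _; have [_ ->] := hP i.
Qed.

Lemma measurable_split_sum D c : measurable (split_sum D c).
Proof. by apply: compact_measurable_rV; exact: compact_split_sum. Qed.

Let bS D c : bm (\1_(split_sum D c) : 'rV[R]_n -> R).
Proof. by apply: bm_indic; exact: measurable_split_sum. Qed.

Definition recolor c j i : {ffun 'I_n -> I} := [ffun j' => if j' == j then i else c j'].

Lemma measurable_slice (S : set 'rV[R]_n) x j : measurable S ->
  measurable [set s : R | S (upd x j s)].
Proof.
move=> mS; have m : measurable_fun setT (fun s : R => upd x j s).
  have m1 : measurable_fun setT (fun s : R => (x, s)) by exact: measurable_fun_pair.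
  exact: (measurableT_comp (measurable_upd j) m1).
by rewrite -[X in measurable X]setTI; exact: m.
Qed.

Lemma pint_indic (S : set 'rV[R]_n) x j :
  pint M j \1_S x = Int M \1_[set s : R | S (upd x j s)].
Proof.
by apply: eq_Int => s _; rewrite !indicE.
Qed.

Lemma split_sum_recolor D c j i : j \notin D ->
  split_sum (j :: D) (recolor c j i) `<=` split_sum D c.
Proof.
move=> jD x [k [kK kz ->]]; exists k; split=> // i' j' j'D cj'.
apply: kz; first by rewrite inE j'D orbT.
by rewrite ffunE; case: (eqVneq j' j) j'D => // ->; rewrite (negPf jD).
Qed.

(* If x_j = \sum_i +- k_i is realized by the points k of the bodies, then the segment from 0
   to +- k_i lies in the i-th recolored slice; so the slice of the sum is contained in the
   Minkowski sum of intervals of lengths [lam i]. *)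
Lemma pint_split_sum_le D c j x : j \notin D ->
  pint M j \1_(split_sum D c) x <=
  \sum_i pint M j \1_(split_sum (j :: D) (recolor c j i)) x.
Proof.
move=> jD; pose lam i := pint M j \1_(split_sum (j :: D) (recolor c j i)) x.
have lam0 i : 0 <= lam i by exact: (bm_ge0 x (bm_pint M_ge1 j (bS _ _))).
have key s k : (forall i, K i (k i)) -> (forall i j', j' \in D -> c j' != i -> k i 0 j' = 0) ->
    upd x j s = \sum_i e i *: k i -> forall i, k i 0 j <= lam i.
  move=> kK kz xE i; have [kij0 _] := dK j (kK i).
  have piece t : 0 <= t <= k i 0 j ->
      split_sum (j :: D) (recolor c j i) (upd x j (e i * t)).
    move=> tk; exists (fun i' => upd (k i') j (if i' == i then t else 0)); split.
    - move=> i'; have [_] := dK j (kK i'); apply; case: eqVneq => [->//|_].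
      by have [-> _] := dK j (kK i'); rewrite lexx.
    - move=> i' j'; rewrite inE ffunE updE; case: eqVneq => [_ _ ii'|_ /= j'D cj'].
        by rewrite eq_sym (negPf ii').
      exact: kz.
    - apply/rowP => j'; rewrite updE summxE.
      have := congr1 (fun y : 'rV[R]_n => y 0 j') xE; rewrite /= updE summxE.
      case: eqVneq => [-> _|jj' ->].
        rewrite (bigD1 i)//= mxE upd_same eqxx big1 ?addr0// => i' ii'.
        by rewrite mxE upd_same (negPf ii') mulr0.
      by apply: eq_bigr => i' _; rewrite !mxE (negPf jj').
  rewrite /lam pint_indic; have kM := KM (kK i) j.
  have mP := measurable_slice x j (measurable_split_sum (j :: D) (recolor c j i)).
  move: piece; rewrite /e; case: (eps i) => piece.
    rewrite -[leLHS]subr0; apply: Int_indic_ge => //; [have := M_ge1; lra|].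
    by move=> t tk /=; have := piece t tk; rewrite mul1r.
  rewrite -[leLHS]opprK -[leLHS]add0r; apply: Int_indic_ge => //; [lra|lra|have := M_ge1; lra|].
  by move=> t tk /=; have := piece (- t); rewrite mulN1r opprK; apply; lra.
rewrite pint_indic.
pose b := \sum_i if eps i then lam i else 0.
pose a := \sum_i if eps i then 0 else - lam i.
have -> : \sum_i lam i = b - a.
  rewrite /b /a -sumrB; apply: eq_bigr => i _; case: (eps i); first by rewrite subr0.
  by rewrite add0r opprK.
have b0 : 0 <= b by apply: sumr_ge0 => i _; case: (eps i).
have a0 : a <= 0 by apply: sumr_le0 => i _; case: (eps i) => //; rewrite oppr_le0.
apply: Int_indic_le => //; [|lra|].
  by apply: measurable_slice; exact: measurable_split_sum.
move=> s sM [k [kK kz xE]]; have kl := key s k kK kz xE.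
have -> : s = \sum_i e i * k i 0 j.
  have := congr1 (fun y : 'rV[R]_n => y 0 j) xE; rewrite /= upd_same summxE => ->.
  by apply: eq_bigr => i _; rewrite mxE.
have k0 i : 0 <= k i 0 j by have [] := dK j (kK i).
apply/andP; split; apply: ler_sum => i _; have := kl i; have := k0 i; rewrite /e;
  case: (eps i); rewrite ?mul1r ?mulN1r; lra.
Qed.

Lemma pints_head j (f g : 'rV[R]_n -> R) : bm f -> bm g ->
  (forall x, pint M j f x <= pint M j g x) ->
  pints (enum 'I_n) f 0 <= pints (enum 'I_n) g 0.
Proof.
move=> bf bg fg.
have P : perm_eq (enum 'I_n) (rem j (enum 'I_n) ++ [:: j]).
  by rewrite perm_sym perm_catC perm_sym perm_to_rem// mem_enum.
rewrite (perm_pints M_ge1 bf P) (perm_pints M_ge1 bg P) !pints_cat.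
by apply: pints_le => //; exact: bm_pint.
Qed.

(* (c, i) |-> (recolor c j i, c j) is an involution. *)
Lemma sum_recolor j (F : {ffun 'I_n -> I} -> R) :
  \sum_c \sum_i F (recolor c j i) = #|I|%:R * \sum_c F c.
Proof.
rewrite pair_big/=.
pose h (p : {ffun 'I_n -> I} * I) := (recolor p.1 j p.2, p.1 j).
have hK : involutive h.
  move=> [c i]; rewrite /h /=; congr (_, _); last by rewrite ffunE eqxx.
  by apply/ffunP => j'; rewrite !ffunE; case: eqP => // ->.
rewrite (reindex_inj (inv_inj hK))/=.
under eq_bigr => p _.
  rewrite (_ : recolor _ _ _ = p.1); first over.
  by have := congr1 fst (hK p).
rewrite -(pair_big predT predT (fun c _ => F c))/= mulr_sumr.
by apply: eq_bigr => c _; rewrite sumr_const mulr_natl.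
Qed.

Let vol D c := pints (enum 'I_n) \1_(split_sum D c) 0.

Lemma pints_pint_sum j D c :
  pints (enum 'I_n) (fun x => \sum_i \1_(split_sum (j :: D) (recolor c j i)) x) 0 =
  \sum_i vol (j :: D) (recolor c j i).
Proof. by rewrite pints_sum. Qed.

(** Summing over all colorings at once makes the one-coordinate step uniform: by [sum_recolor] each
    treated coordinate costs a factor #|I|. The total #|I|^n cancels, since with no treated
    coordinate all colorings give the same set. *)
Lemma volume_split_sum_le c0 : (0 < #|I|)%N -> vol [::] c0 <= \sum_c vol (enum 'I_n) c.
Proof.
move=> I0.
have H D : uniq D -> \sum_c vol [::] c <= #|I|%:R ^+ size D * \sum_c vol D c.
  elim: D => [_|j D IHD /= /andP[jD uD]]; first by rewrite expr0 mul1r.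
  apply: le_trans (IHD uD) _; rewrite exprSr -mulrA ler_wpM2l ?exprn_ge0//.
  rewrite -(sum_recolor j (vol (j :: D))); apply: ler_sum => c _.
  rewrite -pints_pint_sum; apply: (@pints_head j) => //; first by apply: bm_sum.
  move=> x; rewrite {2}/pint Int_sum //; last by move=> i _; exact: bm_upd1.
  exact: pint_split_sum_le.
have := H (enum 'I_n) (enum_uniq _); rewrite size_enum_ord.
have E c : vol [::] c = vol [::] c0.
  rewrite /vol (_ : split_sum [::] c = split_sum [::] c0)//.
  by apply/seteqP; split => x [k [kK _ xE]]; exists k.
rewrite (eq_bigr (fun _ => vol [::] c0))// sumr_const card_ffun card_ord -[leLHS]mulr_natl natrX.
by rewrite ler_pM2l// exprn_gt0// ltr0n.
Qed.

Let proj c i x : 'rV[R]_n := \row_j (if c j == i then e i * x 0 j else 0).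

Lemma measurable_proj c i : measurable_fun setT (proj c i).
Proof.
apply: measurable_fun_rVP => j.
rewrite [X in measurable_fun _ X](_ : _ =
    if c j == i then (fun x : 'rV[R]_n => e i * rV_coord j x) else cst 0).
  case: eqP => _; [|exact: measurable_cst].
  by apply: measurable_funM; [exact: measurable_cst|exact: measurable_rV_coord].
by apply/funext => x; rewrite /= /rV_coord mxE; case: ifP.
Qed.

Lemma eps_sq i : e i * e i = 1.
Proof. by rewrite /e; case: (eps i); rewrite ?mul1r// mulrNN mul1r. Qed.

(** Once all coordinates are treated the summands have disjoint supports, so x determines them: the
    i-th one is [proj c i x]. *)
Lemma split_sum_full c x : split_sum (enum 'I_n) c x <-> forall i, K i (proj c i x).
Proof.
split.
  move=> [k [kK kz ->]] i; rewrite (_ : proj c i _ = k i)//; apply/rowP => j; rewrite mxE.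
  case: eqVneq => [cj|cj]; last by rewrite kz// mem_enum.
  rewrite summxE (bigD1 i)//= big1 ?addr0 ?mxE ?mulrA ?eps_sq ?mul1r// => i' ii'.
  by rewrite mxE kz ?mulr0// ?mem_enum// cj eq_sym.
move=> xK; exists (proj c ^~ x); split=> // [i j _ cj|]; first by rewrite mxE (negPf cj).
apply/rowP => j; rewrite summxE (bigD1 (c j))//= !mxE eqxx mulrA eps_sq mul1r big1 ?addr0// => i ij.
by rewrite !mxE eq_sym (negPf ij) mulr0.
Qed.

Lemma pints_opp js (f : 'rV[R]_n -> R) x : bm f ->
  pints js (fun y => f (- y)) (- x) = pints js f x.
Proof.
move=> bf; elim: js x => [|j js IHjs] x /=; first by rewrite opprK.
rewrite /pint -[RHS](IntN M); last exact: bm_upd1 (bm_pints _ _ bf).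
apply: eq_Int => s _; rewrite -IHjs; congr (pints _ _ _).
by apply/rowP => i; rewrite !mxE; case: eqP => // _; rewrite opprK.
Qed.

(** The piece is a product over the color classes of sections of the bodies, some of them reflected;
    reflection preserves the volume, so the signs disappear. *)
Lemma volume_split_sum_full c :
  vol (enum 'I_n) c = \prod_i pints [seq j <- enum 'I_n | c j == i] \1_(K i) 0.
Proof.
have mK i : measurable (K i) by exact: compact_measurable_rV.
have bK i : bm (\1_(K i) : 'rV[R]_n -> R) by exact: bm_indic.
pose F i x : R := \1_(K i) (proj c i x).
have bF i : bm (F i) by exact: (bm_comp (measurable_proj c i) (bK i)).
have Fc i j y s : c j != i -> F i (upd y j s) = F i y.
  move=> cj; rewrite /F; congr (\1_ _ _); apply/rowP => j'; rewrite !mxE.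
  by case: eqVneq => // cj'; case: eqVneq => // E; rewrite -E cj' eqxx in cj.
rewrite /vol (eq_pints (g := fun x => \prod_i F i x)); last first.
  move=> y _ _; rewrite /F indicE.
  have [/set_mem/split_sum_full yK|yN] := boolP (y \in _).
    by rewrite big1// => i _; rewrite indicE mem_set.
  have [i yi] : exists i, ~ K i (proj c i y).
    apply: contrapT => h; move/negP: yN; apply; rewrite inE; apply/split_sum_full => i.
    by apply: contrapT => hi; apply: h; exists i.
  by rewrite (bigD1 i)//= indicE memNset// mul0r.
rewrite (pints_prod M_ge1 _ _ bF Fc); apply: eq_bigr => i _.
rewrite /F /proj /e; case: (eps i).
  apply: eq_pints => y yz _; congr (\1_ _ _); apply/rowP => j; rewrite mxE.
  by case: ifPn => [_|cj]; rewrite ?mul1r// yz ?mxE// mem_filter (negPf cj).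
rewrite -[RHS](pints_opp _ _ (bK i)) oppr0.
apply: eq_pints => y yz _; congr (\1_ _ _); apply/rowP => j; rewrite !mxE.
by case: ifPn => [_|cj]; rewrite ?mulN1r// yz ?mxE ?oppr0// mem_filter (negPf cj).
Qed.

End signed_sumsets.

(** * Lower bound for the volume of a difference *)

Section difference_body.
Context (R : realType) (n : nat) (M : R).
Hypothesis M_ge1 : 1 <= M.
Local Notation pints := (pints M).
Variable K : bool -> set 'rV[R]_n.
Hypotheses (cK : forall i, compact (K i)) (dK : forall i, downset (K i))
  (KM : forall i x, K i x -> forall j, x 0 j <= M).
Local Notation split_sum := (split_sum K id).

(** The sign of the body labelled by b is plus exactly when b is true, so the two recolored slices
    lie in s >= 0 and in s <= 0. Both are contained in the full slice and they overlap at most at 0;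
    the indicator of that point, of integral 0, is added to absorb the overlap. *)
Lemma pint_split_sum_ge D (c : {ffun 'I_n -> bool}) j x : j \notin D ->
  \sum_i pint M j \1_(split_sum (j :: D) (recolor c j i)) x <=
  pint M j \1_(split_sum D c) x.
Proof.
move=> jD.
have mS D' c' : measurable [set s : R | split_sum D' c' (upd x j s)].
  by apply: measurable_slice; exact: measurable_split_sum.
have bS' D' c' : bm (\1_[set s : R | split_sum D' c' (upd x j s)] : R -> R).
  exact: bm_indic.
have b0 : bm (\1_(`[0, 0]%classic : set R) : R -> R) by apply: bm_indic; exact: measurable_itv.
have sgn i s : split_sum (j :: D) (recolor c j i) (upd x j s) -> if i then 0 <= s else s <= 0.
  move=> [k [kK kz xE]].
  have := congr1 (fun y : 'rV[R]_n => y 0 j) xE; rewrite /= upd_same summxE => ->.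
  rewrite big_bool/= !mxE mul1r mulN1r.
  have [kt _] := dK j (kK true); have [kf _] := dK j (kK false).
  case: i kz => kz.
    by rewrite (kz false j) ?mem_head ?ffunE ?eqxx// oppr0 addr0.
  by rewrite (kz true j) ?mem_head ?ffunE ?eqxx// add0r oppr_le0.
rewrite big_bool/= !pint_indic -IntD//.
have z0 : Int M \1_(`[0, 0]%classic : set R) = 0.
  by rewrite Int_indic_itv ?subrr//; have := M_ge1; lra.
rewrite -[leRHS]addr0 -[X in _ <= _ + X]z0.
rewrite -IntD//; apply: Int_le => //; [exact: bmD..|].
move=> s _; rewrite !indicE.
have sub i : s \in [set s | split_sum (j :: D) (recolor c j i) (upd x j s)] ->
    s \in [set s | split_sum D c (upd x j s)].
  by rewrite !inE; exact: split_sum_recolor.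
case: (boolP (s \in [set s | split_sum (j :: D) (recolor c j true) (upd x j s)])) => st;
  case: (boolP (s \in [set s | split_sum (j :: D) (recolor c j false) (upd x j s)])) => sf.
- rewrite (sub _ st) mem_set//= in_itv/=.
  by have /= := sgn true s (set_mem st); have /= := sgn false s (set_mem sf); lra.
- by rewrite (sub _ st) addr0 lerDl.
- by rewrite (sub _ sf) add0r lerDl.
- by rewrite addr0 addr_ge0.
Qed.

(** The same averaging over all colorings as for the upper bound, with the inequality reversed. *)
Lemma volume_split_sum_ge c0 :
  \sum_c pints (enum 'I_n) \1_(split_sum (enum 'I_n) c) 0 <=
  pints (enum 'I_n) \1_(split_sum [::] c0) 0.
Proof.
have bS D c : bm (\1_(split_sum D c) : 'rV[R]_n -> R).
  by apply: bm_indic; exact: measurable_split_sum.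
pose vol D c := pints (enum 'I_n) \1_(split_sum D c) 0.
have H D : uniq D -> #|{: bool}|%:R ^+ size D * \sum_c vol D c <= \sum_c vol [::] c.
  elim: D => [_|j D IHD /= /andP[jD uD]]; first by rewrite expr0 mul1r.
  apply: le_trans (IHD uD); rewrite exprSr -mulrA ler_wpM2l ?exprn_ge0//.
  rewrite -(sum_recolor j (vol (j :: D))); apply: ler_sum => c _.
  rewrite -pints_sum//; apply: (pints_head M_ge1 (j := j)) => //; first by apply: bm_sum.
  move=> x; rewrite {1}/pint Int_sum //; last by move=> i _; exact: bm_upd1.
  exact: pint_split_sum_ge.
have := H (enum 'I_n) (enum_uniq _); rewrite size_enum_ord.
have E c : vol [::] c = vol [::] c0.
  rewrite /vol (_ : split_sum [::] c = split_sum [::] c0)//.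
  by apply/seteqP; split => x [k [kK _ xE]]; exists k.
rewrite [X in _ <= X](eq_bigr (fun _ => vol [::] c0))// sumr_const card_ffun card_ord.
rewrite -[leRHS]mulr_natl natrX.
by rewrite ler_pM2l// exprn_gt0// ltr0n card_bool.
Qed.

End difference_body.

(** * Anti-blocking bodies and downward closed convex sets *)

Section anti_blocking_bodies.
Context (R : realType) (n : nat).
Implicit Types (x y z : 'rV[R]_n) (K : set 'rV[R]_n) (J : {set 'I_n}) (i j : 'I_n).

Lemma coord_subspaceP J y : reflect (forall j, j \notin J -> y 0 j = 0) (y \in coord_subspace J).
Proof.
apply: (iffP idP) => [yJ j jJ|yJ].
  set L := [seq (delta_mx 0 i : 'rV[R]_n) | i in J] in yJ.
  rewrite (coord_span (X := in_tuple L) yJ) summxE big1// => k _; rewrite mxE.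
  have : nth 0 (in_tuple L) k \in L by apply: mem_nth.
  case/mapP => i; rewrite mem_enum => iJ ->.
  rewrite mxE eqxx; case: eqVneq => [ji|]; last by rewrite mulr0.
  by rewrite ji iJ in jJ.
rewrite (row_sum_delta y) rpred_sum// => j _.
have [jJ|jJ] := boolP (j \in J); last by rewrite yJ// scale0r rpred0.
by apply/rpredZ/memv_span/mapP; exists j; rewrite ?mem_enum.
Qed.

Definition restr J x : 'rV[R]_n := \row_j (if j \in J then x 0 j else 0).

Lemma is_orth_projP J x y : is_orth_proj (coord_subspace J) x y <-> y = restr J x.
Proof.
split=> [[/coord_subspaceP yJ xy]|->].
  apply/rowP => j; rewrite mxE; case: ifPn => jJ; last exact: yJ.
  have := xy (delta_mx 0 j); have dJ : delta_mx 0 j \in @coord_subspace R n J.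
    by apply/memv_span/mapP; exists j; rewrite ?mem_enum.
  move=> /(_ dJ) /matrixP/(_ 0 0); rewrite trmx_delta -colE !mxE => /eqP.
  by rewrite subr_eq0 => /eqP.
split; first by apply/coord_subspaceP => j jJ; rewrite mxE (negPf jJ).
move=> z /coord_subspaceP zJ; apply/matrixP => a b; rewrite !mxE big1// => j _; rewrite !mxE !ord1.
by case: ifPn => jJ; [rewrite subrr mul0r|rewrite zJ// mulr0].
Qed.

Lemma convex_setP K : convex_set K <->
  forall z z' (t : R), 0 < t < 1 -> K z -> K z' -> K ((1 - t) *: z + t *: z').
Proof.
split=> [cK z z' t t01 Kz Kz'|cK].
  have t0 : 0 <= t by lra.
  have t1 : t <= 1 by lra.
  have := cK z' z (Itv01 t0 t1); rewrite !inE => /(_ Kz' Kz).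
  by rewrite /conv /= addrC.
apply/convex_setW => x y; rewrite !inE => Kx Ky k k0 k1; rewrite inE /conv /= addrC.
by apply: cK => //; rewrite k0.
Qed.

(** The projection of x that kills coordinate j belongs to K; lowering x_j moves along the segment
    from x to that projection, which convexity keeps in K. *)
Lemma anti_blocking_downset K : anti_blocking K -> downset K.
Proof.
move=> [K0 [_ _ /convex_setP cK] KJ] j x Kx; split; first exact: K0.
move=> s /andP[s0]; have [xj|xj] := eqVneq (x 0 j) 0.
  rewrite xj => s0'; have -> : s = 0 by lra.
  by rewrite -xj upd_id.
have xj0 : 0 < x 0 j by rewrite lt_neqAle eq_sym xj; exact: K0.
rewrite le_eqVlt => /orP[/eqP ->|sx]; first by rewrite upd_id.
pose J : {set 'I_n} := finset (fun i => i != j).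
have Krestr : K (restr J x).
  have : orth_proj_image (coord_subspace J) K (restr J x).
    by exists x => //; apply/is_orth_projP.
  by rewrite KJ => -[].
have [s00|sN0] := eqVneq s 0.
  move: Krestr; congr K; apply/rowP => i; rewrite !mxE finset.in_set s00.
  by case: eqVneq.
have t01 : 0 < s / x 0 j < 1.
  by rewrite divr_gt0//= ?ltr_pdivrMr ?mul1r// lt_neqAle eq_sym sN0.
have := cK _ _ _ t01 Krestr Kx; congr K; apply/rowP => i; rewrite !mxE finset.in_set.
case: eqVneq => [->|_] /=; first by rewrite mulr0 add0r divfK.
by rewrite -mulrDl subrK mul1r.
Qed.

Lemma anti_blocking_compact K : anti_blocking K -> compact K.
Proof. by move=> [_ []]. Qed.

(** The converse, used to recognize the bodies of the sharpness example: a coordinate projection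
    only lowers coordinates to 0, and compactness follows from closedness and the bound C. *)
Lemma downset_anti_blocking K (C : R) : closed K -> K 0 ->
  (forall z z' (t : R), 0 < t < 1 -> K z -> K z' -> K ((1 - t) *: z + t *: z')) ->
  (forall x i, K x -> 0 <= x 0 i <= C) ->
  (forall x y, K x -> (forall i, 0 <= y 0 i <= x 0 i) -> K y) -> anti_blocking K.
Proof.
move=> clK K0 cK KC dK.
have Kge x i : K x -> 0 <= x 0 i by move=> /(KC x i) /andP[].
split=> [x Kx i|//|J].
- exact: Kge.
- split; [by exists 0| |by apply/convex_setP].
  apply: (subclosed_compact clK (B := [set v : 'rV[R]_n | forall i, `[0, C]%classic (v ord0 i)])).
    by apply: (@rV_compact _ _ (fun=> `[0, C]%classic)) => _; exact: segment_compact.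
  by move=> x Kx i /=; rewrite in_itv/=; exact: KC.
- apply/seteqP; split => [y [x Kx /is_orth_projP ->]|y [Ky /coord_subspaceP yJ]].
    split; last by apply/coord_subspaceP => j jJ; rewrite mxE (negPf jJ).
    by apply: (dK _ _ Kx) => i; rewrite mxE; case: ifP => _; rewrite ?lexx ?Kge.
  exists y => //; apply/is_orth_projP/rowP => j; rewrite mxE.
  by case: ifPn => // /yJ.
Qed.

Lemma anti_blocking_extremal js : anti_blocking (@extremal R n js).
Proof.
apply: (@downset_anti_blocking _ 1).
- exact: closed_extremal.
- have c0 : csum js (0 : 'rV[R]_n) = 0.
    by rewrite /csum big1// => i _; rewrite mxE.
  by split; rewrite ?c0// => i; rewrite mxE ?c0 ?addr0.
- move=> z z' t t01 [z0 z1 z2] [z0' z1' z2'].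
  have t0 : 0 <= t by lra.
  have t1 : 0 <= 1 - t by lra.
  have cE : csum js ((1 - t) *: z + t *: z') = (1 - t) * csum js z + t * csum js z'.
    by rewrite /csum !mulr_sumr -big_split/=; apply: eq_bigr => i _; rewrite !mxE.
  have mix (a b : R) : a <= 1 -> b <= 1 -> (1 - t) * a + t * b <= 1.
    move=> a1 b1; apply: (@le_trans _ _ ((1 - t) * 1 + t * 1)); last by lra.
    by apply: lerD; apply: ler_wpM2l.
  split=> [i||i ijs]; first by rewrite !mxE addr_ge0// mulr_ge0.
    by rewrite cE mix.
  rewrite cE !mxE addrACA -!mulrDr; exact: mix (z2 i ijs) (z2' i ijs).
- by move=> x i; exact: extremal_le1.
- by move=> x y; exact: extremal_le.
Qed.

Definition rect (w : 'I_n -> R) : set 'rV[R]_n := [set x : 'rV[R]_n | forall i, 0 <= x 0 i <= w i].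

Lemma anti_blocking_rect (w : 'I_n -> R) : (forall i, 0 <= w i) -> anti_blocking (rect w).
Proof.
move=> w0; apply: (@downset_anti_blocking _ (\sum_i w i)).
- rewrite (_ : rect w = \bigcap_(i in setT) ([set x : 'rV[R]_n | 0 <= x 0 i] `&`
      [set x : 'rV[R]_n | x 0 i <= w i])); last first.
    apply/seteqP; split => x /= xw i; first by move=> _; have /andP[] := xw i.
    by have [-> ->] := xw i I.
  apply: closed_bigI => i _; apply: closedI; last exact: closed_coord_le.
  rewrite (_ : [set x | _] = (fun x : 'rV[R]_n => x 0 i) @^-1` [set s | 0 <= s]) //.
  by apply: preimage_closed; [move=> x _; exact: continuous_rV_coord|exact: closed_ge].
- by move=> i; rewrite mxE lexx w0.
- move=> z z' t t01 zw zw' i; rewrite !mxE.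
  have /andP[a b] := zw i; have /andP[a' b'] := zw' i.
  have t0 : 0 <= t by lra.
  have t1 : 0 <= 1 - t by lra.
  rewrite addr_ge0 ?mulr_ge0//=.
  apply: (@le_trans _ _ ((1 - t) * w i + t * w i)); last by rewrite -mulrDl subrK mul1r.
  by apply: lerD; apply: ler_wpM2l.
- move=> x i xw; have /andP[-> h] := xw i; apply: (le_trans h).
  by rewrite (bigD1 i)//= lerDl sumr_ge0.
- move=> x y xw yx i; have /andP[-> h] := yx i; apply: (le_trans h).
  by have /andP[] := xw i.
Qed.

End anti_blocking_bodies.

(** * The inequality with the constant zeta *)

Section upper_bound.
Context (R : realType) (n r : nat).
Variables (A : set 'rV[R]_n) (B : 'I_r.+1 -> set 'rV[R]_n) (s : 'I_r.+1 -> bool).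
Hypotheses (abA : anti_blocking A) (abB : forall i, anti_blocking (B i)).

Definition bodies (i : 'I_r.+2) : set 'rV[R]_n :=
  if unlift ord0 i is Some i' then B i' else A.

Definition signs (i : 'I_r.+2) : bool := if unlift ord0 i is Some i' then s i' else true.

Lemma bodies0 : bodies ord0 = A. Proof. by rewrite /bodies unlift_none. Qed.

Lemma bodiesS i : bodies (lift ord0 i) = B i. Proof. by rewrite /bodies liftK. Qed.

Lemma anti_blocking_bodies i : anti_blocking (bodies i).
Proof. by rewrite /bodies; case: unlift. Qed.

(** Indexed by the sign itself: [true] carries A with plus, [false] carries B_i with minus, so that
    the identity serves as sign function. *)
Definition pair_body (i : 'I_r.+1) (b : bool) : set 'rV[R]_n := if b then A else B i.

Lemma anti_blocking_pair i b : anti_blocking (pair_body i b).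
Proof. by rewrite /pair_body; case: b. Qed.

Lemma signed_sum_split c : signed_sum A B s = split_sum bodies signs [::] c.
Proof.
apply/seteqP; split => x.
  move=> [a Aa [_ /bigminkowskiP[k [kT ->]] <-]].
  have /choice[h hP] : forall i, exists y, B i y /\ k i = (if s i then 1 else -1) *: y.
    move=> i; have := kT i; case: (s i) => [|[y By <-]]; first by exists (k i); rewrite scale1r.
    by exists y; rewrite scaleN1r.
  exists (fun i => if unlift ord0 i is Some i' then h i' else a); split=> //.
    by move=> i; rewrite /bodies; case: unlift => // i'; have [] := hP i'.
  rewrite [RHS]big_ord_recl /signs unlift_none scale1r; congr (_ + _).
  by apply: eq_bigr => i _; rewrite liftK; have [_ ->] := hP i.
move=> [k [kK _ ->]]; exists (k ord0); first by have := kK ord0; rewrite bodies0.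
exists (\sum_i (if s i then 1 else -1) *: k (lift ord0 i)).
  apply/bigminkowskiP; exists (fun i => (if s i then 1 else -1) *: k (lift ord0 i)); split=> // i.
  have := kK (lift ord0 i); rewrite bodiesS => Bk.
  by case: (s i); rewrite ?scale1r//; exists (k (lift ord0 i)) => //; rewrite scaleN1r.
rewrite [RHS]big_ord_recl /signs unlift_none scale1r; congr (_ + _).
by apply: eq_bigr => i _; rewrite liftK.
Qed.

Lemma difference_split i c : minkowski_sum A (opp_set (B i)) = split_sum (pair_body i) id [::] c.
Proof.
apply/seteqP; split => x.
  move=> [a Aa [_ [b Bb <-] <-]]; exists (fun t => if t then a else b); split=> //.
    by case.
  by rewrite big_bool/= scale1r scaleN1r.
move=> [k [kK _ ->]]; exists (k true); first exact: (kK true).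
exists (- k false); first by exists (k false) => //; exact: (kK false).
by rewrite big_bool/= scale1r scaleN1r.
Qed.

End upper_bound.

Section volumes_of_split_sums.
Context (R : realType) (n : nat) (M C : R).
Variables (I : finType) (K : I -> set 'rV[R]_n) (eps : I -> bool).
Hypotheses (M_ge1 : 1 <= M) (CM : #|I|%:R * C <= M)
  (cK : forall i, compact (K i)) (KC : forall i x, K i x -> forall j, `|x 0 j| <= C).

Lemma lebesgue_split_sum c : lebesgue_rV n (split_sum K eps [::] c) =
  (pints M (enum 'I_n) \1_(split_sum K eps [::] c) 0)%:E.
Proof.
apply: lebesgue_rV_pints => //; first exact: measurable_split_sum.
move=> x [k [kK _ ->]] j; rewrite -ler_norml summxE; apply: le_trans CM.
apply: le_trans (ler_norm_sum _ _ _) _.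
rewrite mulr_natl -sumr_const; apply: ler_sum => i _; rewrite mxE normrM.
by case: (eps i); rewrite ?normrN normr1 mul1r; exact: KC.
Qed.

End volumes_of_split_sums.

Lemma size_filter_enum n (P : pred 'I_n) : (size [seq j <- enum 'I_n | P j] <= n)%N.
Proof. by rewrite size_filter -[X in (_ <= X)%N]size_enum_ord count_size. Qed.

Section zeta_bound.
Context (R : realType) (n r : nat).

Definition class_sizes (c : {ffun 'I_n -> 'I_r.+2}) : {ffun 'I_r.+1 -> 'I_n.+1} :=
  [ffun i => inord (size [seq j <- enum 'I_n | c j != lift ord0 i])].

Lemma class_sizesE c i :
  class_sizes c i = size [seq j <- enum 'I_n | c j != lift ord0 i] :> nat.
Proof.
by rewrite ffunE inordK// ltnS size_filter_enum.
Qed.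

Lemma sum_class_sizes c :
  (\sum_i class_sizes c i = size [seq j <- enum 'I_n | c j == ord0] + n * r)%N.
Proof. by rewrite (eq_bigr _ (fun i _ => class_sizesE c i)) sum_size_classes. Qed.

Lemma zeta_ge (alpha : {ffun 'I_r.+1 -> 'I_n.+1}) : zeta_admissible alpha ->
  zeta_d alpha <= zeta n r.+1 :> R.
Proof. by move=> ha; apply: le_bigmax_cond. Qed.

(** The class sizes of a coloring form an admissible family whose N is the number of coordinates of
    color 0, so their quotient is among those maximized in [zeta]. *)
Lemma zeta_term (c : {ffun 'I_n -> 'I_r.+2}) (N := size [seq j <- enum 'I_n | c j == ord0]) :
  \prod_(i < r.+1) ('C(size [seq j <- enum 'I_n | c j != lift ord0 i], N)%:R : R) <=
  zeta n r.+1 * 'C(n, N)%:R ^+ r.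
Proof.
have ha : zeta_admissible (class_sizes c).
  by rewrite /zeta_admissible sum_class_sizes subn1/= leq_addl.
have NE : zeta_N (class_sizes c) = N by rewrite /zeta_N sum_class_sizes subn1/= addnK.
have := zeta_ge ha; rewrite /zeta_d NE subn1/= natrX natr_prod.
rewrite ler_pdivrMr; last first.
  by rewrite exprn_gt0// ltr0n bin_gt0 size_filter_enum.
by under eq_bigr do rewrite class_sizesE.
Qed.

Lemma zeta_ge0 : 0 <= zeta n r.+1 :> R.
Proof.
by rewrite /zeta; elim/big_ind : _ => // [x y x0 y0|i _]; [rewrite le_max x0|rewrite divr_ge0].
Qed.

End zeta_bound.

Lemma sumset_bound_zeta (R : realType) (n r : nat) : @sumset_bound R n r.+1 (zeta n r.+1).
Proof.
move=> A B s abA abB.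
pose K := bodies A B.
have cK i : compact (K i) by apply/anti_blocking_compact/anti_blocking_bodies.
have dK i : downset (K i) by apply/anti_blocking_downset/anti_blocking_bodies.
have /choice[Cs CsP] : forall i, exists C : R, 0 <= C /\ forall x, K i x -> forall j, `|x 0 j| <= C.
  by move=> i; have [C C0 HC] := compact_coord_bounded (cK i); exists C.
pose C := \sum_i Cs i.
have C0 : 0 <= C by apply: sumr_ge0 => i _; have [] := CsP i.
have KC i x : K i x -> forall j, `|x 0 j| <= C.
  move=> Kx j; have [_ /(_ x Kx j) h] := CsP i; apply: (le_trans h).
  by rewrite /C (bigD1 i)//= lerDl; apply: sumr_ge0 => i' _; have [] := CsP i'.
(* Large enough for a signed sum of r + 2 bodies with coordinates bounded by C, and at least 1. *)
pose M := 1 + r.+2%:R * C.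
have rC : 0 <= r.+2%:R * C by rewrite mulr_ge0.
have M1 : 1 <= M by rewrite lerDl.
have CM : r.+2%:R * C <= M by rewrite lerDr.
have KM i x : K i x -> forall j, x 0 j <= M.
  move=> Kx j; apply: le_trans (ler_norm _) _; apply: le_trans (KC i x Kx j) _.
  by apply: le_trans CM; rewrite ler_peMl// ler1n.
pose vol (S : set 'rV[R]_n) js := pints M js \1_S 0.
have mK i : measurable (K i) by exact: compact_measurable_rV.
have vol0 i js : 0 <= vol (K i) js by apply: pints_ge0 => //; exact: bm_indic.
have KA : K ord0 = A by exact: bodies0.
have KB i : K (lift ord0 i) = B i by exact: bodiesS.
have lA : lebesgue_rV n A = (vol A (enum 'I_n))%:E.
  rewrite -KA; apply: lebesgue_rV_pints => // x Kx j; rewrite -ler_norml.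
  by apply: le_trans (KC _ _ Kx j) _; apply: le_trans CM; rewrite ler_peMl// ler1n.
pose T (c : {ffun 'I_n -> 'I_r.+2}) i := [seq j <- enum 'I_n | c j == i].
pose Tc (c : {ffun 'I_n -> 'I_r.+2}) i := [seq j <- enum 'I_n | c j != i].
have lS : exists2 v, lebesgue_rV n (signed_sum A B s) = v%:E &
    v <= \sum_c \prod_i vol (K i) (T c i).
  pose c0 : {ffun 'I_n -> 'I_r.+2} := [ffun=> ord0].
  rewrite (signed_sum_split _ _ _ c0).
  have CM' : #|'I_r.+2|%:R * C <= M by rewrite card_ord.
  rewrite (@lebesgue_split_sum _ _ _ _ _ _ (signs s) M1 CM' cK KC).
  eexists; first reflexivity.
  have := @volume_split_sum_le _ _ _ M1 _ _ (signs s) cK dK KM c0.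
  rewrite card_ord => /(_ isT) /le_trans; apply; apply: ler_sum => c _.
  by rewrite (volume_split_sum_full M1 (signs s) cK).
have lD i : exists2 v, lebesgue_rV n (minkowski_sum A (opp_set (B i))) = v%:E &
    \sum_(c : {ffun 'I_n -> bool})
      vol A [seq j <- enum 'I_n | c j] * vol (B i) [seq j <- enum 'I_n | ~~ c j] <= v.
  pose c0 : {ffun 'I_n -> bool} := [ffun=> true].
  rewrite (difference_split _ _ _ c0).
  have pK b : exists i', pair_body A B i b = K i'.
    by case: b; [exists ord0; rewrite KA|exists (lift ord0 i); rewrite KB].
  have cP b : compact (pair_body A B i b) by have [i' ->] := pK b.
  have dP b : downset (pair_body A B i b) by have [i' ->] := pK b.
  have CP b x : pair_body A B i b x -> forall j, `|x 0 j| <= C.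
    by have [i' ->] := pK b; exact: KC.
  have MP b x : pair_body A B i b x -> forall j, x 0 j <= M.
    by have [i' ->] := pK b; exact: KM.
  have CM' : #|{: bool}|%:R * C <= M.
    by rewrite card_bool; apply: le_trans CM; rewrite ler_wpM2r// ler_nat.
  rewrite (@lebesgue_split_sum _ _ _ _ _ _ id M1 CM' cP CP).
  eexists; first reflexivity.
  apply: le_trans (volume_split_sum_ge M1 cP dP c0); apply: ler_sum => c _.
  rewrite (volume_split_sum_full M1 id cP) big_bool /vol /=.
  rewrite le_eqVlt; apply/orP; left; apply/eqP.
  by congr (_ * _); apply: (congr1 (fun js => pints M js _ 0)); apply: eq_filter => j; case: (c j).
have [v -> vle] := lS; rewrite subn1/= lA.
have /choice[d dP] : forall i, exists v : R,
   lebesgue_rV n (minkowski_sum A (opp_set (B i))) = v%:E /\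
    \sum_(c : {ffun 'I_n -> bool})
      vol A [seq j <- enum 'I_n | c j] * vol (B i) [seq j <- enum 'I_n | ~~ c j] <= v.
  by move=> i; have [w ? ?] := lD i; exists w.
rewrite (eq_bigr (fun i => (d i)%:E)); last by move=> i _; have [] := dP i.
rewrite prodEFin -EFin_expe -!EFinM lee_fin.
have Ad i : \sum_(c : {ffun 'I_n -> bool})
      vol A [seq j <- enum 'I_n | c j] * vol (B i) [seq j <- enum 'I_n | ~~ c j] <= d i.
  by have [] := dP i.
have volA js : 0 <= vol A js by rewrite -KA.
have volB i js : 0 <= vol (B i) js by rewrite -KB.
apply: (@le_trans _ _ (zeta n r.+1 * \prod_i \sum_(c : {ffun 'I_n -> bool})
      vol A [seq j <- enum 'I_n | c j] * vol (B i) [seq j <- enum 'I_n | ~~ c j])); last first.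
  rewrite ler_wpM2l ?zeta_ge0//; apply: ler_prod => i _; rewrite Ad andbT.
  by apply: sumr_ge0 => c _; rewrite mulr_ge0.
(* The product of the r + 1 sums over subsets becomes one sum over families of subsets. *)
rewrite bigA_distr_bigA/=.
pose g (h : {ffun 'I_r.+1 -> {ffun 'I_n -> bool}}) := \prod_i
   (vol A [seq j <- enum 'I_n | h i j] * vol (B i) [seq j <- enum 'I_n | ~~ h i j]).
have g0 h : 0 <= g h by apply: prodr_ge0 => i _; rewrite mulr_ge0.
(* A coloring selects the family whose i-th member is the complement of a color class. Distinct
   colorings select distinct families, and the families not selected contribute nonnegative terms,
   which are dropped. *)
pose phi (c : {ffun 'I_n -> 'I_r.+2}) : {ffun 'I_r.+1 -> {ffun 'I_n -> bool}} :=
  [ffun i => [ffun j => c j != lift ord0 i]].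
have phi_inj : injective phi.
  move=> c c' cc'; apply/ffunP => j.
  have cE i : (c j == lift ord0 i) = (c' j == lift ord0 i).
    have := congr1 (fun h : {ffun 'I_r.+1 -> {ffun 'I_n -> bool}} => h i j) cc'.
    by rewrite /phi !ffunE => /negb_inj.
  have [i ci|ci] := unliftP ord0 (c j).
    by have := cE i; rewrite ci eqxx => /esym/eqP ->.
  have [i ci'|->//] := unliftP ord0 (c' j).
  by have := cE i; rewrite ci' eqxx => /eqP ->.
apply: (@le_trans _ _ (zeta n r.+1 * \sum_c g (phi c))); last first.
  rewrite ler_wpM2l ?zeta_ge0//.
  rewrite -(big_imset g (A := predT) (h := phi))/=; last by move=> c c' _ _; exact: phi_inj.
  rewrite [X in _ <= X](bigID (mem (phi @: predT)))/= lerDl; apply: sumr_ge0 => h _.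
  exact: g0.
apply: le_trans (ler_wpM2l (exprn_ge0 r (volA _)) vle) _.
rewrite !mulr_sumr; apply: ler_sum => c _.
(* The volumes of the B_i agree on both sides, so what remains for each coloring is an inequality on
   A alone: [reverse_Bezout] divided by C(n,N)^r. *)
rewrite big_ord_recl KA /g big_split/= mulrA.
have PB : \prod_i vol (K (lift ord0 i)) (T c (lift ord0 i)) =
    \prod_i vol (B i) [seq j <- enum 'I_n | ~~ phi c i j].
  apply: eq_bigr => i _; rewrite KB; congr vol; apply: eq_filter => j.
  by rewrite !ffunE negbK.
have PA : \prod_i vol A [seq j <- enum 'I_n | phi c i j] = \prod_i vol A (Tc c (lift ord0 i)).
  by apply: eq_bigr => i _; congr vol; apply: eq_filter => j; rewrite !ffunE.
rewrite PB PA mulrA; apply: ler_wpM2r; first exact: prodr_ge0.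
have mA : measurable A by rewrite -KA.
have dA : downset A by rewrite -KA.
have cA : forall z z' (t : R), 0 < t < 1 -> A z -> A z' -> A ((1 - t) *: z + t *: z').
  by apply/convex_setP; have [_ []] := abA.
have := reverse_Bezout M1 c mA dA cA; rewrite -/(T c ord0) -/(vol A _) -/(vol A _).
set N := size _; rewrite big_split/= => H.
have Cn0 : 0 < 'C(n, N)%:R ^+ r :> R.
  by rewrite exprn_gt0// ltr0n bin_gt0 size_filter_enum.
rewrite -(ler_pM2l Cn0) mulrA -exprMn; apply: (le_trans H).
rewrite mulrA; apply: ler_wpM2r; first by apply: prodr_ge0 => i _; exact: volA.
by rewrite mulrC; exact: zeta_term.
Qed.

(** * Optimality of the constant *)

Lemma coloring_exists (n r : nat) (k : 'I_r.+1 -> nat) (N : nat) : (\sum_i k i + N = n)%N ->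
  exists c : {ffun 'I_n -> 'I_r.+2},
    size [seq j <- enum 'I_n | c j == ord0] = N /\
    forall i, size [seq j <- enum 'I_n | c j == lift ord0 i] = k i.
Proof.
(* The colors are read off a list of length n that contains each color with the prescribed
   multiplicity. *)
move=> kN; pose L := flatten [seq nseq (k i) (lift ord0 i) | i <- enum 'I_r.+1] ++ nseq N ord0.
have sL : size L = n.
  rewrite size_cat size_nseq size_flatten /shape -map_comp sumnE big_map big_enum/= -[RHS]kN.
  congr (_ + _)%N.
  by apply: eq_bigr => i _; rewrite size_nseq.
exists [ffun j : 'I_n => nth ord0 L j].
have E a : size [seq j <- enum 'I_n | [ffun j : 'I_n => nth ord0 L j] j == a] = count_mem a L.
  rewrite size_filter -[in RHS](mkseq_nth ord0 L) /mkseq sL -val_enum_ord -map_comp [RHS]count_map.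
  by apply: eq_count => j; rewrite /= ffunE.
rewrite E; split=> [|i]; rewrite ?E count_cat count_nseq count_flatten -map_comp sumnE big_map
  big_enum/=.
  by rewrite ?mul1n big1// => i _; rewrite count_nseq.
rewrite addn0 (bigD1 i)//= count_nseq /= eqxx mul1n big1 ?addn0// => i' ii'.
by rewrite count_nseq /= (inj_eq lift_inj) (negPf ii').
Qed.

(** Replaces the limit of (t / (t + 1))^q by Bernoulli's inequality at one sufficiently large t. *)
Lemma le_of_asymptotic (R : realType) (q : nat) (X Y : R) : 0 <= X ->
  (forall t, 1 <= t -> X * t ^+ q <= Y * (t + 1) ^+ q) -> X <= Y.
Proof.
move=> X0 XY; rewrite leNgt; apply/negP => YX.
(* Chosen so that X q / (t + 1) < X - Y. *)
pose t := 1 + q%:R * X / (X - Y).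
have d0 : 0 < X - Y by lra.
have t1 : 1 <= t by rewrite lerDl divr_ge0 ?mulr_ge0// ltW.
have t0 : 0 < t + 1 by lra.
have := XY t t1; rewrite -ler_pdivrMr ?exprn_gt0// -mulrA -expr_div_n => h.
have : 1 - q%:R / (t + 1) <= (t / (t + 1)) ^+ q.
  case: (q) => [|k]; first by rewrite mul0r subr0 expr0.
  have := @exprS_tangent _ k (t / (t + 1)) 1 _ ler01; rewrite !expr1n mulr1 => H.
  apply: le_trans (H _); last by rewrite divr_ge0; lra.
  rewrite le_eqVlt; apply/orP; left; apply/eqP; field.
  by rewrite gt_eqF.
move=> /(ler_wpM2l X0) /le_trans/(_ h).
rewrite mulrBr mulr1 => h2.
have : X * (q%:R / (t + 1)) < X - Y.
  rewrite mulrA ltr_pdivrMr// /t mulrDr mulrDr.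
  rewrite (mulrC _ (_ / _)) divfK ?gt_eqF// mulrC; lra.
lra.
Qed.

Section sharpness.
Context (R : realType) (n r : nat) (C : R).
Hypothesis boundC : @sumset_bound R n r.+1 C.
Variable c : {ffun 'I_n -> 'I_r.+2}.

Local Notation js := [seq j <- enum 'I_n | c j == ord0].
Local Notation us := [seq j <- enum 'I_n | c j != ord0].
Local Notation Is i := [seq j <- enum 'I_n | c j == lift ord0 i].
Local Notation Es i := [seq j <- enum 'I_n | c j != lift ord0 i].
Local Notation N := (size js).
Local Notation q := (size us).

Let A : set 'rV[R]_n := extremal js.
Let B (t : R) (i : 'I_r.+1) : set 'rV[R]_n := rect (fun j => if c j == lift ord0 i then t else 0).

Let mA : measurable A. Proof. exact: measurable_extremal. Qed.
Let bA : bm (\1_A : 'rV[R]_n -> R). Proof. exact: bm_indic. Qed.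

Variables (M t : R).
Hypotheses (t1 : 1 <= t) (M1 : 1 <= M) (tM' : 2 * t <= M).

Let t_ge0 : 0 <= t. Proof. exact: le_trans t1. Qed.

Let abA : anti_blocking A. Proof. exact: anti_blocking_extremal. Qed.
Let abB i : anti_blocking (B t i).
Proof. by apply: anti_blocking_rect => j; case: ifP => _ //; have := t1; lra. Qed.

Let K := bodies A (B t).
Let cK i : compact (K i). Proof. exact/anti_blocking_compact/anti_blocking_bodies. Qed.
Let c0 : {ffun 'I_n -> 'I_r.+2} := c.
Let S := split_sum K (signs (fun=> true)) [::] c0.

Let Kt i x : K i x -> forall j, `|x 0 j| <= t.
Proof.
rewrite /K /bodies; case: (unlift ord0 i) => [i'|] Kx j.
  have /andP[x0] := Kx j; rewrite ger0_norm// => h; apply: (le_trans h).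
  by case: ifP => _ //; have := t1; lra.
by have /andP[x0 x1] := extremal_le1 j Kx; rewrite ger0_norm//; have := t1; lra.
Qed.

Let bS : bm (\1_S : 'rV[R]_n -> R).
Proof. by apply: bm_indic; exact: measurable_split_sum. Qed.

(** The sum contains the product of the section of A in the coordinates of color 0 with the cube
    [0, t] in all the others. *)
Let sumset_volume_ge : t ^+ q * pints M js \1_A 0 <= pints M (enum 'I_n) \1_S 0.
Proof.
have P : perm_eq (enum 'I_n) (js ++ us).
  by rewrite perm_sym perm_catC perm_free_base.
have t0 : 0 <= t ^+ q by rewrite exprn_ge0// ?addr_ge0.
rewrite (perm_pints M1 bS P) pints_cat -pintsZ//.
apply: pints_le_out => //; [by apply: bmM => //; exact: bm_cst|exact: bm_pints|].
move=> y y0; have [/set_mem Ay|yA] := boolP (y \in A); last first.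
  by rewrite indicE (negPf yA) mulr0 pints_ge0.
rewrite indicE mem_set// mulr1 -[t in t ^+ _]subr0.
rewrite -(@pints_box _ _ _ M1 us 0 t y) ?uniq_free_coords//; [|have := tM'; have := t1; lra..].
apply: pints_le_out => //; first by apply: bm_indic; exact: measurable_box.
move=> z zy; apply: indic_le => zb.
have zus j : c j != ord0 -> 0 <= z 0 j <= t by move=> cj; apply: zb; rewrite mem_filter_enum.
have zjs j : c j == ord0 -> z 0 j = y 0 j.
  by move=> cj; apply: zy; rewrite mem_filter_enum negbK.
exists (fun i => \row_j if c j == i then z 0 j else 0); split=> //.
  move=> i; have [i' ->|->] := unliftP ord0 i; rewrite /K ?bodiesS ?bodies0.
    move=> j; rewrite mxE; case: eqVneq => [cj|_]; last by rewrite lexx.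
    by apply: zus; rewrite cj.
  apply: (extremal_le Ay) => j; rewrite mxE; have [Ay0 _ _] := Ay.
  by case: ifP => [/zjs ->|_]; rewrite ?lexx ?Ay0.
apply/rowP => j; rewrite summxE (bigD1 (c j))//= !mxE eqxx big1 ?addr0.
  by rewrite /signs; case: unlift => *; rewrite mul1r.
by move=> i ij; rewrite !mxE eq_sym (negPf ij) mulr0.
Qed.

Let c1 : {ffun 'I_n -> bool} := [ffun=> true].
Let D i := split_sum (pair_body A (B t) i) id [::] c1.

Let cD i b : compact (pair_body A (B t) i b).
Proof. exact/anti_blocking_compact/anti_blocking_pair. Qed.

Let bD i : bm (\1_(D i) : 'rV[R]_n -> R).
Proof. by apply: bm_indic; exact: measurable_split_sum. Qed.

(** The difference lies in the product of P_{E_i} A with the cube [-t, 1] in the coordinates of B_i,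
    because A has coordinates in [0, 1]. The excess of t + 1 over t is lost only in the limit. *)
Let difference_volume_le i : pints M (enum 'I_n) \1_(D i) 0 <=
  (t + 1) ^+ size (Is i) * pints M (Es i) \1_A 0.
Proof.
have P : perm_eq (enum 'I_n) (Es i ++ Is i).
  apply: uniq_perm; [exact: enum_uniq| |].
    have u P : uniq [seq j <- enum 'I_n | P j] by rewrite filter_uniq// enum_uniq.
    rewrite cat_uniq !u andbT; apply/hasPn => j.
    by rewrite !mem_filter_enum negbK.
  by move=> j; rewrite mem_cat !mem_filter_enum mem_enum orNb.
have t0 : 0 <= (t + 1) ^+ size (Is i) by rewrite exprn_ge0// ?addr_ge0.
rewrite (perm_pints M1 (bD i) P) pints_cat -pintsZ//.
apply: pints_le_out => //; [exact: bm_pints|by apply: bmM => //; exact: bm_cst|].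
move=> y y0.
have key (z : 'rV[R]_n) : (forall j, j \notin Is i -> z 0 j = y 0 j) -> D i z ->
    A y /\ box (Is i) (- t) 1 z.
  move=> zy [k [kK _ zE]].
  have Ak : A (k true) by exact: (kK true).
  have Bk : B t i (k false) by exact: (kK false).
  have zj j : z 0 j = k true 0 j - k false 0 j.
    by rewrite zE big_bool/= !mxE mul1r mulN1r.
  split.
    apply: (extremal_le Ak) => j; have /andP[k0 _] := extremal_le1 j Ak.
    have [cj|cj] := eqVneq (c j) (lift ord0 i).
      by rewrite y0 ?mxE ?lexx// mem_filter_enum cj eqxx.
    have := Bk j; rewrite (negPf cj) => kf; rewrite -zy ?mem_filter_enum// zj; lra.
  move=> j; rewrite mem_filter_enum => cj; have := Bk j; rewrite cj zj.
  by have := extremal_le1 j Ak; lra.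
have [/set_mem Ay|yA] := boolP (y \in A); last first.
  rewrite indicE (negPf yA) mulr0 -(pints0 M (Is i) y).
  apply: pints_le_out => //; first exact: bm_cst.
  move=> z zy; rewrite indicE memNset// => /(key z zy)[Ay _].
  by move/negP: yA; apply; rewrite inE.
rewrite indicE mem_set// mulr1 addrC -[t in 1 + t]opprK.
have uI : uniq (Is i) by rewrite filter_uniq// enum_uniq.
rewrite -(@pints_box _ _ _ M1 (Is i) (- t) 1 y)//; [|have := tM'; have := t1; lra..].
apply: pints_le_out => //; first by apply: bm_indic; exact: measurable_box.
by move=> z zy; apply: indic_le => /(key z zy)[].
Qed.

Hypothesis tM : r.+2%:R * t <= M.

Lemma extremal_inequality :
  pints M (enum 'I_n) \1_A 0 ^+ r * (t ^+ q * pints M js \1_A 0) <=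
    C * \prod_i ((t + 1) ^+ size (Is i) * pints M (Es i) \1_A 0).
Proof.
have Kall : #|'I_r.+2|%:R * t <= M by rewrite card_ord.
have lA : lebesgue_rV n A = (pints M (enum 'I_n) \1_A 0)%:E.
  apply: lebesgue_rV_pints => // x Ax j; have := extremal_le1 j Ax; have := M1; lra.
have lS : lebesgue_rV n (signed_sum A (B t) (fun=> true)) = (pints M (enum 'I_n) \1_S 0)%:E.
  by rewrite (signed_sum_split _ _ _ c0); apply: lebesgue_split_sum Kt _ => //.
have lD i : lebesgue_rV n (minkowski_sum A (opp_set (B t i))) =
    (pints M (enum 'I_n) \1_(D i) 0)%:E.
  rewrite (difference_split _ _ _ c1).
  apply: (@lebesgue_split_sum _ _ _ t) => //; first by rewrite card_bool.
  move=> b x; case: b => [Ax|Bx] j; first by apply: (Kt (i := ord0)); rewrite /K bodies0.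
  by apply: (Kt (i := lift ord0 i)); rewrite /K bodiesS.
have := boundC (fun=> true) abA abB; rewrite subn1/= lA lS.
rewrite (eq_bigr (fun i => (pints M (enum 'I_n) \1_(D i) 0)%:E)); last by move=> i _; exact: lD.
rewrite prodEFin -EFin_expe -!EFinM lee_fin => H.
have a0 ls : 0 <= pints M ls \1_A 0 by exact: pints_ge0.
have apos : 0 < pints M (enum 'I_n) \1_A 0 ^+ r * pints M (enum 'I_n) \1_S 0.
  have pos ls js' : perm_eq ls (js' ++ js) -> uniq js' -> (forall i, i \in js' -> i \notin js) ->
      0 < pints M ls \1_A 0.
    move=> P us' js'js; rewrite (perm_pints M1 bA P).
    rewrite (pints_extremal M1 (uniq_base_coords c) us' js'js).
    by rewrite divr_gt0// ltr0n fact_gt0.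
  rewrite mulr_gt0// ?exprn_gt0//.
    apply: pos (uniq_free_coords c) _; first by rewrite perm_sym perm_free_base.
    by move=> j; exact: free_coords_base.
  apply: lt_le_trans sumset_volume_ge; rewrite mulr_gt0// ?exprn_gt0//; first exact: lt_le_trans t1.
  exact: (pos _ [::]).
have dpos : 0 <= \prod_i pints M (enum 'I_n) \1_(D i) 0.
  by apply: prodr_ge0 => i _; exact: pints_ge0.
(* The sign of C is not given; it follows because the left side is positive. *)
have Cge0 : 0 <= C.
  rewrite leNgt; apply/negP => C0; have := lt_le_trans apos H.
  by rewrite ltNge mulr_le0_ge0// ltW.
apply: (@le_trans _ _ (pints M (enum 'I_n) \1_A 0 ^+ r * pints M (enum 'I_n) \1_S 0)).
  by apply: ler_wpM2l => //; rewrite exprn_ge0.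
apply: (le_trans H); apply: ler_wpM2l => //; apply: ler_prod => i _.
by rewrite pints_ge0//=; exact: difference_volume_le.
Qed.

End sharpness.

Lemma zeta_sharp (R : realType) (n r : nat) (C : R) :
  @sumset_bound R n r.+1 C -> zeta n r.+1 <= C.
Proof.
move=> boundC.
have key (alpha : {ffun 'I_r.+1 -> 'I_n.+1}) : zeta_admissible alpha -> zeta_d alpha <= C.
  move=> ha; set N := zeta_N alpha.
  (* The classes get sizes n - alpha_i and N. Admissibility makes the truncated subtraction in N
     exact, so the sizes add up to n. *)
  have Nn : (\sum_i (n - alpha i) + N = n)%N.
    have : (\sum_i (n - alpha i) + \sum_i alpha i = r.+1 * n)%N.
      rewrite -big_split/= (eq_bigr (fun _ => n)).
        by rewrite sum_nat_const card_ord.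
      by move=> i _; rewrite subnK// -ltnS.
    move: ha; rewrite /N /zeta_N /zeta_admissible subn1/= mulSn (mulnC r).
    by move=> h E; rewrite addnBA// E addnK.
  have [c [sN sI]] := coloring_exists Nn.
  pose js := [seq j <- enum 'I_n | c j == ord0].
  pose us := [seq j <- enum 'I_n | c j != ord0].
  pose Es i := [seq j <- enum 'I_n | c j != lift ord0 i].
  pose a (M : R) ls : R := pints M ls \1_(@extremal R n js) 0.
  have sEs i : size (Es i) = alpha i.
    have E : (n - alpha i + size (Es i) = n)%N.
      rewrite -(sI i) !size_filter -[RHS](size_enum_ord n).
      exact: (count_predC (fun j => c j == lift ord0 i)).
    have an : (alpha i <= n)%N by rewrite -ltnS.
    by apply/eqP; rewrite -(eqn_add2l (n - alpha i)) E subnK.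
  (* A volume k! / (k + N)! times C(k + N, N) is 1 / N! for every k, so quotients of these volumes
     reproduce the binomials of [zeta_d]. *)
  have aval (M : R) ls ys : 1 <= M -> perm_eq ls (ys ++ js) -> uniq ys ->
      (forall i, i \in ys -> i \notin js) -> a M ls * 'C(size ls, N)%:R = N`!%:R^-1.
    move=> M1 P uys ysjs.
    have bE : bm (\1_(@extremal R n js) : 'rV[R]_n -> R).
      by apply: bm_indic; exact: measurable_extremal.
    rewrite /a (perm_pints M1 bE P) pints_extremal ?uniq_base_coords// (perm_size P) size_cat.
    rewrite -/js in sN *; rewrite sN.
    have := bin_fact (leq_addl (size ys) N); rewrite addnK => <-.
    rewrite !natrM; field.
    by rewrite !pnatr_eq0 -!lt0n !fact_gt0 bin_gt0 leq_addl.
  have usval (M : R) : 1 <= M -> a M (enum 'I_n) * 'C(n, N)%:R = N`!%:R^-1.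
    move=> M1; rewrite -[X in 'C(X, _)](size_enum_ord n).
    apply: (aval M _ us) => //; first by rewrite perm_sym perm_free_base.
      exact: uniq_free_coords.
    by move=> i; exact: free_coords_base.
  have jsval (M : R) : 1 <= M -> a M js = N`!%:R^-1.
    move=> M1; have := aval M js [::] M1 (perm_refl _) isT.
    by rewrite {2}/js sN binn mulr1; apply.
  have Esval (M : R) i : 1 <= M -> a M (Es i) * 'C(alpha i, N)%:R = N`!%:R^-1.
    move=> M1; rewrite -sEs; apply: (aval M _ [seq j <- us | color_index c j != i]) => //.
    - by rewrite perm_sym perm_class_coords.
    - exact: uniq_class_coords.
    - by move=> j; exact: class_coords_base.
  have NF : N`!%:R != 0 :> R by rewrite pnatr_eq0 -lt0n fact_gt0.
  pose a0 : R := N`!%:R^-1.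
  have a00 : 0 < a0 by rewrite invr_gt0 ltr0n fact_gt0.
  have Cn0 : 0 < 'C(n, N)%:R :> R by rewrite ltr0n bin_gt0 -Nn leq_addl.
  have Ca0 i : 0 < 'C(alpha i, N)%:R :> R.
    rewrite ltr0n bin_gt0 -sEs /Es -sN.
    rewrite -(perm_size (perm_class_coords c i)) size_cat leq_addl//.
  pose aE i : R := a0 / 'C(alpha i, N)%:R.
  pose aN : R := a0 / 'C(n, N)%:R.
  have qE : (\sum_i size [seq j <- enum 'I_n | c j == lift ord0 i] = size us)%N.
    rewrite (eq_bigr (fun i => n - alpha i)%N); last by move=> i _; exact: sI.
    apply/eqP; rewrite -(eqn_add2r N) Nn.
    by have := perm_size (perm_free_base c); rewrite size_cat sN size_enum_ord => ->.
  (* The class sizes sum to q, so t enters only through t^q against (t + 1)^q and disappears as it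
     grows. *)
  have H : aN ^+ r * a0 <= C * \prod_i aE i.
    apply: (@le_of_asymptotic _ (size us)); first by rewrite mulr_ge0 ?exprn_ge0 ?divr_ge0// ltW.
    move=> t t1; pose M := r.+2%:R * t.
    have t0 : 0 <= t by exact: le_trans t1.
    have M1 : 1 <= M by apply: le_trans t1 _; rewrite ler_peMl ?ler1n.
    have tM : 2 * t <= M by rewrite ler_wpM2r ?ler_nat.
    have := extremal_inequality boundC c t1 M1 tM (lexx _).
    rewrite -/us -/js -/(a M _) -/(a M _).
    have -> : a M (enum 'I_n) = aN by rewrite /aN /a0 -(usval M M1) mulfK ?gt_eqF.
    rewrite (jsval M M1) -/a0.
    rewrite (eq_bigr (fun i => (t + 1) ^+ size [seq j <- enum 'I_n | c j == lift ord0 i] * aE i)).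
      rewrite big_split/= -expr_sum qE => h.
      by rewrite -mulrA (mulrC a0) -[X in _ <= X]mulrA (mulrC (\prod_i _)).
    by move=> i _; rewrite /aE /a0 -(Esval M i M1) mulfK ?gt_eqF.
  have PE : 0 < \prod_i aE i by apply: prodr_gt0 => i _; rewrite divr_gt0.
  rewrite -(ler_pM2r PE); apply: le_trans H; rewrite le_eqVlt; apply/orP; left; apply/eqP.
  rewrite /zeta_d -/N subn1/= natrX natr_prod mulrAC -big_split/=.
  rewrite (eq_bigr (fun _ => a0)); last by move=> i _; rewrite /aE mulrC divfK// gt_eqF.
  by rewrite prodr_const card_ord exprSr /aN expr_div_n mulrAC.
rewrite /zeta; apply: bigmax_le => [|alpha ha]; last exact: key.
(* The default value 0 of the maximum requires 0 <= C, which follows from the admissible constant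
   family n. *)
pose full : {ffun 'I_r.+1 -> 'I_n.+1} := [ffun=> ord_max].
apply: (@le_trans _ _ (zeta_d full)); first by rewrite divr_ge0.
apply: key; rewrite /zeta_admissible (eq_bigr (fun _ => n)); last by move=> i _; rewrite ffunE.
by rewrite sum_nat_const card_ord subn1/= mulnC leq_mul2r leqnSn orbT.
Qed.

Theorem corollary10 (R : realType) (n m : nat) (n_ge1 : (1 <= n)%N)
    (m_ge1 : (1 <= m)%N) :
  sumset_bound n m (zeta n m : R) /\
  (forall C : R, sumset_bound n m C -> zeta n m <= C).
Proof.
case: m m_ge1 => // r _; split; first exact: sumset_bound_zeta.
by move=> C; exact: zeta_sharp.
Qed.
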